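(* Let $d>1$, let $\{f_n\}_{n\in\mathbb{N}}$ be a $d$-decaying Gauss like iterated function system, let $a>0$, and let $\varphi$ be the potential function with $\varphi(j)=j^a$ for all $j\ge 1$. (I) When $\Phi(n)=e^{n^\alpha}$ with $\alpha>0$: (I-1) $\dim_H E_\varphi(\Phi)=1$ if $\alpha<\frac12$ and $\{f_n\}$ satisfies the bounded distortion property; (I-2) $\dim_H E_\varphi(\Phi)=\frac1d$ if $\alpha>\frac12$. (II) When $\Phi(n)=e^{\beta^n}$ with $\beta>1$, $\dim_H E_\varphi(\Phi)=\frac{1}{d\beta-\beta+1}$.
   Context: $\mathbb{N}=\{1,2,\dots\}$; $\dim_H$ denotes Hausdorff dimension. Let $d>1$ be real. A family $\{f_n\}_{n\in\mathbb{N}}$ of $C^1$ maps from $[0,1]$ to itself is a $d$-decaying Gauss like iterated function system if: (1) for any $i\ne j$ in $\mathbb{N}$, $f_i((0,1))\cap f_j((0,1))=\emptyset$; (2) $\bigcup_{i=1}^\infty f_i([0,1])=[0,1)$; (3) if $f_i(x)<f_j(x)$ for all $x\in(0,1)$ then $i<j$; (4) there exist $m\in\mathbb{N}$ and $0<A<1$ such that for all $(a_1,\dots,a_m)\in\mathbb{N}^m$ and all $x\in[0,1]$, $0<|(f_{a_1}\circ\cdots\circ f_{a_m})'(x)|\le A<1$; (5) for any $\delta>0$ there are constants $K_1=K_1(\delta)>0$, $K_2=K_2(\delta)>0$ such that for each $i\in\mathbb{N}$ there exist constants $\xi_i,\lambda_i$ with $\frac{K_1}{i^{d+\delta}}\le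 \xi_i\le |f_i'(x)|\le\lambda_i\le \frac{K_2}{i^{d-\delta}}$ for all $x\in[0,1]$. The basic interval of order $n$ of a word $a_1\cdots a_n\in\mathbb{N}^n$ is $I_n(a_1,\dots,a_n)=f_{a_1}\circ\cdots\circ f_{a_n}([0,1])$, and $|I|$ is the diameter of an interval $I$. All but countably many $x\in[0,1]$ have a unique symbolic expansion $(a_1(x),a_2(x),\dots)\in\mathbb{N}^{\mathbb{N}}$ with $x=\lim_{n\to\infty}f_{a_1(x)}\circ\cdots\circ f_{a_n(x)}(1)$. Bounded distortion property: there exist constants $K_3,K_4>0$ such that for any two finite words $a_1\cdots a_n$ and $b_1\cdots b_m$ over $\mathbb{N}$, $K_3\le \frac{|I_{n+m}(a_1,\dots,a_n,b_1,\dots,b_m)|}{|I_n(a_1,\dots,a_n)|\cdot|I_m(b_1,\dots,b_m)|}\le K_4$. A potential function is a function $\varphi:[0,1]\to\mathbb{R}_+$ that is constant on the interior of each $I_1(j)$, $j\in\mathbb{N}$; $\varphi(j)$ denotes this constant value. Its Birkhoff sums are $S_n\varphi(x)=\sum_{k=1}^n\varphi(a_k)$ if $x\in I_n(a_1,\dots,a_n)$; these are well defined outside a countable set (which does not affect Hausdorff dimension). For $\Phi:\mathbb{N}\to\mathbb{R}_+$, $E_\varphi(\Phi)=\{x\in(0,1):\lim_{n\to\infty}S_n\varphi(x)/\Phi(n)=1\}$. *)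

(* Defs.v *)
From HB Require Import structures.
From mathcomp Require Import all_boot all_order all_algebra.
From mathcomp Require Import all_classical all_reals all_analysis.
Set Implicit Arguments.
Unset Strict Implicit.
Unset Printing Implicit Defensive.
Import Order.TTheory GRing.Theory Num.Theory numFieldNormedType.Exports.
Local Open Scope classical_set_scope.
Local Open Scope ring_scope.

Section HausdorffDimension.
Context {R : realType}.
Implicit Types (A : set R) (U : nat -> set R) (s delta : R).

(* The diameter of set0 is -oo here; [gauge] treats set0 separately. *)
Definition diam A : \bar R := ereal_sup [set `|p.1 - p.2|%:E | p in A `*` A].

Definition gauge s A : \bar R :=
  if A == set0 then 0%E else poweR (diam A) s.

Definition delta_cover delta A U : Prop :=
  A `<=` \bigcup_k U k /\ forall k, (diam (U k) <= delta%:E)%E.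

Definition hausdorff_pre s delta A : \bar R :=
  ereal_inf [set (\sum_(0 <= k <oo) gauge s (U k))%E | U in delta_cover delta A].

Definition hausdorff_measure s A : \bar R :=
  ereal_sup [set hausdorff_pre s delta A | delta in [set delta | 0 < delta]].

Definition hausdorff_dim A : \bar R :=
  ereal_inf [set s%:E | s in [set s | 0 <= s /\ hausdorff_measure s A = 0%E]].

End HausdorffDimension.

Section GaussLikeIFS.
Context {R : realType}.
Implicit Types (f : nat -> R -> R) (g phi : R -> R) (w : seq nat) (Phi : nat -> R).

(* Maps of [0, 1] are total functions on R whose values outside [0, 1] are
   irrelevant, so derivatives are taken relative to [0, 1]: they are one-sided
   at 0 and 1. *)
Definition has_deriv01 g (x l : R) : Prop :=
  (g y - g x) / (y - x) @[y --> within `[0, 1] x^'] --> l.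

Definition deriv01 g (x : R) : R :=
  lim ((g y - g x) / (y - x) @[y --> within `[0, 1] x^']).

Definition C1_on01 g : Prop :=
  (forall x, x \in `[0, 1] -> has_deriv01 g x (deriv01 g x)) /\
  {within `[0, 1], continuous (deriv01 g)}.

(* The alphabet is {1, 2, ...}: a family f is only looked at on positive
   indices, and f 0 plays no role. *)
Definition word w : Prop := all (fun i => (0 < i)%N) w.

(* comp_word f [:: a1; ...; an] x = f a1 (... (f an x)) *)
Definition comp_word f w (x : R) : R := foldr f x w.

Definition basic_interval f w : set R := comp_word f w @` `[0, 1].

Record d_decaying_gauss_like (d : R) f : Prop := DDecayingGaussLike {
  dgl_self : forall i x, (0 < i)%N -> x \in `[0, 1] -> f i x \in `[0, 1];
  dgl_C1 : forall i, (0 < i)%N -> C1_on01 (f i);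
  dgl_disjoint : forall i j, (0 < i)%N -> (0 < j)%N -> i <> j ->
    (f i @` `]0, 1[) `&` (f j @` `]0, 1[) = set0;
  dgl_union :
    \bigcup_(i in [set i | (0 < i)%N]) (f i @` `[0, 1]) = `[0, 1[%classic;
  dgl_order : forall i j, (0 < i)%N -> (0 < j)%N ->
    (forall x, x \in `]0, 1[ -> f i x < f j x) -> (i < j)%N;
  dgl_contract : exists m : nat, exists A : R,
    [/\ (0 < m)%N, 0 < A, A < 1 &
      forall w, word w -> size w = m -> forall x, x \in `[0, 1] ->
        0 < `|deriv01 (comp_word f w) x| <= A];
  dgl_decay : forall delta : R, 0 < delta ->
    exists K1 K2 : R, [/\ 0 < K1, 0 < K2 &
      forall i, (0 < i)%N -> exists xi lambda : R,
        [/\ K1 / i%:R `^ (d + delta) <= xi,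
            forall x, x \in `[0, 1] -> xi <= `|deriv01 (f i) x| <= lambda &
            lambda <= K2 / i%:R `^ (d - delta)]]
}.

Definition interval_length f w : R := fine (diam (basic_interval f w)).

Definition bounded_distortion f : Prop :=
  exists K3 K4 : R, [/\ 0 < K3, 0 < K4 &
    forall v w, word v -> word w -> (0 < size v)%N -> (0 < size w)%N ->
      K3 <= interval_length f (v ++ w) /
            (interval_length f v * interval_length f w) <= K4].

Definition potential f phi : Prop :=
  (forall x, x \in `[0, 1] -> 0 <= phi x) /\
  (forall j, (0 < j)%N -> exists c : R,
     forall x, interior (basic_interval f [:: j]) x -> phi x = c).

(* phi(j); the interior is nonempty for a Gauss like system, so the constant
   is unique. *)
Definition potential_value f phi (j : nat) : R :=
  xget 0 [set c | forall x, interior (basic_interval f [:: j]) x -> phi x = c].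

(* All candidate values of S_n phi(x); two of them can occur only at a common
   endpoint of two basic intervals, and none only at an image of the point 1
   under some composition of the maps f i. *)
Definition birkhoff_values f phi (n : nat) (x : R) : set R :=
  [set s | exists w, [/\ word w, size w = n, basic_interval f w x &
     s = \sum_(j <- w) potential_value f phi j]].

(* x is required to lie outside the countable set where some S_n phi(x) is not
   well defined. *)
Definition birkhoff_level_set f phi Phi : set R :=
  [set x | 0 < x < 1 /\ exists2 S : nat -> R,
     forall n, (0 < n)%N -> birkhoff_values f phi n x = [set S n] &
     (S n / Phi n @[n --> \oo] --> (1 : R))].

End GaussLikeIFS.

(* Main.v *)
(** By the mean value theorem the cylinder of a word [a_1 ... a_n] has length
    [(a_1 ... a_n) ^ (- d)] up to factors [C ^ n] and [(a_1 ... a_n) ^ delta].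

    Upper bounds come from explicit finite covers by cylinders.  For
    [alpha > 1/2] the Birkhoff sum must multiply by a large factor over each
    block of times between consecutive squares, so one letter of that block is
    large; the product of the first [n] letters then beats every [exp (C n)],
    and a Chernoff bound gives dimension at most [1/d].  For [Phi n = exp
    (beta ^ n)] every letter is determined up to a constant factor and one
    covers by the union of the cylinders with a large next letter.

    Lower bounds come from maps [p] from [0, 1) into the level set such that
    [|y - z| <= C |p y - p z| ^ s]: Lebesgue measure forces dimension at least
    [s].  Such a [p] reads the mixed radix digits of [y] as choices of letters.
    For fast growth the letters [a_n] range over a window around
    [(Phi n - Phi (n - 1)) ^ (1/a)].  For [alpha < 1/2] the choices are among
    words over a finite alphabet whose cylinders are long enough to carry
    dimension [s]; large letters inserted at square times make the sum follow
    [Phi] and cost only [exp (- o(n))]. *)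

Require Import Defs.
From HB Require Import structures.
From mathcomp Require Import all_boot all_order all_algebra.
From mathcomp Require Import all_classical all_reals all_analysis.
From mathcomp Require Import ring lra zify.
Set Implicit Arguments.
Unset Strict Implicit.
Unset Printing Implicit Defensive.
Import Order.TTheory GRing.Theory Num.Theory numFieldNormedType.Exports.
Local Open Scope classical_set_scope.
Local Open Scope ring_scope.

(** * Hausdorff measure and dimension *)

Section Hausdorff.
Context {R : realType}.
Implicit Types (A : set R) (s r : R).

(** The threshold 1/2 comes from the squares: between the times [k^2] and [(k+1)^2] the exponent
    [n^alpha] grows by an amount of order [k^(2 alpha - 1)]. Above 1/2 this is unbounded; below 1/2
    it tends to 0, so a sum that jumps only at squares still follows [Phi]. For
    [Phi n = exp (beta ^ n)], the logarithm of a covering sum with exponent [s] gets the weight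
    [1 - d s] from each fixed letter and [- (d - 1) s] from the large next one, and the exponents of
    the fixed letters add up to about [1 / (beta - 1)] times the next exponent. The balance
    [(1 - d s) / (beta - 1) = (d - 1) s] is solved by [s = 1 / (d beta - beta + 1)]. Length
    estimates by derivatives lose a constant per letter. Products of letters that beat every
    [exp (C n)] absorb this; bounded letters do not, which is where bounded distortion enters: it
    loses a constant per block, and a block can be given enough choices to outweigh it. Neighbouring
    cylinders share endpoints. Coded points are therefore kept apart by whole cylinders, and their
    codes contain letters above 1 infinitely often, which makes them unique. *)

Lemma dist_le_diam A x y : A x -> A y -> (`|x - y|%:E <= diam A)%E.
Proof. by move=> Ax Ay; apply: ereal_sup_ubound; exists (x, y). Qed.

Lemma diam_le A r : 0 <= r -> (forall x y, A x -> A y -> `|x - y| <= r) ->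
  (diam A <= r%:E)%E.
Proof.
move=> r0 Ar; apply: ge_ereal_sup => _ [[x y] /= [Ax Ay] <-].
by rewrite lee_fin Ar.
Qed.

Lemma diam_ge0 A : A !=set0 -> (0 <= diam A)%E.
Proof. by move=> [x Ax]; have := dist_le_diam Ax Ax; rewrite subrr normr0. Qed.

Lemma gauge_ge0 s A : (0 <= gauge s A)%E.
Proof. by rewrite /gauge; case: ifP => // _; exact: poweR_ge0. Qed.

Lemma gauge_le s A r : 0 <= s -> 0 <= r ->
  (forall x y, A x -> A y -> `|x - y| <= r) -> (gauge s A <= (r `^ s)%:E)%E.
Proof.
move=> s0 r0 Ar; rewrite /gauge; case: ifPn => [_|A0].
  by rewrite lee_fin powR_ge0.
have /set0P An0 := A0.
rewrite -poweR_EFin; apply: gt0_ler_poweR => //.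
- by rewrite in_itv /= diam_ge0 // leey.
- by rewrite in_itv /= lee_fin r0 leey.
- exact: diam_le.
Qed.

(** A cover of [E] pulls back under [p] to a cover of [0, 1). Each preimage lies in an interval
    whose radius is comparable to the [s]-th power of the diameter, so a small [s]-sum would cover
    [0, 1) by intervals of total length below 1. Enclosing preimages in intervals avoids any
    question of measurability of [p]. *)
Lemma hausdorff_dim_ge_of_holder_param (E : set R) (p : R -> R) (C th : R) :
  0 < th -> (forall y : R, 0 <= y < 1 -> E (p y)) ->
  (forall y z : R, 0 <= y < 1 -> 0 <= z < 1 ->
    `|y - z| <= C * `|p y - p z| `^ th) ->
  (th%:E <= hausdorff_dim E)%E.
Proof.
move=> th0 pE pH; apply: le_ereal_inf_tmp => _ [s [s0 Hs] <-].
rewrite lee_fin leNgt; apply/negP => sth.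
pose C1 := `|C| + 1; have C10 : 0 < C1 by rewrite ltr_wpDl.
(* The radii below are at most [C1] times the gauge, so [2^-1 / C1] brings the total length under 1.
   Scale 1 suffices: for [D <= 1] and [s < th], [D ^ th <= D ^ s]. *)
have pre0 : (hausdorff_pre s 1 E < (2^-1 / C1)%:E)%E.
  apply: (@le_lt_trans _ _ 0%E); last by rewrite lte_fin divr_gt0.
  by rewrite -Hs; apply: ereal_sup_ubound; exists 1 => //=.
case: (ereal_inf_lt pre0) => _ [U [UE U1] <-] Usum.
have Udiam k : U k !=set0 -> exists2 D, 0 <= D <= 1 & diam (U k) = D%:E.
  move=> /diam_ge0; have := U1 k; case: (diam (U k)) => // D.
  by rewrite !lee_fin => D1 D0; exists D => //; rewrite D0.
have cover k : exists c : R * R, [/\ 0 <= c.2,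
    forall y, 0 <= y < 1 -> U k (p y) -> c.1 - c.2 <= y <= c.1 + c.2 &
    (c.2%:E <= C1%:E * gauge s (U k))%E].
  have [[y [y01 Uy]]|noy] := pselect (exists y, 0 <= y < 1 /\ U k (p y)); last first.
    exists (0, 0); split => //= [y y01 Uy|]; first by case: noy; exists y.
    by rewrite mule_ge0 ?gauge_ge0 // lee_fin ltW.
  have Un0 : U k !=set0 by exists (p y).
  have [D /andP[D0 D1] dD] := Udiam k Un0.
  have gD : gauge s (U k) = (D `^ s)%:E.
    by rewrite /gauge ifF ?dD ?poweR_EFin //; apply/negbTE/set0P.
  exists (y, C1 * D `^ s); split => /=.
  - by rewrite mulr_ge0 ?powR_ge0 // ltW.
  - move=> z z01 Uz; rewrite -ler_distl; apply: le_trans (pH _ _ z01 y01) _.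
    have dle : `|p z - p y| <= D.
      by have := dist_le_diam Uz Uy; rewrite dD lee_fin.
    have : `|p z - p y| `^ th <= D `^ s.
      have [->|pn0] := eqVneq (`|p z - p y|) 0.
        by rewrite powR0 ?gt_eqF // powR_ge0.
      have pgt : 0 < `|p z - p y| by rewrite lt_def pn0 normr_ge0.
      apply: (@le_trans _ _ (`|p z - p y| `^ s)); last first.
        by rewrite ge0_ler_powR ?nnegrE.
      rewrite /powR (negbTE pn0) ler_expR ler_wnM2r //; last exact: ltW.
      by rewrite ln_le0 // (le_trans dle).
    move=> h; apply: le_trans (_ : C1 * `|p z - p y| `^ th <= _).
      by rewrite ler_wpM2r ?powR_ge0 // (le_trans (ler_norm C)) // lerDl.
    by rewrite ler_wpM2l // ltW.
  - by rewrite gD -EFinM.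
have [c cP] := choice cover.
pose B k := `[(c k).1 - (c k).2, (c k).1 + (c k).2]%classic : set R.
have sub : `[0, 1[%classic `<=` \bigcup_k B k.
  move=> y /=; rewrite in_itv /= => y01.
  have [k _ Uk] := UE _ (pE _ y01); exists k => //=.
  by rewrite /B /= in_itv /=; case: (cP k) => _ /(_ _ y01 Uk).
have mB k : measurable (B k) by exact: measurable_itv.
have : (lebesgue_measure (`[0%R, 1%R[%classic : set R) <=
    \sum_(0 <= k <oo) lebesgue_measure (B k))%E.
  by apply: measure_sigma_subadditive.
rewrite lebesgue_measure_itv /= lte_fin ltr01 oppr0 adde0 leNgt => /negP; apply.
apply: (@le_lt_trans _ _ (\sum_(0 <= k <oo) (2 * C1)%:E * gauge s (U k))%E).
  apply: lee_nneseries => [k _ _|k _]; first exact: measure_ge0.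
  rewrite (lebesgue_measure_itv `[_, _]) /=; case: (cP k) => c0 _ cg.
  case: ifP => _; last first.
    by rewrite mule_ge0 ?gauge_ge0 // lee_fin mulr_ge0 // ltW.
  rewrite -EFinB EFinM -muleA.
  have -> : (c k).1 + (c k).2 - ((c k).1 - (c k).2) = 2 * (c k).2 by ring.
  by rewrite EFinM; apply: lee_wpmul2l.
rewrite nneseriesZl => [|k _]; last exact: gauge_ge0.
have -> : 1%E = ((2 * C1)%:E * (2^-1 / C1)%:E)%E :> \bar R.
  by rewrite -EFinM mulrACA divff ?mulfV ?gt_eqF // mulr1.
by rewrite lte_pmul2l // lte_fin mulr_gt0.
Qed.

Lemma hausdorff_dim_le (E : set R) (r : R) : 0 <= r ->
  (forall s, r < s -> hausdorff_measure s E = 0%E) ->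
  (hausdorff_dim E <= r%:E)%E.
Proof.
move=> r0 H; apply/lee_addgt0Pr => e e0; rewrite -EFinD.
apply: ereal_inf_lbound; exists (r + e) => //; split.
  by rewrite addr_ge0 // ltW.
by rewrite H // ltrDl.
Qed.

Lemma hausdorff_dim_eq (E : set R) (r : R) : 0 < r ->
  (forall s, r < s -> hausdorff_measure s E = 0%E) ->
  (forall th, 0 < th -> th < r -> (th%:E <= hausdorff_dim E)%E) ->
  hausdorff_dim E = r%:E.
Proof.
move=> r0 up lo; apply/eqP; rewrite eq_le (hausdorff_dim_le (ltW r0)) //=.
apply/lee_addgt0Pr => e e0; rewrite -leeBlDr // -EFinB.
have [er|re] := ltP e r; first by apply: lo; rewrite ?subr_gt0 // gtrDl oppr_lt0.
apply: (@le_trans _ _ 0%E); first by rewrite lee_fin subr_le0.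
by apply: le_ereal_inf_tmp => _ [s [s0 _] <-]; rewrite lee_fin.
Qed.

End Hausdorff.

(** * Null sets from finite covers *)

Section HausdorffNull.
Context {R : realType}.
Implicit Types (A : set R) (s r : R).

Lemma hausdorff_pre_ge0 s delta A : (0 <= hausdorff_pre s delta A)%E.
Proof.
apply: le_ereal_inf_tmp => _ [U _ <-]; apply: nneseries_ge0 => k _ _.
exact: gauge_ge0.
Qed.

(** The bound [c <= delta ^ s] makes the cover [delta]-fine by itself: one radius above [delta]
    would already push the sum past [c]. *)
Lemma countable_cover_of_finite_cover (T : eqType) (l : seq T) (U : T -> set R)
    (rad : T -> R) A s delta c :
  0 < s -> 0 < delta -> c <= delta `^ s ->
  (forall x, A x -> exists2 t, t \in l & U t x) ->
  (forall t, t \in l -> 0 <= rad t /\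
     forall x y, U t x -> U t y -> `|x - y| <= rad t) ->
  \sum_(t <- l) rad t `^ s <= c ->
  exists V, delta_cover delta A V /\
    (\sum_(0 <= k <oo) gauge s (V k) <= c%:E)%E.
Proof.
move=> s0 d0 cd AU Ur lc.
have c0 : 0 <= c by apply: le_trans lc; apply: sumr_ge0 => t _; exact: powR_ge0.
case: l => [|t0 l'] in AU Ur lc *.
  exists (fun=> set0); split; [split=> [x /AU[//]|k]|].
    by apply: diam_le => //; exact: ltW.
  rewrite eseries0 ?lee_fin // => k _ _.
  by rewrite /gauge eqxx.
set l := t0 :: l' in AU Ur lc *.
pose V k := if (k < size l)%N then U (nth t0 l k) else set0.
have Vg k : (k < size l)%N -> (gauge s (V k) <= (rad (nth t0 l k) `^ s)%:E)%E.
  move=> kl; rewrite /V kl; have [r0 Ud] := Ur _ (mem_nth t0 kl).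
  by apply: gauge_le => //; exact: ltW.
exists V; split; [split=> [x /AU[t tl Ux]|k]|].
- by exists (index t l) => //; rewrite /V index_mem tl nth_index.
- rewrite /V; case: ifPn => kl; last by apply: diam_le => //; exact: ltW.
  have tl := mem_nth t0 kl; have [r0 Ud] := Ur _ tl.
  apply: (@le_trans _ _ (rad (nth t0 l k))%:E); first exact: diam_le.
  rewrite lee_fin leNgt; apply/negP => dr.
  suff : c < rad (nth t0 l k) `^ s.
    apply/negP; rewrite -leNgt; apply: le_trans lc.
    rewrite (big_rem (nth t0 l k)) //= lerDl; apply: sumr_ge0 => t _.
    exact: powR_ge0.
  by apply: le_lt_trans cd _; rewrite gt0_ltr_powR ?nnegrE // ltW.
apply: lime_le; first by apply: is_cvg_nneseries => n _ _; exact: gauge_ge0.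
exists (size l) => //= n /= ln.
rewrite (big_cat_nat (n := size l)) //= [X in (_ + X)%E]big_nat_cond.
rewrite [X in (_ + X)%E]big1 ?adde0; last first.
  move=> k /andP[/andP[lk _] _]; rewrite /V ltnNge lk /=.
  by rewrite /gauge eqxx.
apply: (@le_trans _ _ (\sum_(0 <= k < size l) (rad (nth t0 l k) `^ s)%:E)%E).
  rewrite big_nat_cond [leRHS]big_nat_cond; apply: lee_sum => k /andP[/andP[_ kl] _].
  exact: Vg.
by rewrite sumEFin lee_fin -(big_nth t0 xpredT (fun t => rad t `^ s)).
Qed.

(** Countable stability of null sets is built in, the [N]-th piece receiving a share
    [2 ^ (- N - 1)]. Fineness of the covers is not demanded separately, since [e] can be taken below
    [delta ^ s]. *)
Lemma hausdorff_measure_bigcup_eq0 (A : nat -> set R) s : 0 < s ->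
  (forall N (e : R), 0 < e -> exists (T : eqType) (l : seq T) (U : T -> set R)
     (rad : T -> R),
     [/\ forall x, A N x -> exists2 t, t \in l & U t x,
         forall t, t \in l -> 0 <= rad t /\
           forall x y, U t x -> U t y -> `|x - y| <= rad t &
         \sum_(t <- l) rad t `^ s <= e]) ->
  hausdorff_measure s (\bigcup_N A N) = 0%E.
Proof.
move=> s0 H; apply/eqP; rewrite eq_le; apply/andP; split; last first.
  apply: (le_trans (hausdorff_pre_ge0 s 1 (\bigcup_N A N))).
  by apply: ereal_sup_ubound; exists 1 => //=.
apply: ge_ereal_sup => _ [delta /= d0 <-].
apply/lee_addgt0Pr => e e0; rewrite add0e.
have ds0 : 0 < delta `^ s by rewrite powR_gt0.
pose e' := Num.min e (delta `^ s).
have e'0 : 0 < e' by rewrite lt_min e0 ds0.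
have e'N N : 0 < e' / (2 ^ N.+1)%:R by rewrite divr_gt0 // ltr0n expn_gt0.
have /choice[V VP] : forall N, exists V, delta_cover delta (A N) V /\
    (\sum_(0 <= k <oo) gauge s (V k) <= (e' / (2 ^ N.+1)%:R)%:E)%E.
  move=> N; have [T [l [U [rad [AU Ur lc]]]]] := H N _ (e'N N).
  apply: (countable_cover_of_finite_cover s0 d0 _ AU Ur lc).
  apply: (@le_trans _ _ e'); last by rewrite ge_min lexx orbT.
  rewrite ler_pdivrMr ?ltr0n ?expn_gt0 //; apply: ler_peMr; first exact: ltW.
  by rewrite ler1n expn_gt0.
have /card_esym/ppcard_eqP[f] := card_nat2.
pose W := (fun p : nat * nat => V p.1 p.2) \o f.
have Wc : delta_cover delta (\bigcup_N A N) W.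
  split=> [x [N _ ANx]|k]; last by case: (VP (f k).1) => -[_ +] _; exact.
  have [[/(_ _ ANx)[k _ Vx] _] _] := VP N.
  by exists (f^-1%FUN (N, k)) => //; rewrite /W /= invK ?inE.
apply: (@le_trans _ _ (\sum_(0 <= k <oo) gauge s (W k))%E).
  by apply: ereal_inf_lbound; exists W.
have -> : (\sum_(0 <= k <oo) gauge s (W k) =
    \sum_(0 <= N <oo) \sum_(0 <= k <oo) gauge s (V N k))%E.
  rewrite nneseries_esumT; last by move=> k; exact: gauge_ge0.
  rewrite -(@reindex_esum _ _ _ [set: nat] [set: nat * nat] f
    (fun p => gauge s (V p.1 p.2))) //.
  rewrite nneseries_esumT; last first.
    by move=> N; apply: nneseries_ge0 => k _ _; exact: gauge_ge0.
  under [RHS]eq_esum => N _.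
    rewrite nneseries_esumT; last by move=> k; exact: gauge_ge0.
    over.
  rewrite esum_esum; last by move=> *; exact: gauge_ge0.
  by congr esum; apply/seteqP; split.
apply: (@le_trans _ _ (\sum_(0 <= N <oo) (e' / (2 ^ N.+1)%:R)%:E)%E).
  apply: lee_nneseries => [N _ _|N _].
    by apply: nneseries_ge0 => k _ _; exact: gauge_ge0.
  by case: (VP N).
apply: (le_trans (epsilon_trick0 _ (ltW e'0))).
by rewrite lee_fin ge_min lexx.
Qed.

Lemma hausdorff_measure_subset s A B : A `<=` B ->
  hausdorff_measure s B = 0%E -> hausdorff_measure s A = 0%E.
Proof.
move=> AB B0; apply/eqP; rewrite eq_le; apply/andP; split; last first.
  apply: (le_trans (hausdorff_pre_ge0 s 1 A)).
  by apply: ereal_sup_ubound; exists 1 => //=.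
rewrite -B0; apply: ge_ereal_sup => _ [delta /= d0 <-].
apply: (@le_trans _ _ (hausdorff_pre s delta B)); last first.
  by apply: ereal_sup_ubound; exists delta.
apply: ereal_inf_le_tmp => _ [U [BU dU] <-]; exists U => //.
by split=> // x /AB /BU.
Qed.

End HausdorffNull.
(** * Derivatives relative to the unit interval *)

Section RelativeDerivative.
Context {R : realType}.
Implicit Types (g h : R -> R) (x y l : R).

Lemma has_deriv01P g x l : has_deriv01 g x l <->
  forall e : R, 0 < e -> exists2 delta : R, 0 < delta &
    forall y, 0 <= y <= 1 -> y != x -> `|y - x| < delta ->
      `|(g y - g x) / (y - x) - l| < e.
Proof.
rewrite /has_deriv01; split.
  move=> /cvgrPdist_lt + e e0 => /(_ e e0).
  rewrite near_withinE /= => -[r /= r0 rP]; exists r => // y y01 yx yr.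
  rewrite distrC; apply: rP => //=; first by rewrite distrC.
move=> H; apply/cvgrPdist_lt => e e0; have [r r0 rP] := H e e0.
rewrite near_withinE; exists r => //= y yr yx.
rewrite in_itv /= => y01.
by rewrite distrC; apply: rP => //; rewrite distrC.
Qed.

Lemma has_deriv01_is_derive g x l :
  0 < x < 1 -> has_deriv01 g x l -> is_derive x 1 g l.
Proof.
move=> /andP[x0 x1] /has_deriv01P H.
suff cv : (fun h : R => h^-1 *: ((g \o shift x) (h *: (1 : R)) - g x)) @ (0 : R)^' --> l.
  by apply: DeriveDef; [apply/cvg_ex; exists l|apply: cvg_lim].
apply/cvgrPdist_lt => e e0; have [r r0 rP] := H e e0.
exists (Num.min r (Num.min x (1 - x))) => /=.
  by rewrite !lt_min r0 x0 subr_gt0.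
move=> t /=; rewrite sub0r normrN !lt_min => /and3P[tr tx tx1] t0.
rewrite distrC /GRing.scale /= mulr1 mulrC.
have tE : t = t + x - x by rewrite addrK.
rewrite {2}tE; apply: rP.
- move: tx tx1; rewrite !ltr_norml => /andP[? ?] /andP[? ?]; apply/andP; split; lra.
- by rewrite -subr_eq0 addrK.
- by rewrite addrK.
Qed.

Lemma has_deriv01_continuous g x l : 0 <= x <= 1 -> has_deriv01 g x l ->
  g y @[y --> within `[0, 1] (nbhs x)] --> g x.
Proof.
move=> x01 /has_deriv01P H; apply/cvgrPdist_lt => e e0.
have [r r0 rP] := H 1 ltr01.
pose m := `|l| + 1; have m0 : 0 < m by rewrite ltr_wpDl.
rewrite near_withinE; exists (Num.min r (e / m)) => /=.
  by rewrite lt_min r0 divr_gt0.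
move=> y /=; rewrite lt_min => /andP[yr ye]; rewrite in_itv /= => y01.
have [->|yx] := eqVneq y x; first by rewrite subrr normr0.
rewrite distrC.
have {}rP : `|(g y - g x) / (y - x)| < m.
  have := rP _ y01 yx; rewrite distrC => /(_ yr) h.
  rewrite -(subrK l ((g y - g x) / _)) (le_lt_trans (ler_normD _ _)) //.
  by rewrite /m addrC ltrD2l.
have yx0 : 0 < `|y - x| by rewrite normr_gt0 subr_eq0.
move: rP; rewrite normrM normfV ltr_pdivrMr // => /lt_trans; apply.
by rewrite -ltr_pdivlMl // mulrC distrC.
Qed.

Lemma deriv01_mvt g x y :
  (forall z, z \in `[0, 1] -> has_deriv01 g z (deriv01 g z)) ->
  0 <= x -> x < y -> y <= 1 ->
  exists2 c, c \in `[0, 1] & g y - g x = deriv01 g c * (y - x).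
Proof.
move=> H x0 xy y1.
have [z||c cxy ->] := @MVT R g (deriv01 g) x y xy.
- rewrite in_itv /= => /andP[xz zy].
  apply: has_deriv01_is_derive; first by apply/andP; split; lra.
  by apply: H; rewrite in_itv /=; apply/andP; split; lra.
- have sub : `[x, y]%classic `<=` (`[0, 1]%classic : set R).
    by move=> z /=; rewrite !in_itv /= => /andP[? ?]; apply/andP; split; lra.
  apply: (continuous_subspaceW sub).
  apply/subspace_continuousP => z /= z01; apply: has_deriv01_continuous (H z z01).
  by move: z01; rewrite in_itv.
- exists c => //; move: cxy; rewrite !in_itv /= => /andP[? ?].
  by apply/andP; split; lra.
Qed.

Lemma deriv01_bounds g xi lam :
  (forall z, z \in `[0, 1] -> has_deriv01 g z (deriv01 g z)) ->
  (forall z, z \in `[0, 1] -> xi <= `|deriv01 g z| <= lam) ->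
  forall x y, 0 <= x <= 1 -> 0 <= y <= 1 ->
    xi * `|x - y| <= `|g x - g y| <= lam * `|x - y|.
Proof.
move=> H B x y.
wlog xy : x y / x <= y.
  move=> W x01 y01; have [|/ltW] := leP x y => ?; first exact: W.
  by rewrite distrC (distrC (g x)); apply: W.
have [->|xny] := eqVneq x y; first by rewrite !subrr normr0 !mulr0 lexx.
move=> /andP[x0 x1] /andP[y0 y1].
have lxy : x < y by rewrite lt_neqAle xny.
have [c c01] := deriv01_mvt H x0 lxy y1.
rewrite distrC (distrC (g x)) => ->; rewrite normrM.
have /andP[? ?] := B c c01.
by rewrite !ler_wpM2r.
Qed.

(** Injectivity keeps [h y] off [h x] for [y != x], so the difference quotient of the composite
    factors into two convergent quotients. *)
Lemma has_deriv01_comp g h x l m :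
  (forall y, 0 <= y <= 1 -> 0 <= h y <= 1) ->
  (forall y, 0 <= y <= 1 -> h y = h x -> y = x) ->
  0 <= x <= 1 ->
  has_deriv01 h x m -> has_deriv01 g (h x) l -> has_deriv01 (g \o h) x (l * m).
Proof.
move=> h01 hinj x01 hm gl; rewrite /has_deriv01.
have hc := has_deriv01_continuous x01 hm.
have sub : within `[0, 1] x^' `=>` within `[0, 1] (nbhs x).
  move=> A; rewrite /within /= => -[r r0 rP]; exists r => // y yr yx y01.
  exact: rP.
have hh : h y @[y --> within `[0, 1] x^'] --> within `[0, 1] (h x)^'.
  move=> A; rewrite /= /within /= => -[r /= r0 rP].
  have /cvgrPdist_lt/(_ r r0) := hc; rewrite near_withinE => -[r' r'0 r'P].
  exists r' => // y yr /= yx y01; apply: rP => //=.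
  - exact: r'P.
  - by apply: contra_neq yx => /hinj; apply; move: y01; rewrite in_itv.
  - by move: y01; rewrite !in_itv /=; exact: h01.
have gh : (g (h y) - g (h x)) / (h y - h x) @[y --> within `[0, 1] x^'] --> l.
  exact: (cvg_comp _ _ hh gl).
apply: cvg_trans (cvgM gh hm); apply: near_eq_cvg.
rewrite near_withinE; exists 1 => //= y _ yx; rewrite in_itv /= => y01.
rewrite mulrA mulfVK // subr_eq0; apply: contra_neq yx; exact: hinj.
Qed.

End RelativeDerivative.

(** Limits along this filter are then unique, so [deriv01], defined by [lim], equals any relative
    derivative that exists. *)
Lemma within01_dnbhs_proper (R : realType) (x : R) : 0 <= x <= 1 ->
  ProperFilter (within `[0, 1] x^').
Proof.
move=> x01; apply: Build_ProperFilter_ex => A.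
rewrite /within /= => -[r /= r0 rP].
pose m := Num.min (r / 2) 2^-1.
have m0 : 0 < m by rewrite lt_min divr_gt0 //= invr_gt0.
have mr : m <= r / 2 by rewrite ge_min lexx.
have mh : m <= 2^-1 by rewrite ge_min lexx orbT.
(* The move goes towards the farther end, which keeps the point in [0, 1]. *)
exists (if x <= 2^-1 then x + m else x - m); case: ifPn => xh; apply: rP => /=.
- by rewrite opprD addrA subrr sub0r normrN gtr0_norm //; lra.
- by rewrite -subr_eq0 addrAC subrr add0r gt_eqF.
- by rewrite in_itv /=; apply/andP; split; lra.
- by rewrite opprB addrCA subrr addr0 gtr0_norm //; lra.
- by rewrite -subr_eq0 addrAC subrr add0r oppr_eq0 gt_eqF.
- by rewrite in_itv /= in xh *; apply/andP; split; lra.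
Qed.

(** * Injective Lipschitz maps of the unit interval *)

Section InjectiveUnitInterval.
Context {R : realType}.
Variables (g : R -> R) (L : R).
Hypothesis gL : forall x y, 0 <= x <= 1 -> 0 <= y <= 1 ->
  `|g x - g y| <= L * `|x - y|.
Hypothesis ginj : forall x y, 0 <= x <= 1 -> 0 <= y <= 1 -> g x = g y -> x = y.

Lemma lipschitz01_continuous : {within `[0, 1], continuous g}.
Proof.
apply/subspace_continuousP => x /=; rewrite in_itv /= => x01.
apply/cvgrPdist_lt => e e0.
pose m := `|L| + 1; have m0 : 0 < m by rewrite ltr_wpDl.
rewrite near_withinE; exists (e / m) => /=; first by rewrite divr_gt0.
move=> y /=; rewrite ltr_pdivlMr // => xy; rewrite in_itv /= => y01.
apply: le_lt_trans (gL x01 y01) _; apply: le_lt_trans xy.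
by rewrite mulrC ler_wpM2l // (le_trans (ler_norm L)) // lerDl.
Qed.

Lemma injective01_mono :
  (forall x y, 0 <= x -> x < y -> y <= 1 -> g x < g y) \/
  (forall x y, 0 <= x -> x < y -> y <= 1 -> g y < g x).
Proof.
have inj : {in `[0, 1] &, injective g}.
  by move=> x y; rewrite !in_itv /=; exact: ginj.
have [inc|dec] := itv_continuous_inj_mono lipschitz01_continuous inj.
  left=> x y x0 xy y1; apply: inc => //; rewrite in_itv /=;
    by apply/andP; split; lra.
right=> x y x0 xy y1; apply: dec => //; rewrite in_itv /=;
  by apply/andP; split; lra.
Qed.

Lemma image01_between x : 0 <= x <= 1 ->
  Num.min (g 0) (g 1) <= g x <= Num.max (g 0) (g 1).
Proof.
move=> /andP[]; rewrite le_eqVlt => /predU1P[<- _|x0].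
  by rewrite ge_min lexx le_max lexx.
rewrite le_eqVlt => /predU1P[->|x1].
  by rewrite ge_min lexx le_max lexx !orbT.
rewrite ge_min le_max; have [inc|dec] := injective01_mono.
  by rewrite (ltW (inc 0 x (lexx 0) x0 (ltW x1)))
    (ltW (inc x 1 (ltW x0) x1 (lexx 1))) orbT.
by rewrite (ltW (dec 0 x (lexx 0) x0 (ltW x1)))
  (ltW (dec x 1 (ltW x0) x1 (lexx 1))) orbT.
Qed.

Lemma image01_between_lt x : 0 < x < 1 ->
  Num.min (g 0) (g 1) < g x < Num.max (g 0) (g 1).
Proof.
move=> /andP[x0 x1]; rewrite gt_min lt_max; have [inc|dec] := injective01_mono.
  by rewrite (inc 0 x (lexx 0) x0 (ltW x1)) (inc x 1 (ltW x0) x1 (lexx 1)) orbT.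
by rewrite (dec 0 x (lexx 0) x0 (ltW x1)) (dec x 1 (ltW x0) x1 (lexx 1)) orbT.
Qed.

Lemma image01_surj p : Num.min (g 0) (g 1) <= p <= Num.max (g 0) (g 1) ->
  exists2 x, 0 <= x <= 1 & g x = p.
Proof.
move=> pB; have [x] := IVT ler01 lipschitz01_continuous pB.
by rewrite in_itv /= => x01 gx; exists x.
Qed.

Lemma image01_surj_lt p : Num.min (g 0) (g 1) < p < Num.max (g 0) (g 1) ->
  exists2 x, 0 < x < 1 & g x = p.
Proof.
move=> /andP[pl pr]; have [|x /andP[x0 x1] gx] := @image01_surj p.
  by rewrite !ltW.
have [x00|xn0] := eqVneq x 0.
  have [inc|dec] := injective01_mono.
    move: pl; rewrite -gx x00 min_l ?ltxx //; exact/ltW/inc.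
  move: pr; rewrite -gx x00 max_l ?ltxx //; exact/ltW/dec.
have [x11|xn1] := eqVneq x 1.
  have [inc|dec] := injective01_mono.
    move: pr; rewrite -gx x11 max_r ?ltxx //; exact/ltW/inc.
  move: pl; rewrite -gx x11 min_r ?ltxx //; exact/ltW/dec.
by exists x => //; rewrite !lt_neqAle x0 x1 xn1 eq_sym xn0.
Qed.

Lemma image01_length : fine (diam (g @` `[0, 1])) = `|g 1 - g 0|.
Proof.
have -> : diam (g @` `[0, 1]) = `|g 1 - g 0|%:E; last by [].
apply/eqP; rewrite eq_le; apply/andP; split; last first.
  by apply: dist_le_diam; [exists 1|exists 0] => //=; rewrite in_itv /= ler01 lexx.
apply: diam_le => // p q [x /=]; rewrite in_itv /= => x01 <- [y /=].
rewrite in_itv /= => y01 <-.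
have /andP[xl xr] := image01_between x01; have /andP[yl yr] := image01_between y01.
have -> : `|g 1 - g 0| = Num.max (g 0) (g 1) - Num.min (g 0) (g 1).
  have [] := leP (g 0) (g 1) => h; first by rewrite ger0_norm ?subr_ge0.
  by rewrite ltr0_norm ?subr_lt0 // opprB.
by rewrite ler_distl; apply/andP; split; lra.
Qed.

End InjectiveUnitInterval.

(** * Gauss like systems *)

Section GaussLikeSystem.
Context {R : realType} (d : R) (f : nat -> R -> R).
Hypothesis hf : d_decaying_gauss_like d f.
Implicit Types (w v : seq nat) (x y : R).

Lemma map01 i x : (0 < i)%N -> 0 <= x <= 1 -> 0 <= f i x <= 1.
Proof. by move=> i0 x01; have := dgl_self hf i0; exact. Qed.

Lemma has_deriv01_map i z : (0 < i)%N -> z \in `[0, 1] ->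
  has_deriv01 (f i) z (deriv01 (f i) z).
Proof. by move=> i0; case: (dgl_C1 hf i0) => H _; exact: H. Qed.

Lemma map_bounds delta : 0 < delta -> exists K1 K2 : R, [/\ 0 < K1, 0 < K2 &
  forall i x y, (0 < i)%N -> 0 <= x <= 1 -> 0 <= y <= 1 ->
    K1 / i%:R `^ (d + delta) * `|x - y| <= `|f i x - f i y| <=
    K2 / i%:R `^ (d - delta) * `|x - y|].
Proof.
move=> d0; have [K1 [K2 [K10 K20 H]]] := dgl_decay hf d0.
exists K1, K2; split=> // i x y i0 x01 y01.
have [xi [lam [Kxi B lamK]]] := H i i0.
have [l1 l2] := andP (deriv01_bounds (fun z => @has_deriv01_map i z i0) B x01 y01).
by rewrite (le_trans _ l1) ?(le_trans l2) ?ler_wpM2r.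
Qed.

Lemma map_inj i x y : (0 < i)%N -> 0 <= x <= 1 -> 0 <= y <= 1 ->
  f i x = f i y -> x = y.
Proof.
move=> i0 x01 y01 fxy; have [K1 [K2 [K10 K20 H]]] := map_bounds ltr01.
have /andP[+ _] := H i x y i0 x01 y01; rewrite fxy subrr normr0.
have c0 : 0 < K1 / i%:R `^ (d + 1) by rewrite divr_gt0 // powR_gt0 // ltr0n.
by rewrite pmulr_rle0 // normr_le0 subr_eq0 => /eqP.
Qed.

Lemma word_cons i w : word (i :: w) -> (0 < i)%N /\ word w.
Proof. by move=> /andP[]. Qed.

Lemma comp_word_cat w v x : comp_word f (w ++ v) x = comp_word f w (comp_word f v x).
Proof. by rewrite /comp_word foldr_cat. Qed.

Lemma comp_word01 w x : word w -> 0 <= x <= 1 -> 0 <= comp_word f w x <= 1.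
Proof.
by elim: w => //= i w IH /word_cons[i0 ww] x01; apply: map01 => //; exact: IH.
Qed.

Lemma comp_word_inj w x y : word w -> 0 <= x <= 1 -> 0 <= y <= 1 ->
  comp_word f w x = comp_word f w y -> x = y.
Proof.
elim: w => //= i w IH /word_cons[i0 ww] x01 y01 /map_inj e.
by apply: IH => //; apply: e => //; exact: comp_word01.
Qed.

Lemma comp_word_bounds (lo hi : nat -> R) w x y :
  (forall i, (0 < i)%N -> 0 <= lo i) -> (forall i, (0 < i)%N -> 0 <= hi i) ->
  (forall i x y, (0 < i)%N -> 0 <= x <= 1 -> 0 <= y <= 1 ->
    lo i * `|x - y| <= `|f i x - f i y| <= hi i * `|x - y|) ->
  word w -> 0 <= x <= 1 -> 0 <= y <= 1 ->
  \prod_(i <- w) lo i * `|x - y| <= `|comp_word f w x - comp_word f w y| <=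
  \prod_(i <- w) hi i * `|x - y|.
Proof.
move=> lo0 hi0 H; elim: w => [|i w IH] /=.
  by rewrite !big_nil !mul1r lexx.
move=> /word_cons[i0 ww] x01 y01; rewrite !big_cons.
have /andP[l1 l2] := IH ww x01 y01.
have /andP[m1 m2] := H i _ _ i0 (comp_word01 ww x01) (comp_word01 ww y01).
apply/andP; split; rewrite -mulrA.
  by apply: le_trans m1; rewrite ler_wpM2l // lo0.
by apply: (le_trans m2); rewrite ler_wpM2l // hi0.
Qed.

Lemma comp_word_lipschitz w : word w -> exists L, forall x y,
  0 <= x <= 1 -> 0 <= y <= 1 ->
  `|comp_word f w x - comp_word f w y| <= L * `|x - y|.
Proof.
move=> ww; have [K1 [K2 [K10 K20 H]]] := map_bounds ltr01.
exists (\prod_(i <- w) (K2 / i%:R `^ (d - 1))) => x y x01 y01.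
by have /andP[] := comp_word_bounds (fun i _ => divr_ge0 (ltW K10) (powR_ge0 _ _))
  (fun i _ => divr_ge0 (ltW K20) (powR_ge0 _ _)) H ww x01 y01.
Qed.

(** [dgl_contract] bounds a [lim], which speaks about the composite only once its derivative is
    known to exist. The chain rule provides that. *)
Lemma has_deriv01_comp_word w z : word w -> z \in `[0, 1] ->
  has_deriv01 (comp_word f w) z (deriv01 (comp_word f w) z).
Proof.
move=> ww zI; have z01 : 0 <= z <= 1 by move: zI; rewrite in_itv.
suff [l hl] : exists l, has_deriv01 (comp_word f w) z l.
  by have -> : deriv01 (comp_word f w) z = l
    by apply: cvg_lim hl => //; exact: within01_dnbhs_proper.
elim: w ww => [_|i w IH /= /word_cons[i0 ww]].
  exists 1; apply/has_deriv01P => e e0; exists 1 => // y _ yz _ /=.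
  by rewrite divff ?subr_eq0 // subrr normr0.
have [l hl] := IH ww; exists (deriv01 (f i) (comp_word f w z) * l).
apply: (@has_deriv01_comp R (f i) (comp_word f w)) => //.
- by move=> y; exact: comp_word01.
- by move=> y y01; exact: comp_word_inj.
- by apply: has_deriv01_map => //; rewrite in_itv /=; exact: comp_word01.
Qed.

(** Each map may increase or decrease, so the ends of its image are recovered by minimum and
    maximum. *)
Definition lend i := Num.min (f i 0) (f i 1).
Definition rend i := Num.max (f i 0) (f i 1).

Lemma map_lipschitz i : (0 < i)%N -> exists L, forall x y,
  0 <= x <= 1 -> 0 <= y <= 1 -> `|f i x - f i y| <= L * `|x - y|.
Proof. by move=> i0; apply: (@comp_word_lipschitz [:: i]); rewrite /word /= i0. Qed.

Lemma map_between i x : (0 < i)%N -> 0 <= x <= 1 -> lend i <= f i x <= rend i.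
Proof.
move=> i0; have [L fL] := map_lipschitz i0.
by apply: image01_between fL _ _ => y z; exact: map_inj.
Qed.

Lemma map_between_lt i x : (0 < i)%N -> 0 < x < 1 -> lend i < f i x < rend i.
Proof.
move=> i0; have [L fL] := map_lipschitz i0.
by apply: image01_between_lt fL _ _ => y z; exact: map_inj.
Qed.

Lemma map_surj_lt i p : (0 < i)%N -> lend i < p < rend i ->
  exists2 x, 0 < x < 1 & f i x = p.
Proof.
move=> i0; have [L fL] := map_lipschitz i0.
by apply: image01_surj_lt fL _ _ => y z; exact: map_inj.
Qed.

Lemma lend_lt_rend i : (0 < i)%N -> lend i < rend i.
Proof.
move=> i0; have h : 0 < (2^-1 : R) < 1 by apply/andP; split; lra.
by have /andP[h1 h2] := map_between_lt i0 h; apply: lt_trans h1 h2.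
Qed.

(** If the images overlapped, the midpoint of the overlap would lie in both open images, against
    disjointness. If the image of [j] came entirely first, the order condition would give
    [j < i]. *)
Lemma rend_le_lend i j : (0 < i)%N -> (i < j)%N -> rend i <= lend j.
Proof.
move=> i0 ij; have j0 : (0 < j)%N by apply: leq_trans ij.
rewrite leNgt; apply/negP => lj; have [li|] := ltP (lend i) (rend j).
  pose p := (Num.max (lend i) (lend j) + Num.min (rend i) (rend j)) / 2.
  have mM : Num.max (lend i) (lend j) < Num.min (rend i) (rend j).
    by rewrite lt_min !gt_max li lj !lend_lt_rend.
  have pl : Num.max (lend i) (lend j) < p by rewrite /p; lra.
  have pr : p < Num.min (rend i) (rend j) by rewrite /p; lra.
  move: pl pr; rewrite gt_max lt_min => /andP[pli plj] /andP[pri prj].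
  have [|x x01 fx] := @map_surj_lt i p i0; first by rewrite pli pri.
  have [|y y01 fy] := @map_surj_lt j p j0; first by rewrite plj prj.
  have : (f i @` `]0, 1[ `&` f j @` `]0, 1[) p.
    by split; [exists x|exists y] => //=; rewrite in_itv.
  rewrite (dgl_disjoint hf i0 j0); first by [].
  by move=> ijE; move: ij; rewrite ijE ltnn.
move=> ji; have : (j < i)%N.
  apply: (dgl_order hf) => // x; rewrite in_itv /= => x01.
  have /andP[_ h1] := map_between_lt j0 x01.
  have /andP[h2 _] := map_between_lt i0 x01.
  by apply: lt_trans h1 _; apply: le_lt_trans h2.
by rewrite ltnNge (ltnW ij).
Qed.

Lemma rend_le_rend i j : (0 < i)%N -> (i <= j)%N -> rend i <= rend j.
Proof.
move=> i0; rewrite leq_eqVlt => /predU1P[->//|ij].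
apply: le_trans (rend_le_lend i0 ij) _; apply/ltW/lend_lt_rend.
exact: leq_trans ij.
Qed.

Lemma lend_le_lend i j : (0 < i)%N -> (i <= j)%N -> lend i <= lend j.
Proof.
move=> i0; rewrite leq_eqVlt => /predU1P[->//|ij].
by apply: le_trans (rend_le_lend i0 ij); exact/ltW/lend_lt_rend.
Qed.

Lemma map_lt1 i x : (0 < i)%N -> 0 <= x <= 1 -> f i x < 1.
Proof.
move=> i0 x01; have : (\bigcup_(i in [set i | (0 < i)%N]) (f i @` `[0, 1])) (f i x).
  by exists i => //; exists x => //=; rewrite in_itv.
by rewrite (dgl_union hf) /= in_itv /= => /andP[].
Qed.

Lemma rend_lt1 i : (0 < i)%N -> rend i < 1.
Proof. by move=> i0; rewrite gt_max !map_lt1 ?ler01 ?lexx. Qed.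

Lemma lend_ge0 i : (0 < i)%N -> 0 <= lend i.
Proof.
move=> i0; rewrite le_min.
have /andP[-> _] := @map01 i 0 i0 (introT andP (conj (lexx 0) ler01)).
by have /andP[-> _] := @map01 i 1 i0 (introT andP (conj ler01 (lexx 1))).
Qed.

Lemma mem_some_letter p : 0 <= p < 1 -> exists2 i, (0 < i)%N & lend i <= p <= rend i.
Proof.
move=> p01; have : `[0, 1[%classic p by rewrite /= in_itv.
rewrite -(dgl_union hf) => -[i /= i0 [x]]; rewrite /= in_itv /= => x01 <-.
by exists i => //; exact: map_between.
Qed.

Lemma lend1 : lend 1 = 0.
Proof.
apply/eqP; rewrite eq_le lend_ge0 // andbT.
have [|i i0 /andP[h _]] := @mem_some_letter 0; first by rewrite lexx ltr01.
by apply: le_trans h; exact: lend_le_lend.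
Qed.

(** A gap would contain a point of [0, 1) outside every image: letters up to [i] end before it and
    later ones start after it. *)
Lemma rend_lendS i : (0 < i)%N -> lend i.+1 = rend i.
Proof.
move=> i0; apply/eqP; rewrite eq_le rend_le_lend // andbT leNgt; apply/negP => h.
pose p := (rend i + lend i.+1) / 2.
have [|k k0 /andP[kl kr]] := @mem_some_letter p.
  have := lend_ge0 i0; have := lend_lt_rend i0; have := @rend_lt1 i.+1 isT.
  have := @lend_lt_rend i.+1 isT => *; apply/andP; rewrite /p; split; lra.
have [ki|ik] := leqP k i.
  by have := rend_le_rend k0 ki; move: kr; rewrite /p; lra.
by have := @lend_le_lend i.+1 k isT ik; move: kl; rewrite /p; lra.
Qed.

Lemma rend_cofinal p : p < 1 -> exists2 i, (0 < i)%N & p <= rend i.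
Proof.
move=> p1; have [p0|p0] := leP 0 p.
  by have [|i i0 /andP[_ h]] := @mem_some_letter p; [rewrite p0 p1|exists i].
exists 1%N => //; apply: (le_trans (ltW p0)).
by rewrite -lend1; exact/ltW/lend_lt_rend.
Qed.

Lemma rend_sub_lend i : (0 < i)%N -> rend i - lend i = `|f i 1 - f i 0|.
Proof.
move=> _; rewrite /rend /lend.
have [] := leP (f i 0) (f i 1) => h; first by rewrite ger0_norm ?subr_ge0.
by rewrite ltr0_norm ?subr_lt0 // opprB.
Qed.

Lemma interval_lengthE w : word w ->
  interval_length f w = `|comp_word f w 1 - comp_word f w 0|.
Proof.
move=> ww; have [L gL] := comp_word_lipschitz ww.
by apply: image01_length gL _ => x y; exact: comp_word_inj.
Qed.

Lemma basic_intervalP w x : basic_interval f w x <->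
  exists2 z, 0 <= z <= 1 & comp_word f w z = x.
Proof. by split=> -[z]; rewrite /= ?in_itv /= => z01 <-; exists z. Qed.

Lemma comp_word_interior w z : word w -> 0 < z < 1 -> 0 < comp_word f w z < 1.
Proof.
elim: w => //= i w IH /word_cons[i0 ww] z01.
have /andP[h1 h2] := map_between_lt i0 (IH ww z01).
by rewrite (le_lt_trans (lend_ge0 i0) h1) (lt_trans h2 (rend_lt1 i0)).
Qed.

(** Letters from 2 on have images bounded away from 0, and no image contains 1. Once the point is
    interior, the outer maps keep it interior. *)
Lemma comp_word_big_letter w z : word w -> has (leq 2) w -> 0 <= z <= 1 ->
  0 < comp_word f w z < 1.
Proof.
elim: w => //= i w IH /word_cons[i0 ww] /orP[i2|wh] z01.
  have /andP[h1 _] := map_between i0 (comp_word01 ww z01).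
  rewrite map_lt1 ?comp_word01 // andbT; apply: lt_le_trans h1.
  apply: lt_le_trans (rend_le_lend (isT : (0 < 1)%N) i2).
  by rewrite -lend1 lend_lt_rend.
have wi : word [:: i] by rewrite /word /= i0.
exact: comp_word_interior wi (IH ww wh z01).
Qed.

(** A point strictly inside the image of one letter is not in the closed image of another, since two
    such images meet at endpoints at most. Letters are then peeled off one at a time. *)
Lemma interior_coding_unique w v z : word w -> word v -> size w = size v ->
  0 < z < 1 -> basic_interval f v (comp_word f w z) -> w = v.
Proof.
move=> ww wv sz z01 /basic_intervalP[y y01].
elim: w v ww wv sz => [|i w IH] [|j v] //= /word_cons[i0 ww] /word_cons[j0 wv] [sz] e.
have a12 := map_between_lt i0 (comp_word_interior ww z01).
have /andP[a1 a2] := a12.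
have b12 := map_between j0 (comp_word01 wv y01).
have /andP[b1 b2] := b12.
have ij : i = j.
  case: (ltngtP i j) => // ij.
    rewrite -e in a2.
    by have := lt_le_trans a2 (le_trans (rend_le_lend i0 ij) b1); rewrite ltxx.
  rewrite -e in a1.
  by have := le_lt_trans (le_trans b2 (rend_le_lend j0 ij)) a1; rewrite ltxx.
move: e; rewrite -ij => e; congr cons; apply: IH => //.
have z01' : 0 <= z <= 1 by case/andP: z01 => *; rewrite !ltW.
have w01 := comp_word01 ww z01'; have v01 := comp_word01 wv y01.
exact: (map_inj i0 v01 w01 e).
Qed.

End GaussLikeSystem.

(** * Upper bounds *)

Section PowerSums.
Context {R : realType}.
Implicit Types (q r s : R).

(** A discrete integral comparison, obtained from [expR t >= 1 + t] and [ln (1 - t) <= - t]. *)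
Lemma powR_telescope q j : 1 < q -> (0 < j)%N ->
  (q - 1) * j.+1%:R `^ (- q) <= j%:R `^ (1 - q) - j.+1%:R `^ (1 - q).
Proof.
move=> q1 j0; set x : R := j.+1%:R.
have x0 : 0 < x by rewrite ltr0n.
have jx : j%:R = x * (1 + - x^-1).
  by rewrite mulrDr mulrN mulfV ?gt_eqF // mulr1 /x -natr1 addrK.
have y0 : 0 < 1 + - x^-1.
  by rewrite -(pmulr_rgt0 _ x0) -jx ltr0n.
rewrite jx powRM ?(ltW x0) ?(ltW y0) //.
have -> : (x `^ (- q)) = x `^ (1 - q) * x^-1.
  rewrite -(powR_inv1 (ltW x0)) -powRD; last by rewrite (gt_eqF x0) implybT.
  by congr (_ `^ _); ring.
have -> : x `^ (1 - q) * (1 + - x^-1) `^ (1 - q) - x `^ (1 - q) =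
   x `^ (1 - q) * ((1 + - x^-1) `^ (1 - q) - 1) by ring.
rewrite mulrCA ler_wpM2l ?powR_ge0 // lerBrDl.
rewrite /powR gt_eqF //; apply: le_trans (expR_ge1Dx _).
rewrite lerD2l -(opprB q 1) mulNr -mulrN ler_wpM2l ?subr_ge0 ?(ltW q1) //.
by rewrite lerNr; apply: le_ln1Dx; rewrite ltrN2 // invf_lt1 // ltr1n.
Qed.

Lemma sum_powR_tail q M N : 1 < q -> (0 < M)%N ->
  \sum_(M.+1 <= j < N) (j%:R : R) `^ (- q) <= (q - 1)^-1 * M%:R `^ (1 - q).
Proof.
move=> q1 M0; have q10 : 0 < q - 1 by rewrite subr_gt0.
rewrite ler_pdivlMl //.
have [NM|MN] := leqP N M.+1.
  by rewrite big_geq // mulr0 powR_ge0.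
suff : (q - 1) * (\sum_(M.+1 <= j < N) j%:R `^ (- q)) <=
    M%:R `^ (1 - q) - N.-1%:R `^ (1 - q).
  by move=> /le_trans; apply; rewrite gerBl powR_ge0.
case: N MN => // N; rewrite ltnS => MN /=.
rewrite big_add1 /= mulr_sumr.
rewrite -(opprB (N%:R `^ _)) -(telescope_sumr (fun j => j%:R `^ (1 - q)) (ltnW MN)).
rewrite -sumrN big_nat_cond [leRHS]big_nat_cond; apply: ler_sum => j /andP[/andP[Mj _] _].
by rewrite opprB powR_telescope // (leq_trans M0).
Qed.

Lemma sum_powR_le q N : 1 < q ->
  \sum_(1 <= j < N) (j%:R : R) `^ (- q) <= 1 + (q - 1)^-1.
Proof.
move=> q1; have q10 : 0 < q - 1 by rewrite subr_gt0.
have [N1|N1] := leqP N 1; first by rewrite big_geq // addr_ge0 // invr_ge0 ltW.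
rewrite big_ltn // powR1 lerD2l.
by apply: le_trans (sum_powR_tail _ q1 (isT : (0 < 1)%N)) _; rewrite powR1 mulr1.
Qed.

Lemma prod_powR (I : Type) (l : seq I) (h : I -> R) s : (forall i, 0 <= h i) ->
  (\prod_(i <- l) h i) `^ s = \prod_(i <- l) h i `^ s.
Proof.
move=> h0; elim: l => [|i l IH]; first by rewrite !big_nil powR1.
by rewrite !big_cons powRM ?IH // prodr_ge0.
Qed.

End PowerSums.

(** * Words over prescribed alphabets *)

Fixpoint words (D : nat -> seq nat) (n : nat) : seq (seq nat) :=
  if n is n'.+1 then [seq rcons w b | w <- words D n', b <- D n'] else [:: [::]].

Lemma mem_words D n w : size w = n -> (forall i, (i < n)%N -> nth 0%N w i \in D i) ->
  w \in words D n.
Proof.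
elim: n w => [|n IH] w; first by move/size0nil ->; rewrite inE.
case/lastP: w => // w b; rewrite size_rcons => -[sw] H /=.
apply: allpairs_f.
  by apply: IH => // i ilt; have := H i (ltnW ilt); rewrite nth_rcons sw ilt.
by have := H n (ltnSn n); rewrite nth_rcons sw ltnn eqxx.
Qed.

Lemma words_mem D n w : w \in words D n ->
  size w = n /\ forall i, (i < n)%N -> nth 0%N w i \in D i.
Proof.
elim: n w => [|n IH] w; first by rewrite inE => /eqP ->.
case/allpairsP => -[v b] /= [/IH[sv vD] bD ->]; rewrite size_rcons sv.
split=> // i; rewrite ltnS leq_eqVlt nth_rcons sv => /predU1P[->|ilt].
  by rewrite ltnn eqxx.
by rewrite ilt; exact: vD.
Qed.

Lemma words_uniq D n : (forall i, uniq (D i)) -> uniq (words D n).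
Proof.
move=> uD; elim: n => //= n IH; apply: allpairs_uniq => //.
by move=> [v b] [v' b'] _ _ /= /rcons_inj[-> ->].
Qed.

(** Weights that are products over letters can be summed position by position. The covering sums of
    both upper bounds are evaluated this way. *)
Lemma sum_words (R : comPzSemiRingType) (h : nat -> R) D n :
  \sum_(w <- words D n) \prod_(b <- w) h b = \prod_(i < n) \sum_(b <- D i) h b.
Proof.
elim: n => [|n IH]; first by rewrite big_seq1 big_nil big_ord0.
rewrite big_ord_recr /= -IH big_allpairs_dep /= mulr_suml.
apply: eq_bigr => w _; rewrite mulr_sumr; apply: eq_bigr => b _.
by rewrite big_rcons /= mulrC.
Qed.

Section UpperBounds.
Context {R : realType} (d : R) (f : nat -> R -> R).
Hypotheses (hf : d_decaying_gauss_like d f) (hd : 1 < d).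

(** From the letter [N] to [N + 1] the right end advances by at most [K2 * (N + 1) ^ (- q)], so
    [rend f N + K2 / (q - 1) * N ^ (1 - q)] is nonincreasing in [N]. Its value at [M] is compared
    with the limit 1 of [rend]. *)
Lemma one_sub_rend_le delta : 0 < delta -> delta < d - 1 -> exists2 C : R, 0 < C &
  forall M, (0 < M)%N -> 1 - rend f M <= C * M%:R `^ (1 - (d - delta)).
Proof.
move=> d0 dd; have [K1 [K2 [K10 K20 H]]] := map_bounds hf d0.
set q := d - delta in H *; have q1 : 1 < q by rewrite /q; lra.
have q10 : 0 < q - 1 by rewrite subr_gt0.
exists (K2 / (q - 1)); first by rewrite divr_gt0.
move=> M M0; rewrite lerBlDl; apply/ler_addgt0Pr => e e0.
have [N N0 eN] := rend_cofinal hf (ltac:(lra) : 1 - e < 1).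
suff : rend f N <= rend f M + K2 / (q - 1) * M%:R `^ (1 - q) by lra.
have [NM|MN] := leqP N M.
  apply: le_trans (rend_le_rend hf N0 NM) _; rewrite lerDl mulr_ge0 ?powR_ge0 //.
  by rewrite divr_ge0 // ltW.
suff : rend f N + K2 / (q - 1) * N%:R `^ (1 - q) <=
    rend f M + K2 / (q - 1) * M%:R `^ (1 - q).
  by apply: le_trans; rewrite lerDl mulr_ge0 ?powR_ge0 // divr_ge0 // ltW.
elim: N MN {N0 eN} => // N IH; rewrite ltnS => MN.
have N0 : (0 < N)%N by apply: leq_trans MN.
have step : rend f N.+1 + K2 / (q - 1) * N.+1%:R `^ (1 - q) <=
    rend f N + K2 / (q - 1) * N%:R `^ (1 - q).
  rewrite -(rend_lendS hf N0) -lerBlDl addrAC rend_sub_lend // -lerBrDr -mulrBr.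
  have /andP[_ h] := H N.+1 1 0 isT (introT andP (conj ler01 (lexx 1)))
     (introT andP (conj (lexx 0) ler01)).
  apply: le_trans h _; rewrite subr0 normr1 mulr1 -powRN -mulrA.
  by rewrite ler_wpM2l ?(ltW K20) // ler_pdivlMl // powR_telescope.
by move: MN; rewrite leq_eqVlt => /predU1P[->//|/IH]; exact: le_trans.
Qed.

(* Chernoff: the constraint on the product of the letters is replaced by the
   weight b^eps, so that the sum over words factorizes. *)
Lemma hausdorff_measure_large_products (A : nat -> set R) s : d^-1 < s ->
  (forall N (C : R), exists n M, (0 < n)%N /\ forall x, A N x -> exists w,
    [/\ word w, size w = n, all (fun b => (b <= M)%N) w, basic_interval f w x &
        expR (C * n%:R) <= \prod_(b <- w) b%:R]) ->
  hausdorff_measure s (\bigcup_N A N) = 0%E.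
Proof.
move=> ds HA; have d0 : 0 < d by apply: lt_trans hd.
have s0 : 0 < s by apply: lt_trans ds; rewrite invr_gt0.
(* The surplus of [d * s] over 1 is shared out: a quarter to [delta], a quarter to the Chernoff
   weight [eps], and half remains to make the exponent [p] exceed 1. *)
pose eta := d * s - 1; have eta0 : 0 < eta.
  by rewrite subr_gt0 -ltr_pdivrMl // mulr1.
pose delta := eta / (4 * s); have delta0 : 0 < delta.
  by rewrite divr_gt0 // mulr_gt0.
pose eps := eta / 4; have eps0 : 0 < eps by rewrite divr_gt0.
have [K1 [K2 [K10 K20 H]]] := map_bounds hf delta0.
pose p := 1 + eta / 2; have p1 : 1 < p by rewrite /p; lra.
have pE : (d - delta) * s - eps = p.
  rewrite /p /eps mulrBl /delta; have -> : eta / (4 * s) * s = eta / 4.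
    by field; rewrite gt_eqF.
  by rewrite /eta; field.
pose Z := K2 `^ s * (1 + (p - 1)^-1); have Z0 : 0 < Z.
  by rewrite mulr_gt0 ?powR_gt0 // ltr_wpDr ?ltr01 // invr_ge0 subr_ge0 ltW.
apply: hausdorff_measure_bigcup_eq0 => // N e e0.
pose e' := Num.min e 1; have e'0 : 0 < e' by rewrite lt_min e0 ltr01.
(* The sum over one letter is at most [Z]; with this [C] the saving per letter reduces it to
   [e' <= 1], and the [n]-th power is then at most [e']. *)
pose C := ln (Z / e') / eps.
have CE : Z * expR (- (eps * C)) = e'.
  have -> : eps * C = ln (Z / e') by rewrite /C mulrC mulfVK ?gt_eqF.
  rewrite expRN lnK ?posrE ?divr_gt0 // invf_div mulrC mulfVK ?gt_eqF //.
have [n [M [n0 HNC]]] := HA N C.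
pose D (_ : nat) := iota 1 M.
pose rad (w : seq nat) := \prod_(b <- w) (K2 / b%:R `^ (d - delta)).
exists (seq nat), [seq w <- words D n | expR (C * n%:R) <= \prod_(b <- w) b%:R],
  (basic_interval f), rad; split.
- move=> x /HNC[w [ww sw wM wx wC]]; exists w => //.
  rewrite mem_filter wC /=; apply: mem_words => // i ilt.
  rewrite mem_iota add1n ltnS; apply/andP; split.
    by apply: (allP ww); rewrite mem_nth // sw.
  by apply: (allP wM); rewrite mem_nth // sw.
- move=> w; rewrite mem_filter => /andP[_ /words_mem[sw wD]]; split.
    by apply: prodr_ge0 => b _; rewrite divr_ge0 ?powR_ge0 // ltW.
  have ww : word w.
    apply/(all_nthP 0%N) => i; rewrite sw => /wD.
    by rewrite mem_iota => /andP[].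
  move=> x y /basic_intervalP[u u01 <-] /basic_intervalP[v v01 <-].
  have /andP[_ h] := comp_word_bounds hf (fun i _ => divr_ge0 (ltW K10) (powR_ge0 _ _))
    (fun i _ => divr_ge0 (ltW K20) (powR_ge0 _ _)) H ww u01 v01.
  apply: (le_trans h); apply: ler_piMr.
    by apply: prodr_ge0 => b _; rewrite divr_ge0 ?powR_ge0 // ltW.
  by rewrite ler_distl; move: u01 v01 => /andP[? ?] /andP[? ?]; apply/andP; split; lra.
rewrite big_filter.
pose h (b : nat) : R := (K2 / b%:R `^ (d - delta)) `^ s * b%:R `^ eps.
have h0 b : 0 <= h b by rewrite mulr_ge0 ?powR_ge0.
apply: (@le_trans _ _
  (\sum_(w <- words D n) expR (- (eps * (C * n%:R))) * \prod_(b <- w) h b)).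
  rewrite big_mkcond /=; apply: ler_sum => w _; case: ifPn => wC; last first.
    by rewrite mulr_ge0 ?expR_ge0 // prodr_ge0.
  rewrite /h big_split /= -prod_powR; last first.
    by move=> b; rewrite divr_ge0 ?powR_ge0 // ltW.
  rewrite mulrCA ler_peMr ?powR_ge0 // expRN mulrC -prod_powR; last first.
    by move=> b; rewrite ler0n.
  rewrite ler_pdivlMr ?expR_gt0 // mul1r mulrC expRM ge0_ler_powR ?nnegrE ?expR_ge0 //.
    exact: ltW.
  by rewrite prodr_ge0.
rewrite -mulr_sumr sum_words.
have -> : \prod_(i < n) \sum_(b <- D i) h b = (\sum_(b <- iota 1 M) h b) ^+ n.
  by rewrite /D big_const_ord -Monoid.iteropE.
have -> : expR (- (eps * (C * n%:R))) = expR (- (eps * C)) ^+ n.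
  by rewrite -expRM_natr; congr expR; ring.
rewrite -exprMn.
have hZ : \sum_(b <- iota 1 M) h b <= Z.
  apply: (@le_trans _ _ (K2 `^ s * \sum_(1 <= b < M.+1) b%:R `^ (- p))); last first.
    by rewrite ler_wpM2l ?powR_ge0 // sum_powR_le.
  rewrite mulr_sumr /index_iota subn1 /= !big_seq; apply: ler_sum => b.
  rewrite mem_iota => /andP[b0 _].
  have b0' : b%:R != 0 :> R by rewrite pnatr_eq0 -lt0n.
  rewrite /h powRM ?invr_ge0 ?powR_ge0 // ?(ltW K20) // -powRN -powRrM -mulrA.
  rewrite -powRD; last by rewrite b0' implybT.
  by rewrite -pE mulNr opprB addrC.
have h1 : expR (- (eps * C)) * (\sum_(b <- iota 1 M) h b) <= e'.
  by rewrite -CE mulrC ler_wpM2r ?expR_ge0.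
have e'1 : e' <= 1 by rewrite ge_min lexx orbT.
apply: le_trans (_ : e' ^+ n <= _).
  apply: lerXn2r => //; rewrite nnegrE ?(ltW e'0) //.
  by rewrite mulr_ge0 ?expR_ge0 // sumr_ge0.
case: n n0 {HNC} => // n _; rewrite exprS; apply: (@le_trans _ _ e').
  by apply: ler_piMr; [exact: ltW|exact: exprn_ile1 (ltW e'0) e'1].
by rewrite ge_min lexx.
Qed.

End UpperBounds.

(** * Growth estimates *)

Lemma sqrnS k : (k.+1 ^ 2 = k ^ 2 + (2 * k + 1))%N.
Proof. by rewrite -!mulnn; nia. Qed.

Section Growth.
Context {R : realType}.

Lemma expr_superlinear (b C : R) : 1 < b ->
  exists n0, forall n, (n0 <= n)%N -> C * n%:R <= b ^+ n.
Proof.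
(* Bernoulli's inequality for the square root of [b], once squared, is quadratic in [n] and so beats
   every linear function. *)
move=> b1; pose g := Num.sqrt b.
have g1 : 1 < g by rewrite -sqrtr1 ltr_sqrt // (lt_trans ltr01).
have c0 : 0 < (g - 1) ^+ 2 by rewrite exprn_gt0 // subr_gt0.
exists (Num.truncn (`|C| / (g - 1) ^+ 2)).+1 => n n0n.
have bern m : 1 + m%:R * (g - 1) <= g ^+ m.
  elim: m => [|m IH]; first by rewrite mul0r addr0 expr0.
  have h : 0 <= (g - 1) * (g ^+ m - 1).
    by rewrite mulr_ge0 // subr_ge0 ?exprn_ege1 // ltW.
  rewrite exprS -natr1; nra.
have gn : n%:R * (g - 1) <= g ^+ n by apply: le_trans (bern n); rewrite lerDr.
have -> : b = g ^+ 2 by rewrite sqr_sqrtr // ltW // (lt_trans ltr01).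
rewrite -exprM mulnC exprM; apply: le_trans (_ : (n%:R * (g - 1)) ^+ 2 <= _).
  have n1 : `|C| / (g - 1) ^+ 2 <= n%:R.
    apply: le_trans (_ : (Num.truncn (`|C| / (g - 1) ^+ 2)).+1%:R <= _).
      exact/ltW/truncnS_gt.
    by rewrite ler_nat.
  rewrite ler_pdivrMr // in n1.
  rewrite exprMn expr2 -mulrA [leRHS]mulrC ler_wpM2r //.
  exact: le_trans (ler_norm C) n1.
have h : 0 <= n%:R * (g - 1) by rewrite mulr_ge0 // subr_ge0 ltW.
by apply: lerXn2r => //; rewrite nnegrE // (le_trans h).
Qed.

Lemma powR_unbounded (p T : R) : 0 < p ->
  exists n0, forall n, (n0 <= n)%N -> T <= n%:R `^ p.
Proof.
move=> p0; exists (Num.truncn ((`|T|) `^ p^-1)).+1 => n nT.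
apply: (le_trans (ler_norm T)).
have -> : `|T| = (`|T| `^ p^-1) `^ p.
  by rewrite -powRrM mulVf ?gt_eqF // powRr1.
apply: ge0_ler_powR; rewrite ?nnegrE ?powR_ge0 ?ler0n // 1?ltW //.
by apply: lt_le_trans (truncnS_gt _) _; rewrite ler_nat.
Qed.

Lemma powR_sub_ge (p : R) k : 1 <= p ->
  k.+1%:R `^ (p - 1) <= k.+1%:R `^ p - (k%:R : R) `^ p.
Proof.
move=> p1; have p0 : 0 < p by apply: lt_le_trans p1.
rewrite -(mulr_powRB1 (ler0n R k.+1) p0) -(mulr_powRB1 (ler0n R k) p0).
have h : (k%:R : R) `^ (p - 1) <= k.+1%:R `^ (p - 1).
  by apply: ge0_ler_powR; rewrite ?subr_ge0 ?nnegrE ?ler0n // ler_nat.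
have k0 : 0 <= k%:R :> R by [].
rewrite -natr1; move: h k0; rewrite -natr1.
set u := k%:R `^ _; set v := (k%:R + 1) `^ _; set z := k%:R => h k0; nra.
Qed.

Lemma expR2_ge4 : 4 <= expR 2 :> R.
Proof.
have h : 2 <= expR 1 :> R by apply: le_trans (expR_ge1Dx 1); lra.
have -> : expR 2 = expR 1 * expR 1 :> R by rewrite -expRD.
nra.
Qed.

Lemma expR3_ge8 : 8 <= expR 3 :> R.
Proof.
have h : 2 <= expR 1 :> R by apply: le_trans (expR_ge1Dx 1); lra.
have -> : expR 3 = expR 2 * expR 1 :> R by rewrite -expRD; congr expR; ring.
have := expR2_ge4; nra.
Qed.

End Growth.

(** * Level sets and the upper bound for exponents above 1/2 *)

Section LevelSets.
Context {R : realType} (d : R) (f : nat -> R -> R) (a : R) (phi : R -> R).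
Hypotheses (hf : d_decaying_gauss_like d f) (hd : 1 < d) (ha : 0 < a).
Hypothesis hval : forall j : nat, (0 < j)%N -> potential_value f phi j = j%:R `^ a.
Implicit Types (w : seq nat) (Phi : nat -> R).

Definition power_sum w : R := \sum_(b <- w) b%:R `^ a.

Lemma power_sum_ge0 w : 0 <= power_sum w.
Proof. by apply: sumr_ge0 => b _; exact: powR_ge0. Qed.

Lemma power_sum_cat w v : power_sum (w ++ v) = power_sum w + power_sum v.
Proof. exact: big_cat. Qed.

Lemma letter_le_power_sum w b : b \in w -> b%:R `^ a <= power_sum w.
Proof.
move=> bw; rewrite /power_sum (big_rem b) //= lerDl.
by apply: sumr_ge0 => c _; exact: powR_ge0.
Qed.

Lemma power_sum_potential w : word w ->
  \sum_(j <- w) potential_value f phi j = power_sum w.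
Proof.
move=> ww; rewrite /power_sum !big_seq; apply: eq_bigr => j jw.
by rewrite hval //; apply: (allP ww).
Qed.

Lemma word_take k w : word w -> word (take k w).
Proof. by move=> ww; apply/allP => b /mem_take; exact: (allP ww). Qed.

Lemma word_drop k w : word w -> word (drop k w).
Proof. by move=> ww; apply/allP => b /mem_drop; exact: (allP ww). Qed.

(** Convergence to 1 is weakened to a factor 2 from the time [N] on, which turns the level set into
    a countable union. One word serves for all its prefixes, so letters can be estimated from
    differences of sums. *)
Definition pinched_set Phi N : set R := [set x | forall n, (0 < n)%N ->
  exists w, [/\ word w, size w = n, basic_interval f w x &
    forall k, (0 < k)%N -> (N <= k)%N -> (k <= n)%N ->
      Phi k / 2 <= power_sum (take k w) <= 2 * Phi k]].

Lemma level_set_sub_pinched Phi : (forall n, 0 < Phi n) ->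
  birkhoff_level_set f phi Phi `<=` \bigcup_N pinched_set Phi N.
Proof.
move=> P0 x [_ [S HS Sc]].
have h2 : 0 < 2^-1 :> R by rewrite invr_gt0.
have /cvgrPdist_lt/(_ _ h2)[N _ NS] := Sc.
exists N => //= n n0.
have [w [ww sw wx _]] : birkhoff_values f phi n x (S n) by rewrite HS.
exists w; split=> // k k0 Nk kn.
(* A prefix of [w] yields a candidate sum at the time [k], and a point of the level set has only
   one. *)
have -> : power_sum (take k w) = S k.
  have : birkhoff_values f phi k x (power_sum (take k w)).
    exists (take k w); split; first exact: word_take.
    - by rewrite size_takel // sw.
    - have /basic_intervalP[z z01 <-] := wx.
      apply/basic_intervalP; exists (comp_word f (drop k w) z).
        by apply: (comp_word01 hf) => //; exact: word_drop.
      by rewrite -comp_word_cat cat_take_drop.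
    - by rewrite power_sum_potential //; exact: word_take.
  by rewrite HS.
have := NS k Nk; rewrite ltr_distlC => /andP[l1 l2].
have {}l1 : 1 - 2^-1 <= S k / Phi k by exact: ltW.
have {}l2 : S k / Phi k <= 1 + 2^-1 by exact: ltW.
move: l1 l2; rewrite ler_pdivlMr // ler_pdivrMr // => l1 l2.
have := P0 k => Pk.
by apply/andP; split; lra.
Qed.

(** All letters are at least 1, so the product dominates each of them and hence each summand. This
    turns a large sum into a large product. *)
Lemma power_sum_le_prod w : word w ->
  power_sum w <= (size w)%:R * (\prod_(b <- w) b%:R) `^ a.
Proof.
move=> ww; rewrite prod_powR // /power_sum.
have one b : (0 < b)%N -> 1 <= b%:R `^ a :> R.
  move=> b0; rewrite -[leLHS](powRr0 b%:R); apply: ler_powR; last exact: ltW.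
  by rewrite ler1n.
elim: w ww => [|b w IH] /=; first by rewrite !big_nil mul0r.
move=> /word_cons[b0 ww]; rewrite !big_cons -natr1.
have p1 : 1 <= \prod_(j <- w) (j%:R : R) `^ a.
  rewrite big_seq; elim/big_ind : _ => // [y z y1 z1|j /(allP ww)/one//].
  by rewrite -[leLHS]mulr1; apply: ler_pM.
have := IH ww; have := one b b0.
set B := b%:R `^ a; set P := \prod_(_ <- _) _; set Q := \sum_(_ <- _) _.
have s0 : 0 <= (size w)%:R :> R by [].
move: s0; set m := (size w)%:R => s0 B1 h.
rewrite -/P in p1.
have h1 : m * P <= m * (B * P) by rewrite ler_wpM2l // ler_peMl // (le_trans ler01).
have h2 : B <= B * P by rewrite ler_peMr // (le_trans ler01).
lra.
Qed.

Lemma hausdorff_measure_subexp_upper alpha s : 2^-1 < alpha -> d^-1 < s ->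
  hausdorff_measure s
    (birkhoff_level_set f phi (fun n => expR (n%:R `^ alpha))) = 0%E.
Proof.
move=> alpha2 ds; pose Phi n : R := expR (n%:R `^ alpha).
apply: (@hausdorff_measure_subset R s _ (\bigcup_N pinched_set Phi N)).
  by apply: level_set_sub_pinched => n; exact: expR_gt0.
apply: (hausdorff_measure_large_products hf hd ds) => N C.
pose C0 := Num.max C 0; have C00 : 0 <= C0 by rewrite le_max lexx orbT.
(* Twice the required rate: letters before the time [k1 ^ 2] are only known to be at least 1, and
   they are at most half of the first [K ^ 2] letters. *)
pose B := 2 * C0; have B0 : 0 <= B by rewrite mulr_ge0.
(* At squares [n ^ alpha] becomes [k ^ p] with [p > 1], and the increments of [k ^ p] are
   unbounded. *)
pose p := 2 * alpha; have p1 : 1 < p by rewrite /p; lra.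
have PhiE k : Phi (k ^ 2)%N = expR (k%:R `^ p).
  by rewrite /Phi /p powRrM natrX powR_mulrn.
have p10 : 0 < p - 1 by rewrite subr_gt0.
have [k0 k0P] := powR_unbounded (3 + 2 * (1 + a * B) + 2) p10.
pose k1 := (k0 + N).+1.
(* By pinching, the [2 k + 1] letters between consecutive squares have a power sum at least equal to
   the right-hand side. Hence their product is at least [expR (B * (2 k + 1))]. *)
have step k : (k1 <= k)%N ->
    (2 * k + 1)%:R * expR (a * (B * (2 * k + 1)%:R)) <=
    Phi ((k.+1) ^ 2)%N / 2 - 2 * Phi (k ^ 2)%N.
  move=> kk; rewrite !PhiE.
  have T := k0P k.+1 (leq_trans (leq_addr N k0) (ltnW (leqW kk))).
  have D := powR_sub_ge k (ltW p1).
  have aB : 0 <= a * B by rewrite mulr_ge0 // ltW.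
  have D3 : 3 <= k.+1%:R `^ p - (k%:R : R) `^ p by lra.
  have E8 : 8 * expR ((k%:R : R) `^ p) <= expR (k.+1%:R `^ p).
    apply: le_trans (_ : expR 3 * expR (k%:R `^ p) <= _).
      by rewrite ler_wpM2r ?expR_ge0 // expR3_ge8.
    by rewrite -expRD ler_expR; lra.
  have n1 : (2 * k + 1)%:R <= expR ((2 * k + 1)%:R) :> R.
    by apply: le_trans (expR_ge1Dx _); rewrite lerDr.
  have big : 4 * ((2 * k + 1)%:R * expR (a * (B * (2 * k + 1)%:R))) <=
      expR (k.+1%:R `^ p).
    apply: le_trans (_ : expR 2 * (expR ((2 * k + 1)%:R) *
         expR (a * (B * (2 * k + 1)%:R))) <= _).
      by apply: ler_pM; rewrite ?mulr_ge0 ?expR_ge0 ?expR2_ge4 // ler_wpM2r ?expR_ge0.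
    rewrite -!expRD ler_expR -(mulr_powRB1 (ler0n R k.+1) (lt_trans ltr01 p1)).
    have kE : (2 * k + 1)%:R = 2 * k.+1%:R - 1 :> R.
      by rewrite natrD natrM -natr1; ring.
    have k11 : 1 <= k.+1%:R :> R by rewrite ler1n.
    apply: le_trans (_ : k.+1%:R * (3 + 2 * (1 + a * B) + 2) <= _); last first.
      by rewrite ler_wpM2l.
    rewrite kE mulrA; move: aB k11; set c := a * B; set y := k.+1%:R => aB k11.
    by move: aB k11; clear; nra.
  by move: E8 big; clear; lra.
(* The alphabet is made finite by pinching at the time [K ^ 2]: the [a]-th power of a letter is at
   most the whole sum. *)
pose K := (2 * k1).+1; exists (K ^ 2)%N, (Num.truncn ((2 * Phi (K ^ 2)%N) `^ a^-1)).
split=> [//|x Nx]; have [//|w [ww sw wx wP]] := Nx (K ^ 2)%N.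
have K0 : (0 < K ^ 2)%N by [].
have NK : (N <= K ^ 2)%N.
  by rewrite /K /k1; clear; rewrite -mulnn; nia.
exists w; split=> //.
  apply/allP => b bw; rewrite truncn_ge_nat ?powR_ge0 //.
  have : b%:R `^ a <= 2 * Phi (K ^ 2)%N.
    apply: le_trans (letter_le_power_sum bw) _.
    by have /andP[_] := wP _ K0 NK (leqnn _); rewrite take_oversize // sw.
  move=> /(ge0_ler_powR (_ : 0 <= a^-1)); rewrite -powRrM mulfV ?gt_eqF //.
  rewrite powRr1 //; apply; rewrite ?invr_ge0 ?ltW // nnegrE ?powR_ge0 //.
  by rewrite mulr_ge0 ?expR_ge0.
have main k : (k1 <= k)%N -> (k <= K)%N ->
    expR (B * ((k ^ 2)%:R - (k1 ^ 2)%:R)) <= \prod_(b <- take (k ^ 2) w) (b%:R : R).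
  move=> + kK; elim: k kK => [|k IH] kK; first by rewrite /k1.
  rewrite leq_eqVlt => /predU1P[<-|].
    rewrite subrr mulr0 expR0; rewrite big_seq; elim/big_ind : _ => //.
      by move=> y z y1 z1; rewrite -[leLHS]mulr1; apply: ler_pM.
    by move=> b /mem_take /(allP ww) b0; rewrite ler1n.
  rewrite ltnS => kk1.
  have kle : (k ^ 2 <= k.+1 ^ 2)%N by rewrite leq_sqr.
  have kK2 : (k.+1 ^ 2 <= K ^ 2)%N by rewrite leq_sqr.
  have kN : (N <= k)%N by apply: leq_trans kk1; rewrite /k1 leqW // leq_addl.
  have N1 : (N <= k ^ 2)%N.
    by apply: leq_trans kN _; rewrite -mulnn leq_pmulr // (leq_trans _ kk1).
  have k20 : (0 < k ^ 2)%N by rewrite expn_gt0 (leq_trans _ kk1).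
  have /andP[_ h1] := wP _ k20 N1 (leq_trans kle kK2).
  have /andP[h2 _] := wP _ (ltac:(by rewrite expn_gt0) : (0 < k.+1 ^ 2)%N)
    (leq_trans N1 kle) kK2.
  have tE : take (k.+1 ^ 2) w = take (k ^ 2) w ++ drop (k ^ 2) (take (k.+1 ^ 2) w).
    by rewrite -(take_takel w kle) cat_take_drop.
  set v := drop _ _ in tE.
  have wv : word v by apply: word_drop; apply: word_take.
  have sv : size v = (2 * k + 1)%N.
    by rewrite size_drop size_takel ?sw // sqrnS addKn.
  have vlow : (2 * k + 1)%:R * expR (a * (B * (2 * k + 1)%:R)) <= power_sum v.
    apply: le_trans (step k kk1) _.
    by move: h2; rewrite tE power_sum_cat; clear -h1; lra.
  have : expR (a * (B * (2 * k + 1)%:R)) <= (\prod_(b <- v) (b%:R : R)) `^ a.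
    have s0 : 0 < (2 * k + 1)%:R :> R by rewrite ltr0n addn1.
    rewrite -(ler_pM2l s0); apply: le_trans vlow _.
    by rewrite -sv; exact: power_sum_le_prod.
  rewrite mulrC expRM => pv.
  have {}pv : expR (B * (2 * k + 1)%:R) <= \prod_(b <- v) (b%:R : R).
    rewrite leNgt; apply/negP => /(gt0_ltr_powR ha).
    by rewrite !nnegrE expR_ge0 prodr_ge0 // => /(_ isT isT); rewrite ltNge pv.
  rewrite tE big_cat /=.
  have -> : B * ((k.+1 ^ 2)%:R - (k1 ^ 2)%:R) =
      B * ((k ^ 2)%:R - (k1 ^ 2)%:R) + B * (2 * k + 1)%:R.
    by rewrite -mulrDr addrAC -natrD -sqrnS.
  by rewrite expRD; apply: ler_pM; rewrite ?expR_ge0 // IH // ltnW.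
have := main K _ (leqnn _); rewrite take_oversize ?sw // => /(_ _) le_main.
apply: le_trans (le_main _); last by rewrite /K leqW // leq_pmull.
rewrite ler_expR.
apply: le_trans (_ : C0 * (K ^ 2)%:R <= _).
  by rewrite ler_wpM2r // le_max lexx.
rewrite /B [2 * C0]mulrC -mulrA ler_wpM2l //.
have : (2 * (k1 ^ 2) <= K ^ 2)%N by rewrite /K; clear; rewrite -!mulnn; nia.
by rewrite -(ler_nat R) natrM; lra.
Qed.

End LevelSets.

(** * Upper bound for doubly exponential growth *)

Section RootInequalities.
Context {R : realType} (a : R).
Hypothesis ha : 0 < a.

Lemma powRK (x : R) : 0 <= x -> (x `^ a) `^ a^-1 = x.
Proof. by move=> x0; rewrite -powRrM mulfV ?gt_eqF // powRr1. Qed.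

Lemma powRVK (x : R) : 0 <= x -> (x `^ a^-1) `^ a = x.
Proof. by move=> x0; rewrite -powRrM mulVf ?gt_eqF // powRr1. Qed.

Lemma ler_powR_root (x y : R) : 0 <= x -> x `^ a <= y -> x <= y `^ a^-1.
Proof.
move=> x0 xy; rewrite -[leLHS]powRK //; apply: ge0_ler_powR => //.
- by rewrite invr_ge0 ltW.
- by rewrite nnegrE powR_ge0.
- by rewrite nnegrE (le_trans _ xy) // powR_ge0.
Qed.

Lemma root_ler_powR (x y : R) : 0 <= x -> 0 <= y -> y <= x `^ a -> y `^ a^-1 <= x.
Proof.
move=> x0 y0 xy; rewrite -[leRHS]powRK //; apply: ge0_ler_powR => //.
- by rewrite invr_ge0 ltW.
- by rewrite nnegrE powR_ge0.
Qed.

Lemma expR_root (x : R) : expR x `^ a^-1 = expR (x / a).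
Proof. by rewrite expRM. Qed.

End RootInequalities.

Lemma sum_cond_le_const (R : numDomainType) (I : Type) (r : seq I) (P : pred I)
  (F : I -> R) (c : R) : 0 <= c -> (forall i, P i -> F i <= c) ->
  \sum_(i <- r | P i) F i <= (size r)%:R * c.
Proof.
move=> c0 H; elim: r => [|i r IH]; first by rewrite big_nil mul0r.
rewrite big_cons /= -natr1 mulrDl mul1r; case: ifPn => Pi.
  by rewrite addrC lerD ?H.
by rewrite (le_trans IH) // lerDl.
Qed.

Lemma hausdorff_measure_superexp_upper (R : realType) (d : R) (f : nat -> R -> R)
  (a : R) (phi : R -> R) (beta s : R) :
  d_decaying_gauss_like d f -> 1 < d -> 0 < a ->
  (forall j : nat, (0 < j)%N -> potential_value f phi j = j%:R `^ a) ->
  1 < beta -> (d * beta - beta + 1)^-1 < s ->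
  hausdorff_measure s
    (birkhoff_level_set f phi (fun n => expR (beta ^+ n))) = 0%E.
Proof.
move=> hf hd ha hval beta1 hs; pose Phi n : R := expR (beta ^+ n).
have beta0 : 0 < beta by apply: lt_trans beta1.
have b10 : 0 < beta - 1 by rewrite subr_gt0.
pose den := d * beta - beta + 1.
have den0 : 0 < den.
  have -> : den = (d - 1) * beta + 1 by rewrite /den; ring.
  by rewrite addr_gt0 // mulr_gt0 // subr_gt0.
have s0 : 0 < s by apply: lt_trans hs; rewrite invr_gt0.
have sden : 1 < s * den by rewrite -ltr_pdivrMr // div1r.
apply: (@hausdorff_measure_subset R s _ (\bigcup_N pinched_set f a Phi N)).
  by apply: (level_set_sub_pinched hf hval) => n; exact: expR_gt0.
apply: hausdorff_measure_bigcup_eq0 => // N e e0.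
(* The first bound keeps [q > 1], the second keeps [kappa > 0]. *)
pose delta := Num.min ((d - 1) / 2) ((s * den - 1) / (2 * (s * beta))).
have delta0 : 0 < delta.
  by rewrite lt_min !divr_gt0 ?subr_gt0 ?mulr_gt0.
have delta1 : delta < d - 1.
  by rewrite gt_min; apply/orP; left; move: hd; clear; lra.
have delta2 : s * beta * delta <= (s * den - 1) / 2.
  have : delta <= (s * den - 1) / (2 * (s * beta)) by rewrite ge_min lexx orbT.
  have sb0 : 0 < 2 * (s * beta) by rewrite !mulr_gt0.
  by rewrite ler_pdivlMr //; lra.
have [C1 C10 HC1] := one_sub_rend_le hf delta0 delta1.
have [K1 [K2 [K10 K20 H]]] := map_bounds hf delta0.
set q := d - delta in HC1 H.
have q1 : 1 < q by rewrite /q; move: delta1; clear; lra.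
(* The logarithm of the covering sum has [beta ^ n.+1 / a] with coefficient [(1 - q s) / (beta - 1)]
   from the choices of letters plus [(1 - q) s] from the tail; this is [- kappa / (beta - 1)]. *)
pose kappa := s * (q * beta - beta + 1) - 1.
have kappa0 : 0 < kappa.
  have -> : kappa = s * den - s * beta * delta - 1 by rewrite /kappa /den /q; ring.
  by move: delta2 sden; clear; lra.
have [i0 i0P] := expr_superlinear (3 / (beta - 1)) beta1.
(* With a factor 8, the new letter contributes at least [Phi i.+1 / 2 - 2 * Phi i >= Phi i.+1 / 4],
   whence the constant in [c1]. *)
have gap i : (i0 < i)%N -> 8 * Phi i <= Phi i.+1.
  move=> i0i; have i1 : 1 <= i%:R :> R by rewrite ler1n (leq_trans _ i0i).
  have h3 : 3 <= beta ^+ i.+1 - beta ^+ i.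
    have := i0P i (ltnW i0i); rewrite mulrAC ler_pdivrMr // exprS.
    by move: i1; set y : R := beta ^+ i; set z : R := i%:R; clear; nra.
  apply: le_trans (_ : expR 3 * Phi i <= _).
    by rewrite ler_wpM2r ?expR_ge0 // expR3_ge8.
  by rewrite -expRD ler_expR; move: h3; clear; lra.
(* After [N'] both pinching and the gap are available. Positions up to [N'] receive the crude bound
   [M0] and only add a constant. *)
pose N' := (N + i0).+1.
pose c1 : R := 4^-1 `^ a^-1; have c10 : 0 < c1 by rewrite powR_gt0 // invr_gt0.
pose c2 : R := 2 `^ a^-1; have c20 : 0 < c2 by rewrite powR_gt0.
pose v i : R := expR (beta ^+ i.+1 / a).
have v0 i : 0 < v i by exact: expR_gt0.
have rootPhi (c : R) i : 0 <= c -> (c * Phi i.+1) `^ a^-1 = c `^ a^-1 * v i.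
  by move=> c0; rewrite powRM ?expR_ge0 // expR_root.
pose h (b : nat) : R := (K2 / b%:R `^ q) `^ s.
have h0 b : 0 <= h b by exact: powR_ge0.
pose M0 := Num.truncn (c2 * v N').
pose D i := if (i <= N')%N then iota 1 M0 else
  [seq b <- iota 1 (Num.truncn (c2 * v i)) | c1 * v i <= b%:R].
pose lnQ := ln (c2 * (K2 / c1 `^ q) `^ s).
pose lnH := ln (1 + \sum_(b <- iota 1 M0) h b).
pose E i := if (i <= N')%N then lnH else lnQ + (1 - q * s) * (beta ^+ i.+1 / a).
have sumD i : \sum_(b <- D i) h b <= expR (E i).
  rewrite /D /E; case: ifPn => _.
    have hh : 0 <= \sum_(b <- iota 1 M0) h b by apply: sumr_ge0.
    by rewrite lnK ?posrE ?ltr_pwDl // lerDr.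
  rewrite big_filter.
  pose hm := (K2 / (c1 * v i) `^ q) `^ s.
  have : (Num.truncn (c2 * v i))%:R <= c2 * v i.
    by rewrite truncn_le // mulr_ge0 // ltW.
  move: (Num.truncn (c2 * v i)) => T TE.
  have hm_ge b : c1 * v i <= b%:R -> h b <= hm.
    move=> bc.
    apply: ge0_ler_powR; rewrite ?nnegrE ?divr_ge0 ?powR_ge0 ?(ltW K20) ?(ltW s0) //.
    have cv0 : 0 < c1 * v i by rewrite mulr_gt0.
    rewrite ler_pM2l // lef_pV2 ?posrE ?powR_gt0 // ?(lt_le_trans cv0) //.
    apply: ge0_ler_powR; rewrite ?nnegrE // ?(ltW cv0) //.
    by rewrite ltW // (lt_trans ltr01).
  apply: (le_trans (sum_cond_le_const _ (powR_ge0 _ _) hm_ge)); rewrite size_iota.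
  apply: (@le_trans _ _ (c2 * v i * hm)); first by rewrite ler_wpM2r ?powR_ge0.
  have K2c : 0 < K2 / c1 `^ q by rewrite divr_gt0 // powR_gt0.
  have -> : hm = (K2 / c1 `^ q) `^ s * v i `^ (- (q * s)).
    rewrite /hm (powRM q (ltW c10) (ltW (v0 i))) invfM mulrA powRM ?(ltW K2c) //; last first.
      by rewrite invr_ge0 powR_ge0.
    by congr (_ * _); rewrite -powRN -powRrM mulNr.
  rewrite expRD lnK; last by rewrite posrE mulr_gt0 // powR_gt0.
  rewrite [(1 - q * s) * _]mulrC expRM -/(v i).
  rewrite (@powRD _ (v i) 1); last by rewrite (gt_eqF (v0 i)) implybT.
  rewrite powRr1 ?(ltW (v0 i)) //.
  by rewrite le_eqVlt; apply/orP; left; apply/eqP; ring.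
(* [A0 * beta ^ n.+1] is a discrete primitive of the leading part of [E n], by the geometric
   series. *)
pose A0 := (1 - q * s) / (a * (beta - 1)).
pose c0 := \sum_(i < N'.+1) E i - A0 * beta ^+ N'.+2.
have sumE n : (N' < n)%N -> \sum_(i < n) E i <= c0 + n%:R * `|lnQ| + A0 * beta ^+ n.+1.
  elim: n => // n IH; rewrite ltnS leq_eqVlt => /predU1P[<-|N'n].
    by rewrite /c0 addrAC subrK lerDl mulr_ge0.
  rewrite big_ord_recr /= {2}/E leqNgt N'n /=.
  have -> : beta ^+ n.+2 = (beta - 1) * beta ^+ n.+1 + beta ^+ n.+1.
    by rewrite exprS; ring.
  have -> : A0 * ((beta - 1) * beta ^+ n.+1 + beta ^+ n.+1) =
      (1 - q * s) * (beta ^+ n.+1 / a) + A0 * beta ^+ n.+1.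
    rewrite mulrDr; congr (_ + _); rewrite /A0; field.
    by rewrite !gt_eqF.
  have := IH N'n; have := ler_norm lnQ; rewrite -natr1.
  set X : R := (1 - q * s) * _; set Y : R := A0 * _; set Z : R := `|lnQ|; set S : R := \sum_(_ < _) _.
  by clear; lra.
pose c3 := s * (ln C1 + (1 - q) * ln (c1 / 4)).
pose k' := kappa / (a * (beta - 1)).
have k'0 : 0 < k' by rewrite divr_gt0 // mulr_gt0.
have [n1 n1P] := expr_superlinear ((`|c0 + c3 - ln e| + `|lnQ|) / k') beta1.
have [n2 n2P] := expr_superlinear (a * ln (4 / c1)) beta1.
pose n := (N' + n1 + n2).+1.
have N'n : (N' < n)%N by rewrite /n; clear; lia.
have vn4 : 4 <= c1 * v n.
  rewrite mulrC -ler_pdivrMr // -[leLHS]lnK ?posrE ?divr_gt0 // ler_expR.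
  rewrite ler_pdivlMr // mulrC; have [l0|l0] := leP 0 (a * ln (4 / c1)); last first.
    by rewrite (le_trans (ltW l0)) // exprn_ge0 // ltW.
  apply: le_trans (n2P n.+1 _); last by rewrite /n; clear; lia.
  by rewrite ler_peMr // ler1n.
(* Half of the least possible value of the letter at position [n]: that letter exceeds [m], while
   [m] stays comparable to [v n]. *)
pose m := Num.truncn (c1 * v n / 2).
have m_le : m%:R <= c1 * v n / 2.
  by rewrite truncn_le //; move: vn4; clear; lra.
have m_gt : c1 * v n / 4 <= m%:R.
  have := truncnS_gt (c1 * v n / 2); rewrite -/m -(natr1 m); move: vn4; clear; lra.
have m0 : (0 < m)%N.
  by rewrite -(ltr0n R); move: m_gt vn4; clear; lra.
pose rad (w : seq nat) := \prod_(b <- w) (K2 / b%:R `^ q) * (1 - rend f m).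
have rm0 : 0 <= 1 - rend f m by rewrite subr_ge0 ltW // (rend_lt1 hf).
have K2q b : 0 <= K2 / b%:R `^ q by rewrite divr_ge0 ?powR_ge0 // ltW.
exists (seq nat), (words D n),
  (fun w => comp_word f w @` [set z | rend f m <= z <= 1]), rad; split.
- move=> x Nx; have [//|w [ww sw wx wP]] := Nx n.+1.
  have letter i : (i <= n)%N -> (N' < i)%N ->
      c1 * v i <= (nth 0%N w i)%:R <= c2 * v i.
    move=> ilt N'i.
    have Ni : (N <= i)%N by move: N'i; rewrite /N'; clear; lia.
    have i0i : (i0 < i)%N by move: N'i; rewrite /N'; clear; lia.
    have /andP[_ h1] := wP i (leq_trans (ltn0Sn _) N'i) Ni (leqW ilt).
    have /andP[h2 h3] := wP i.+1 (ltn0Sn _) (leqW Ni) (ltac:(by []) : (i.+1 <= n.+1)%N).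
    have tE : take i.+1 w = rcons (take i w) (nth 0%N w i).
      by rewrite (take_nth 0%N) // sw.
    move: h2 h3; rewrite tE -cats1 power_sum_cat /power_sum big_seq1 -!/(power_sum _ _).
    have p0 := @power_sum_ge0 R a (take i w); have := gap i i0i => g8 h2 h3.
    rewrite -!rootPhi ?invr_ge0 //; apply/andP; split.
      apply: root_ler_powR => //; first by rewrite mulr_ge0 ?invr_ge0 ?expR_ge0.
      by move: h2 h1 g8; rewrite /power_sum; clear; lra.
    apply: ler_powR_root => //.
    by move: h3 p0; rewrite /power_sum; clear; lra.
  have early i : (i <= N')%N -> (nth 0%N w i)%:R <= c2 * v N'.
    move=> iN'; rewrite -rootPhi //; apply: ler_powR_root => //.
    have /andP[_ h3] := wP N'.+1 (ltn0Sn _) (ltac:(rewrite /N'; clear; lia) : (N <= N'.+1)%N)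
      (ltac:(by rewrite ltnS ltnW) : (N'.+1 <= n.+1)%N).
    apply: le_trans h3; apply: letter_le_power_sum.
    rewrite -(nth_take 0%N (ltac:(by rewrite ltnS) : (i < N'.+1)%N)).
    by apply: mem_nth; rewrite size_takel // sw ltnS ltnW.
  have wpos i : (i <= n)%N -> (0 < nth 0%N w i)%N.
    by move=> ilt; apply: (allP ww); rewrite mem_nth // sw ltnS.
  have /basic_intervalP[z z01 xz] := wx.
  exists (take n w).
    apply: mem_words => [|i ilt]; first by rewrite size_takel // sw.
    rewrite nth_take // /D; case: ifPn => iN'.
      rewrite mem_iota wpos ?(ltnW ilt) //= add1n ltnS truncn_ge_nat ?early //.
      by rewrite mulr_ge0 // ltW.
    have /andP[l1 l2] := letter i (ltnW ilt) (ltac:(by rewrite ltnNge) : (N' < i)%N).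
    rewrite mem_filter l1 mem_iota wpos ?(ltnW ilt) //= add1n ltnS truncn_ge_nat //.
    by rewrite mulr_ge0 // ltW.
  exists (f (nth 0%N w n) z) => /=; last first.
    rewrite -xz -[in RHS](cat_take_drop n w) comp_word_cat; congr comp_word.
    rewrite (drop_nth 0%N) ?sw // drop_oversize ?sw //.
  have bn := wpos n (leqnn _).
  have /andP[l1 _] := letter n (leqnn _) N'n.
  have mb : (m < nth 0%N w n)%N.
    by rewrite -(ltr_nat R); move: l1 m_le vn4; clear; lra.
  rewrite (le_trans (rend_le_lend hf m0 mb)) /=; last first.
    by have /andP[] := map_between hf bn z01.
  by have /andP[] := map01 hf bn z01.
- move=> w /words_mem[sw wD]; split; first by rewrite mulr_ge0 // prodr_ge0.
  have ww : word w.
    apply/(all_nthP 0%N) => i; rewrite sw => /wD; rewrite /D.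
    by case: ifP => _; rewrite ?mem_filter mem_iota => /andP[] // _ /andP[].
  have r0 : 0 <= rend f m.
    exact: le_trans (lend_ge0 hf m0) (ltW (lend_lt_rend hf m0)).
  move=> x y [u /= /andP[u0 u1] <-] [t /= /andP[t0 t1] <-].
  have u01 : 0 <= u <= 1 by rewrite (le_trans r0).
  have t01 : 0 <= t <= 1 by rewrite (le_trans r0).
  have /andP[_ hb] := comp_word_bounds hf (fun i _ => divr_ge0 (ltW K10) (powR_ge0 _ _))
    (fun i _ => K2q i) H ww u01 t01.
  apply: (le_trans hb); rewrite ler_wpM2l ?prodr_ge0 //.
  by rewrite ler_distl; move: u0 u1 t0 t1; clear; move=> *; apply/andP; split; lra.
under eq_bigr => w _.
  rewrite /rad powRM ?prodr_ge0 // prod_powR //.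
  over.
rewrite -mulr_suml sum_words.
apply: (@le_trans _ _ (expR (\sum_(i < n) E i) *
    expR (s * (ln C1 + (1 - q) * ln (c1 / 4) + (1 - q) * (beta ^+ n.+1 / a))))).
  apply: ler_pM; rewrite ?powR_ge0 //; first by apply: prodr_ge0 => i _; apply: sumr_ge0 => b _; exact: powR_ge0.
    rewrite expR_sum; apply: ler_prod => i _; rewrite sumD andbT.
    by apply: sumr_ge0 => b _; exact: powR_ge0.
  rewrite [s * _]mulrC expRM; apply: ge0_ler_powR; rewrite ?nnegrE ?expR_ge0 ?(ltW s0) //.
  apply: (le_trans (HC1 m m0)); rewrite !expRD lnK ?posrE // -mulrA ler_pM2l //.
  rewrite -expRD -mulrDr mulrC [expR _]expRM expRD lnK ?posrE ?divr_gt0 //.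
  rewrite -(opprB q 1) !powRN lef_pV2 ?posrE ?powR_gt0 ?mulr_gt0 ?divr_gt0 ?ltr0n ?expR_gt0 //.
  apply: ge0_ler_powR; rewrite ?nnegrE ?mulr_ge0 ?divr_ge0 ?(ltW c10) ?(ltW (v0 n)) //.
    by rewrite subr_ge0 ltW.
  by rewrite mulrAC.
rewrite -expRD -[leRHS]lnK ?posrE // ler_expR.
(* The term in [A0] cancels the one in [sumE]; what remains is [- k' * beta ^ n.+1], which beats the
   terms linear in [n]. *)
have EQ : s * (ln C1 + (1 - q) * ln (c1 / 4) + (1 - q) * (beta ^+ n.+1 / a)) =
   c3 - (k' + A0) * beta ^+ n.+1.
  rewrite /c3 /k' /A0 /kappa; field.
  by rewrite !gt_eqF.
rewrite EQ; have := sumE n N'n.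
have n1n : (n1 <= n.+1)%N by rewrite /n; clear; lia.
have := n1P n.+1 n1n; rewrite mulrAC ler_pdivrMr //.
have := ler_norm (c0 + c3 - ln e); have n11 : 1 <= n.+1%:R :> R by rewrite ler1n.
have nE : n.+1%:R = n%:R + 1 :> R by rewrite -natr1.
have W0 : 0 <= `|c0 + c3 - ln e| by [].
have Z0 : 0 <= `|lnQ| by [].
have nn0 : 0 <= n%:R :> R by [].
move: W0 Z0 n11 nn0; rewrite nE.
set W : R := `|c0 + _ - _|; set Z : R := `|lnQ|; set S : R := \sum_(_ < _) _.
set Y : R := beta ^+ _.
set y : R := n%:R; move: (ln e) => le; clear; nra.
Qed.

(** * Coding points by mixed radix digits *)

Section MixedRadix.
Context {R : realType}.
Variable t : nat -> nat.
Hypothesis t2 : forall i, (2 <= t i)%N.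
Implicit Types (y z : R) (n : nat).

Definition radix_prod n : nat := \prod_(i < n) t i.

(** For [y >= 0] the natural subtraction does not truncate: the floor at level [n.+1] is at least
    [t n] times the floor at level [n]. *)
Definition radix_digit y n : nat :=
  (Num.truncn ((radix_prod n.+1)%:R * y) - t n * Num.truncn ((radix_prod n)%:R * y))%N.

Lemma radix_prodS n : radix_prod n.+1 = (radix_prod n * t n)%N.
Proof. by rewrite /radix_prod big_ord_recr. Qed.

Lemma radix_prod_ge n : (2 ^ n <= radix_prod n)%N.
Proof.
elim: n => [|n IH]; first by rewrite /radix_prod big_ord0.
by rewrite radix_prodS expnSr leq_mul.
Qed.

Lemma radix_prod_gt0 n : (0 < radix_prod n)%N.
Proof. by apply: leq_trans (radix_prod_ge n); rewrite expn_gt0. Qed.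

Lemma radix_floorP y n : 0 <= y ->
  (Num.truncn ((radix_prod n)%:R * y))%:R <= (radix_prod n)%:R * y <
  (Num.truncn ((radix_prod n)%:R * y)).+1%:R.
Proof. by move=> y0; apply: truncn_itv; rewrite mulr_ge0. Qed.

Lemma radix_digitP y n : 0 <= y ->
  (radix_digit y n < t n)%N /\
  Num.truncn ((radix_prod n.+1)%:R * y) =
    (t n * Num.truncn ((radix_prod n)%:R * y) + radix_digit y n)%N.
Proof.
move=> y0; have /andP[l1 l2] := radix_floorP n y0.
have /andP[m1 m2] := radix_floorP n.+1 y0.
rewrite /radix_digit; set F := Num.truncn _ in l1 l2 *.
set G := Num.truncn _ in m1 m2 *.
have t0 : 0 < (t n)%:R :> R by rewrite ltr0n (leq_trans _ (t2 n)).
have PE : (radix_prod n.+1)%:R * y = (t n)%:R * ((radix_prod n)%:R * y).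
  by rewrite radix_prodS natrM; ring.
have FG : (t n * F < G.+1)%N.
  by rewrite -(ltr_nat R) natrM (le_lt_trans _ m2) // PE ler_pM2l.
have GF : (G < t n * F.+1)%N.
  by rewrite -(ltr_nat R) natrM (le_lt_trans m1) // PE ltr_pM2l.
by rewrite mulnS in GF; split; [rewrite ltn_subLR // addnC|rewrite subnKC].
Qed.

(** Take the first level at which the floors differ. The digits agree before it, and there the two
    floors differ by exactly the difference of the last digits. *)
Lemma radix_digit_separate y z : 0 <= y -> y < z -> z < 1 -> exists n,
  [/\ forall i, (i < n)%N -> radix_digit y i = radix_digit z i,
      (radix_digit y n < radix_digit z n)%N &
      z - y <= (radix_digit z n - radix_digit y n).+1%:R / (radix_prod n.+1)%:R].
Proof.
move=> y0 yz z1; have z0 : 0 <= z by apply: le_trans y0 (ltW yz).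
pose F x n := Num.truncn ((radix_prod n)%:R * x : R).
have ex : exists n, F y n != F z n.
  (* [radix_prod n >= 2 ^ n > 1 / (z - y)] puts the two scaled points more than 1 apart, so their
     floors differ. *)
  pose n := Num.truncn ((z - y)^-1).
  exists n; apply/eqP => Fe.
  have /andP[l1 l2] := radix_floorP n y0; have /andP[m1 m2] := radix_floorP n z0.
  rewrite -/(F y n) in l1 l2; rewrite -/(F z n) -Fe in m1 m2.
  have P0 : 0 < (radix_prod n)%:R :> R by rewrite ltr0n radix_prod_gt0.
  have zy : 0 < z - y by rewrite subr_gt0.
  have h1 : (radix_prod n)%:R * (z - y) < 1.
    rewrite mulrBr; move: l1 l2 m1 m2; rewrite -natr1.
    set a := (_%:R * y); set b := (_%:R * z); set c := _%:R; lra.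
  have h2 : (z - y)^-1 < (radix_prod n)%:R.
    apply: lt_le_trans (truncnS_gt _) _; rewrite ler_nat.
    by apply: leq_trans (radix_prod_ge n); exact: ltn_expl.
  have := ltr_pM2r zy (z - y)^-1 (radix_prod n)%:R.
  by rewrite h2 mulVf ?gt_eqF // => /lt_trans /(_ h1); rewrite ltxx.
have [m Fm minm] := ex_minnP ex.
have F0 x : 0 <= x -> x < 1 -> F x 0%N = 0%N.
  by move=> x0 x1; apply/truncn0Pn; rewrite /radix_prod big_ord0 mul1r -ltNge.
case: m Fm minm => [|n] Fn minn.
  by move: Fn; rewrite !F0 // (lt_trans yz).
have Feq i : (i <= n)%N -> F y i = F z i.
  by move=> iltn; apply/eqP/negPn/negP => /minn; rewrite leqNgt ltnS iltn.
have [_ Ey] := radix_digitP n y0; have [_ Ez] := radix_digitP n z0.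
rewrite -/(F y n.+1) -/(F y n) in Ey; rewrite -/(F z n.+1) -/(F z n) -(Feq n (leqnn n)) in Ez.
have /andP[l1 l2] := radix_floorP n.+1 y0; have /andP[m1 m2] := radix_floorP n.+1 z0.
rewrite -/(F y n.+1) in l1 l2; rewrite -/(F z n.+1) in m1 m2.
have P0 : 0 < (radix_prod n.+1)%:R :> R by rewrite ltr0n radix_prod_gt0.
have Fle : (F y n.+1 < F z n.+1)%N.
  rewrite ltn_neqAle Fn /= -ltnS -(ltr_nat R); apply: le_lt_trans l1 _.
  by apply: lt_trans m2; rewrite ltr_pM2l.
have dlt : (radix_digit y n < radix_digit z n)%N.
  by move: Fle; rewrite Ey Ez ltn_add2l.
exists n; split=> //.
  move=> i ilt; rewrite /radix_digit -!/(F _ _) !Feq // ltnW //.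
rewrite ler_pdivlMr // mulrC mulrBr -natr1 natrB ?(ltnW dlt) //.
move: l1 l2 m1 m2; rewrite Ey Ez -!natr1 !natrD.
set a := (_%:R * y); set b := (_%:R * z); lra.
Qed.

End MixedRadix.

(** * Points with prescribed codes *)

Section CodedPoints.
Context {R : realType} (d : R) (f : nat -> R -> R) (a : R) (phi : R -> R).
Hypothesis hf : d_decaying_gauss_like d f.
Hypothesis hval : forall j : nat, (0 < j)%N -> potential_value f phi j = j%:R `^ a.
Implicit Types (c : nat -> nat) (Phi : nat -> R).

Definition coded c (x : R) := forall n, basic_interval f (mkseq c n) x.

Lemma word_mkseq c n : (forall i, (0 < c i)%N) -> word (mkseq c n).
Proof. by move=> c0; apply/allP => b /mapP[i _ ->]. Qed.

Lemma mkseq_cat c n m : (n <= m)%N -> exists v, mkseq c m = mkseq c n ++ v /\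
  forall i, (n <= i < m)%N -> c i \in v.
Proof.
move=> nm; exists [seq c i | i <- iota n (m - n)]; split.
  by rewrite /mkseq -map_cat -iotaD subnKC.
by move=> i im; apply: map_f; rewrite mem_iota subnKC.
Qed.

Lemma exists_coded c : (forall i, (0 < c i)%N) -> exists x, coded c x.
Proof.
move=> c0; pose F n := comp_word f (mkseq c n).
have W n : word (mkseq c n) by exact: word_mkseq.
pose L n := Num.min (F n 0) (F n 1); pose U n := Num.max (F n 0) (F n 1).
have btw n m z : (n <= m)%N -> 0 <= z <= 1 -> L n <= F m z <= U n.
  move=> nm z01; have [v [E _]] := mkseq_cat c nm.
  have wv : word v by have := W m; rewrite E /word all_cat => /andP[].
  rewrite /F E comp_word_cat; have [K gK] := comp_word_lipschitz hf (W n).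
  apply: image01_between gK _ _ _ => [x y|]; first exact: (comp_word_inj hf (W n)).
  exact: (comp_word01 hf wv).
have i0 : 0 <= (0 : R) <= 1 by rewrite lexx ler01.
have i1 : 0 <= (1 : R) <= 1 by rewrite lexx ler01.
have LU n m : L n <= U m.
  have [nm|mn] := leqP n m.
    by apply: le_trans (_ : F m 0 <= _); [case/andP: (btw n m 0 nm i0)|rewrite le_max lexx].
  apply: le_trans (_ : F n 0 <= _); first by rewrite ge_min lexx.
  by case/andP: (btw m n 0 (ltnW mn) i0).
(* By nesting, every right end bounds every left end, so the supremum of the left ends lies in all
   the cylinders. *)
have bd m : ubound (range L) (U m) by move=> _ [n _ <-].
pose x := sup (range L).
exists x => n; apply/basic_intervalP.
have [K gK] := comp_word_lipschitz hf (W n).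
have [|z z01 zx] := @image01_surj R (F n) K gK x; last by exists z.
apply/andP; split; last by apply: ge_sup; [exists (L 0%N); exists 0%N|exact: bd].
by apply: ub_le_sup; [exists (U 0%N)|exists n].
Qed.

(** Letters above 1 infinitely often put every tail of the code inside (0, 1). The point is then
    interior to each of its cylinders, its prefixes are determined, and all its Birkhoff sums are
    well defined. *)
Lemma coded_level_set c x Phi : (forall i, (0 < c i)%N) ->
  (forall n, exists2 m, (n <= m)%N & (2 <= c m)%N) -> coded c x ->
  (power_sum a (mkseq c n) / Phi n @[n --> \oo] --> (1 : R)) ->
  birkhoff_level_set f phi Phi x.
Proof.
move=> c0 c2 cx lim.
have tail n : exists v, [/\ word v, has (leq 2) v &
    exists2 z, 0 <= z <= 1 & x = comp_word f (mkseq c n) (comp_word f v z)].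
  have [m nm cm] := c2 n; have [v [E vP]] := mkseq_cat c (leqW nm).
  exists v; split.
  - by have := word_mkseq m.+1 c0; rewrite E /word all_cat => /andP[].
  - by apply/hasP; exists (c m) => //; apply: vP; rewrite nm ltnSn.
  - have /basic_intervalP[z z01 <-] := cx m.+1; exists z => //.
    by rewrite E comp_word_cat.
split; first by have [v [wv hv [z z01 ->]]] := tail 0%N; exact: (comp_word_big_letter hf wv hv z01).
exists (fun n => power_sum a (mkseq c n)) => // n n0.
have W := word_mkseq n c0.
apply/seteqP; split=> [s [w [ww sw wx ->]]|_ ->] /=; last first.
  by exists (mkseq c n); split; rewrite ?size_mkseq // (power_sum_potential hval).
have [v [wv hv [z z01 xE]]] := tail n.
have vz := comp_word_big_letter hf wv hv z01.
have -> : mkseq c n = w.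
  apply: (interior_coding_unique hf W ww _ vz); first by rewrite size_mkseq.
  by rewrite -xE.
by rewrite (power_sum_potential hval).
Qed.

(** [s] lists the digits of a real number and [c s] the letters they select. The separation
    hypothesis retains the digit difference at the first disagreement, which matters when [t n] is
    huge: the previous radix product alone bounds the distance of the numbers much too weakly. *)
Lemma hausdorff_dim_ge_of_code Phi (t : nat -> nat) (c : (nat -> nat) -> nat -> nat)
    (C th : R) : 0 < th -> (forall i, (2 <= t i)%N) ->
  (forall s, (forall i, (s i < t i)%N) ->
    [/\ forall i, (0 < c s i)%N, forall n, exists2 m, (n <= m)%N & (2 <= c s m)%N &
        power_sum a (mkseq (c s) n) / Phi n @[n --> \oo] --> (1 : R)]) ->
  (forall s s' n x x', (forall i, (s i < t i)%N) -> (forall i, (s' i < t i)%N) ->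
    (forall i, (i < n)%N -> s i = s' i) -> (s n < s' n)%N ->
    coded (c s) x -> coded (c s') x' ->
    (s' n - s n).+1%:R / (radix_prod t n.+1)%:R <= C * `|x - x'| `^ th) ->
  (th%:E <= hausdorff_dim (birkhoff_level_set f phi Phi))%E.
Proof.
move=> th0 t2 cP sep.
have digit_lt (y : R) i : 0 <= y -> (radix_digit t y i < t i)%N.
  by move=> y0; have [] := @radix_digitP R t t2 y i y0.
have /choice[p pP] : forall y : R, exists x, 0 <= y -> coded (c (radix_digit t y)) x.
  move=> y; have [y0|y0] := leP 0 y; last by exists 0.
  have [c0 _ _] := cP _ (fun i => digit_lt y i y0).
  by have [x] := exists_coded c0; exists x.
apply: (@hausdorff_dim_ge_of_holder_param R _ p C) => // [y /andP[y0 y1]|].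
  have [c0 c2 lim] := cP _ (fun i => digit_lt y i y0).
  exact: coded_level_set c0 c2 (pP y y0) lim.
have main (y z : R) : 0 <= y -> y < z -> z < 1 -> `|y - z| <= C * `|p y - p z| `^ th.
  move=> y0 yz z1; have z0 : 0 <= z by apply: le_trans y0 (ltW yz).
  have [n [eqd ltd le]] := radix_digit_separate t2 y0 yz z1.
  rewrite distrC gtr0_norm ?subr_gt0 //; apply: le_trans le _.
  by apply: sep => //; [move=> i; exact: digit_lt|move=> i; exact: digit_lt
    |exact: pP|exact: pP].
move=> y z /andP[y0 y1] /andP[z0 z1].
case: (ltgtP y z) => [yz|zy|->]; first exact: main.
  by rewrite distrC (distrC (p y)); exact: main.
by rewrite !subrr normr0 powR0 ?gt_eqF // mulr0.
Qed.

End CodedPoints.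

(** * Lower bounds for fast growth *)

Section AsymptoticSums.
Context {R : realType}.

(** Letters overshoot their targets by a small proportion and a bounded rounding error. For large
    [v] both fit into the factor [1 + e]; for small [v] the left-hand side is bounded. *)
Lemma powR_affine_le (a e : R) : 0 < a -> 0 < e -> exists2 eta : R, 0 < eta &
  exists2 C : R, 0 <= C &
    forall v, 0 <= v -> (v * (1 + eta) + 4) `^ a <= (1 + e) * v `^ a + C.
Proof.
move=> a0 e0; pose eta := ((1 + e) `^ a^-1 - 1) / 2.
have e1 : 0 < 1 + e by rewrite addr_gt0.
have eta0 : 0 < eta.
  have : 1 `^ a^-1 < (1 + e) `^ a^-1.
    apply: gt0_ltr_powR; rewrite ?invr_gt0 ?nnegrE ?ler01 ?(ltW e1) //.
    by rewrite ltrDl.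
  by rewrite powR1 => h; rewrite divr_gt0 // subr_gt0.
exists eta => //.
exists ((4 / eta * (1 + eta) + 4) `^ a); first exact: powR_ge0.
move=> v v0; have [h|h] := leP 4 (eta * v).
  apply: le_trans (_ : (1 + e) * v `^ a <= _); last by rewrite lerDl powR_ge0.
  have -> : 1 + e = (1 + 2 * eta) `^ a.
    have -> : 1 + 2 * eta = (1 + e) `^ a^-1 by rewrite /eta; field.
    by rewrite powRVK // ltW.
  rewrite -powRM //; last by rewrite addr_ge0 // mulr_ge0 // ltW.
  apply: ge0_ler_powR; rewrite ?nnegrE ?(ltW a0) //.
  - by rewrite addr_ge0 // mulr_ge0 // addr_ge0 // ltW.
  - by rewrite mulr_ge0 // addr_ge0 // mulr_ge0 // ltW.
  - by move: h; clear; lra.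
apply: le_trans (_ : (4 / eta * (1 + eta) + 4) `^ a <= _); last first.
  by rewrite lerDr mulr_ge0 ?powR_ge0 // ltW.
apply: ge0_ler_powR; rewrite ?nnegrE ?(ltW a0) //.
- by rewrite addr_ge0 // mulr_ge0 // addr_ge0 // ltW.
- have eta1 : 0 <= 1 + eta by rewrite addr_ge0 // ltW.
  have q0 : 0 <= 4 / eta by rewrite divr_ge0 // ltW.
  by rewrite addr_ge0 // mulr_ge0.
rewrite lerD2r ler_wpM2r ?addr_ge0 ?(ltW eta0) //.
by rewrite ler_pdivlMr // mulrC ltW.
Qed.

Lemma cvg_ratio1 (P Phi : nat -> R) : (forall n, 0 < Phi n) ->
  (forall e : R, 0 < e -> exists n0, forall n, (n0 <= n)%N ->
    (1 - e) * Phi n <= P n <= (1 + e) * Phi n) ->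
  P n / Phi n @[n --> \oo] --> (1 : R).
Proof.
move=> P0 H; apply/cvgrPdist_le => e e0; have [n0 n0P] := H e e0.
exists n0 => // n /= n0n; have /andP[l1 l2] := n0P n n0n.
by rewrite distrC ler_distl ler_pdivlMr // ler_pdivrMr // l1.
Qed.

End AsymptoticSums.

Lemma expRN_le_half (R : realType) (x : R) : 0 <= x -> x <= 1 -> expR (- x) <= 1 - x / 2.
Proof.
move=> x0 x1; rewrite expRN -div1r ler_pdivrMr ?expR_gt0 //.
apply: le_trans (_ : (1 - x / 2) * (1 + x) <= _); first by nra.
by rewrite ler_wpM2l ?expR_ge1Dx //; lra.
Qed.

(** The gap is tiled by the cylinders of the [b' - b - 1] intermediate letters, consecutive ones
    sharing an endpoint. *)
Lemma gap_between_letters (R : realType) (d : R) (f : nat -> R -> R) (m : R) b b' :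
  d_decaying_gauss_like d f -> (0 < b)%N -> (b < b')%N ->
  (forall c, (b < c < b')%N -> m <= rend f c - lend f c) ->
  (b' - b.+1)%:R * m <= lend f b' - rend f b.
Proof.
move=> hf b0 bb'; rewrite -(subnKC bb'); move: (b' - b.+1)%N => j.
rewrite addKn; elim: j => [|j IH] H.
  by rewrite mul0r addn0 (rend_lendS hf) // subrr.
have {}IH : j%:R * m <= lend f (b.+1 + j) - rend f b.
  by apply: IH => c /andP[bc cj]; apply: H; rewrite bc addnS ltnS ltnW.
have bj : (b < b.+1 + j < b.+1 + j.+1)%N.
  by rewrite addnS ltnSn andbT addSn ltnS leq_addr.
have := H _ bj; rewrite addnS (rend_lendS hf) //.
by rewrite -natr1; lra.
Qed.

Section LowerFast.
Variables (R : realType) (a c : R) (g : nat -> R).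
Hypotheses (ha : 0 < a) (hc : 0 < c) (g0 : forall n, 0 <= g n).
Hypothesis ginc : forall n, c / n.+1%:R <= g n.+1 - g n.

(** The amount the letter at position [n] should add to the power sum, so that the sums telescope to
    [expR (g n)] up to a constant. *)
Definition increment n : R := expR (g n.+1) - expR (g n).
Definition increment_root n : R := increment n `^ a^-1.
(** Just above half of the target root, because letters are doubled. *)
Definition first_digit n : nat := (Num.truncn (increment_root n / 2)).+1.
(** The window has relative width of order [1 / (n + 1)], up to rounding: small enough to keep the
    sums asymptotic to their target, yet costing only a polynomial factor in the number of choices.
    Adding 2 guarantees two digits. *)
Definition digit_count n : nat := (Num.truncn (increment_root n / n.+1%:R)).+2.
(* Even letters only: distinct choices are separated by a whole cylinder. *)
Definition fast_letter (s : nat -> nat) n : nat := 2 * (first_digit n + s n).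

Lemma g_le n : g n <= g n.+1.
Proof. by rewrite -subr_ge0 (le_trans _ (ginc n)) // divr_ge0 // ltW. Qed.

Lemma increment_ge0 n : 0 <= increment n.
Proof. by rewrite subr_ge0 ler_expR g_le. Qed.

Lemma increment_root_ge0 n : 0 <= increment_root n.
Proof. exact: powR_ge0. Qed.

Lemma increment_root_le n : increment_root n <= expR (g n.+1 / a).
Proof.
rewrite /increment_root expRM.
apply: ge0_ler_powR; rewrite ?nnegrE ?increment_ge0 ?expR_ge0 ?invr_ge0 ?(ltW ha) //.
by rewrite gerBl expR_ge0.
Qed.

(** By [1 - expR (- t) >= t / 2] on [0, 1], the hypothesis [ginc] makes the increment smaller than
    [expR (g n.+1)] by a factor of order [1 / (n + 1)] at worst. *)
Lemma increment_root_ge : exists2 k : R, 0 <= k &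
  forall n, expR (g n.+1 / a - a^-1 * ln n.+1%:R - k) <= increment_root n.
Proof.
pose c' := Num.min c 1; have c'0 : 0 < c' by rewrite lt_min hc ltr01.
have c'c : c' <= c by rewrite ge_min lexx.
have c'1 : c' <= 1 by rewrite ge_min lexx orbT.
exists (ln (2 / c') / a).
  by rewrite divr_ge0 ?(ltW ha) // ln_ge0 // ler_pdivlMr //; lra.
move=> n; have n1 : 1 <= n.+1%:R :> R by rewrite ler1n.
have n0 : 0 < n.+1%:R :> R by rewrite ltr0n.
have x1 : c' / n.+1%:R <= 1 by rewrite ler_pdivrMr // mul1r (le_trans c'1).
have low : expR (g n.+1) * (c' / n.+1%:R / 2) <= increment n.
  have -> : increment n = expR (g n.+1) * (1 - expR (- (g n.+1 - g n))).
    by rewrite /increment mulrBr mulr1 -expRD opprB addrCA subrr addr0.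
  rewrite ler_pM2l ?expR_gt0 //.
  have x0 : 0 <= c' / n.+1%:R by rewrite divr_ge0 // ltW.
  have h1 := expRN_le_half x0 x1.
  have h2 : expR (- (g n.+1 - g n)) <= expR (- (c' / n.+1%:R)).
    by rewrite ler_expR lerN2 (le_trans _ (ginc n)) // ler_wpM2r // invr_ge0.
  by rewrite lerBrDl -lerBrDr (le_trans h2).
apply: le_trans (_ : (expR (g n.+1) * (c' / n.+1%:R / 2)) `^ a^-1 <= _); last first.
  apply: ge0_ler_powR => //; rewrite ?invr_ge0 ?(ltW ha) // nnegrE.
    by rewrite mulr_ge0 ?expR_ge0 // !divr_ge0 // ltW.
  exact: increment_ge0.
have y0 : 0 < c' / n.+1%:R / 2 by rewrite !divr_gt0.
have yE : expR (ln (c' / n.+1%:R / 2)) = c' / n.+1%:R / 2 by rewrite lnK ?posrE.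
rewrite -yE -expRD -expRM ler_expR.
have -> : ln (c' / n.+1%:R / 2) = - ln (2 / c') - ln n.+1%:R.
  have -> : c' / n.+1%:R / 2 = (2 / c')^-1 / n.+1%:R by rewrite invf_div mulrAC.
  by rewrite ln_div ?posrE ?invr_gt0 ?divr_gt0 // lnV ?posrE ?divr_gt0.
by rewrite le_eqVlt; apply/orP; left; apply/eqP; ring.
Qed.

Lemma fast_letter_ge s n : increment n <= (fast_letter s n)%:R `^ a.
Proof.
have -> : increment n = increment_root n `^ a by rewrite powRVK // increment_ge0.
apply: ge0_ler_powR; rewrite ?nnegrE ?increment_root_ge0 ?(ltW ha) //.
have h := truncnS_gt (increment_root n / 2); rewrite -/(first_digit n) in h.
rewrite /fast_letter natrM natrD.
have : 0 <= (s n)%:R :> R by [].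
lra.
Qed.

Lemma fast_letter_le s n : (s n < digit_count n)%N ->
  (fast_letter s n)%:R <= increment_root n * (1 + 2 / n.+1%:R) + 4.
Proof.
move=> sn; have v0 := increment_root_ge0 n.
have n0 : 0 < n.+1%:R :> R by rewrite ltr0n.
have h1 : (Num.truncn (increment_root n / 2))%:R <= increment_root n / 2.
  by rewrite truncn_le // divr_ge0.
have h2 : (Num.truncn (increment_root n / n.+1%:R))%:R <= increment_root n / n.+1%:R.
  by rewrite truncn_le // divr_ge0.
have h3 : (s n)%:R <= (Num.truncn (increment_root n / n.+1%:R))%:R + 1 :> R.
  by rewrite natr1 ler_nat.
rewrite /fast_letter natrM natrD /first_digit -(natr1 (Num.truncn (_ / 2))).
have -> : increment_root n * (1 + 2 / n.+1%:R) =
  increment_root n + 2 * (increment_root n / n.+1%:R) by ring.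
move: h1 h2 h3; set q : R := increment_root n / n.+1%:R.
set v : R := increment_root n; set T1 : R := _%:R; set T2 : R := (Num.truncn q)%:R.
set S : R := (s n)%:R; clear; lra.
Qed.

Lemma fast_letter_le_expR s n : (s n < digit_count n)%N ->
  (fast_letter s n)%:R <= 7 * expR (g n.+1 / a).
Proof.
move=> sn; apply: (le_trans (fast_letter_le sn)).
have h := increment_root_le n; have v0 := increment_root_ge0 n.
have n0 : 0 < n.+1%:R :> R by rewrite ltr0n.
have n1 : 2 / n.+1%:R <= 2 :> R by rewrite ler_pdivrMr // ler_peMr // ler1n.
have n2 : 0 <= 2 / n.+1%:R :> R by rewrite divr_ge0.
have e1 : 1 <= expR (g n.+1 / a) by rewrite -expR0 ler_expR divr_ge0 // ltW.
move: h v0 n1 n2 e1; set v := increment_root n; set y := 2 / _; set E := expR _.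
by clear; nra.
Qed.

(** Each letter contributes at least its increment and, at late positions, at most
    [(1 + e / 2) * increment + C]. The increments telescope, and the linear error is negligible by
    the second hypothesis. *)
Lemma fast_power_sum_cvg s : (forall n, (s n < digit_count n)%N) ->
  (forall C : R, exists n0, forall n, (n0 <= n)%N -> C * n.+1%:R <= expR (g n)) ->
  power_sum a (mkseq (fast_letter s) n) / expR (g n) @[n --> \oo] --> (1 : R).
Proof.
move=> sn sub; apply: cvg_ratio1 => [n|e e0]; first exact: expR_gt0.
have psE n : power_sum a (mkseq (fast_letter s) n) =
    \sum_(i < n) (fast_letter s i)%:R `^ a.
  by rewrite /power_sum /mkseq big_map -[X in iota 0 X]subn0 -/(index_iota 0 n) big_mkord.
have incE n : \sum_(i < n) increment i = expR (g n) - expR (g 0%N).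
  by rewrite -(big_mkord xpredT increment) telescope_sumr.
have e20 : 0 < e / 2 by rewrite divr_gt0.
have [eta eta0 [C C0 HC]] := powR_affine_le ha e20.
pose i0 := Num.truncn (2 / eta).
have small i : (i0 <= i)%N -> (fast_letter s i)%:R `^ a <= (1 + e / 2) * increment i + C.
  move=> ii; have -> : increment i = increment_root i `^ a.
    by rewrite powRVK // increment_ge0.
  apply: le_trans (HC _ (increment_root_ge0 i)).
  have v0 := increment_root_ge0 i.
  have q0 : 0 <= 2 / i.+1%:R :> R by rewrite divr_ge0.
  apply: ge0_ler_powR; rewrite ?nnegrE ?(ltW ha) //.
    by rewrite addr_ge0 // mulr_ge0 // addr_ge0 // ltW.
  apply: (le_trans (fast_letter_le (sn i))); rewrite lerD2r ler_wpM2l // lerD2l.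
  rewrite ler_pdivrMr ?ltr0n // mulrC -ler_pdivrMr //.
  by apply/ltW/(lt_le_trans (truncnS_gt _)); rewrite ler_nat ltnS.
pose M := \sum_(i < i0) (fast_letter s i)%:R `^ a.
have M0 : 0 <= M by apply: sumr_ge0 => i _; exact: powR_ge0.
have up n : \sum_(i < n) (fast_letter s i)%:R `^ a <=
    (1 + e / 2) * (expR (g n) - expR (g 0%N)) + C * n%:R + M.
  elim: n => [|n IH].
    by rewrite big_ord0 subrr mulr0 mulr0 !add0r.
  have [ni|ni] := leqP i0 n.
    rewrite big_ord_recr /= -(natr1 n).
    have := small n ni; have := IH; rewrite /increment; clear; lra.
  apply: le_trans (_ : M <= _).
    rewrite /M -!(big_mkord xpredT (fun i => (fast_letter s i)%:R `^ a)).
    rewrite [leRHS](big_cat_nat (n := n.+1)) //= lerDl; apply: sumr_ge0 => i _.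
    exact: powR_ge0.
  have D0 : 0 <= expR (g n.+1) - expR (g 0%N).
    by rewrite -incE; apply: sumr_ge0 => i _; exact: increment_ge0.
  rewrite lerDr; apply: addr_ge0; last by rewrite mulr_ge0.
  by apply: mulr_ge0 => //; rewrite addr_ge0 // ltW.
have [n1 n1P] := sub (2 * (C + M) / e); have [n2 n2P] := sub (expR (g 0%N) / e).
exists (maxn n1 n2) => n; rewrite geq_max => /andP[n1n n2n].
rewrite psE; apply/andP; split.
  apply: le_trans (_ : \sum_(i < n) increment i <= _); last first.
    by apply: ler_sum => i _; exact: fast_letter_ge.
  rewrite incE; have := n2P n n2n.
  have h : expR (g 0%N) / e <= expR (g 0%N) / e * n.+1%:R.
    by rewrite ler_peMr ?ler1n // divr_ge0 ?expR_ge0 // ltW.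
  by move=> /(le_trans h); rewrite ler_pdivrMr //; lra.
apply: (le_trans (up n)); have := n1P n n1n.
rewrite mulrAC ler_pdivrMr // -(natr1 n).
have := expR_ge0 (g 0%N); have n0 : 0 <= n%:R :> R by [].
move: C0 M0 n0 e0; set E := expR (g n); set E0 := expR (g 0%N); set y : R := n%:R.
by clear; nra.
Qed.

End LowerFast.

(** The last hypothesis is [a] times the logarithm of the separation estimate. The first [n] letters
    enter with [1 - th * (d + delta)]: number of choices against length to the power [th]. At the
    branching letter the range of digits, of size about [exp (g n.+1 / a)], regains one unit of the
    exponent [d + delta]. The left-hand side collects the polynomial loss of every letter. *)
Lemma hausdorff_dim_ge_fast (R : realType) (d : R) (f : nat -> R -> R) (a : R)
    (phi : R -> R) (g : nat -> R) (c th delta : R) :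
  d_decaying_gauss_like d f ->
  (forall j : nat, (0 < j)%N -> potential_value f phi j = j%:R `^ a) ->
  1 < d -> 0 < a -> 0 < c -> 0 < th -> th < 1 -> 0 < delta -> (forall n, 0 <= g n) ->
  (forall n, c / n.+1%:R <= g n.+1 - g n) ->
  (forall C : R, exists n0, forall n, (n0 <= n)%N -> C * n.+1%:R <= expR (g n)) ->
  (forall B : R, exists C, forall n, B * (n.+1%:R * (1 + ln n.+1%:R)) <=
    (1 - th * (d + delta)) * (\sum_(i < n) g i.+1) - th * (d + delta - 1) * g n.+1 + C) ->
  (th%:E <= hausdorff_dim (birkhoff_level_set f phi (fun n => expR (g n))))%E.
Proof.
move=> hf hval hd ha hc th0 th1 delta0 g0 ginc sub main.
have [K1 [K2 [K10 K20 H]]] := map_bounds hf delta0.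
set p := d + delta in main H.
have p0 : 0 < p by rewrite addr_gt0 // (lt_trans ltr01).
have [k k0 kP] := increment_root_ge ha hc ginc.
pose E i := expR (g i.+1 / a).
have E0 i : 0 < E i by exact: expR_gt0.
(* [lq] and, further down, [lt] are logarithms of lower bounds: for the contraction by a permitted
   letter at position [i], which is at most [7 * E i], and for the number of choices there. *)
pose lK := ln (K1 / 7 `^ p).
pose lq i := lK - p * (g i.+1 / a).
have K7 : 0 < K1 / 7 `^ p by rewrite divr_gt0 // powR_gt0.
have qE i : expR (lq i) = K1 / (7 * E i) `^ p.
  rewrite powRM ?(ltW (E0 i)) // invfM mulrA /lq expRD lnK ?posrE //.
  by congr (_ * _); rewrite /E expRN -expRM [p * _]mulrC.
pose lt i := g i.+1 / a - (1 + a^-1) * ln i.+1%:R - k.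
have tP i : expR (lt i) <= (digit_count a g i)%:R.
  have -> : lt i = g i.+1 / a - a^-1 * ln i.+1%:R - k - ln i.+1%:R by rewrite /lt; ring.
  have i0 : 0 < i.+1%:R :> R by rewrite ltr0n.
  rewrite expRB lnK ?posrE //.
  apply: le_trans (_ : increment_root a g i / i.+1%:R <= _).
    by rewrite ler_wpM2r ?invr_ge0.
  apply/ltW/(lt_le_trans (truncnS_gt _)); rewrite ler_nat.
  by rewrite /digit_count leqW.
pose B := a * ((1 + a^-1) + k + `|lK|).
have [C' C'P] := main B.
apply: (@hausdorff_dim_ge_of_code R d f a phi hf hval _ (digit_count a g)
   (fast_letter a g) (2 * expR (C' / a))) => //.
  move=> s sn; split.
  - by move=> i; rewrite /fast_letter muln_gt0 addn_gt0.
  - move=> n; exists n => //; rewrite /fast_letter /first_digit.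
    by move: (Num.truncn _) (s n); clear; lia.
  - exact: (fast_power_sum_cvg ha hc ginc sn sub).
move=> s s' n x x' sn s'n ss' sns' cx cx'.
set b := fast_letter a g s n; set b' := fast_letter a g s' n.
pose m := (s' n - s n)%N.
have m0 : (0 < m)%N by rewrite subn_gt0.
have b0 : (0 < b)%N by rewrite /b /fast_letter muln_gt0 addn_gt0.
have bb'E : b' = (b + 2 * m)%N.
  by rewrite /b' /b /fast_letter -mulnDr -addnA subnKC // ltnW.
have bb' : (b < b')%N by rewrite bb'E -[X in (X < _)%N]addn0 ltn_add2l muln_gt0 m0.
have letterle s1 i : (s1 i < digit_count a g i)%N ->
   (fast_letter a g s1 i)%:R <= 7 * E i by exact: (fast_letter_le_expR ha hc g0 ginc).
have i0 : 0 <= (0 : R) <= 1 by rewrite lexx ler01.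
have i1 : 0 <= (1 : R) <= 1 by rewrite lexx ler01.
have lowle y i : (0 < y)%N -> y%:R <= 7 * E i -> expR (lq i) <= K1 / y%:R `^ p.
  move=> y0 yE; rewrite qE ler_pM2l // lef_pV2 ?posrE ?powR_gt0 ?mulr_gt0 ?ltr0n //.
  by apply: ge0_ler_powR; rewrite ?nnegrE ?(ltW p0) // mulr_ge0 // ltW.
have w0 s1 i : (0 < fast_letter a g s1 i)%N.
  by rewrite /fast_letter muln_gt0 addn_gt0.
have W : word (mkseq (fast_letter a g s) n) by exact: word_mkseq.
have Weq : mkseq (fast_letter a g s') n = mkseq (fast_letter a g s) n.
  apply/eq_in_map => i; rewrite mem_iota add0n => /andP[_ /ss' si].
  by rewrite /fast_letter si.
have [z z01 xE] : exists2 z, 0 <= z <= 1 &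
    x = comp_word f (mkseq (fast_letter a g s) n) (f b z).
  have /basic_intervalP[z z01 <-] := cx n.+1; exists z => //.
  by rewrite mkseqS -cats1 comp_word_cat.
have [z' z'01 x'E] : exists2 z, 0 <= z <= 1 &
    x' = comp_word f (mkseq (fast_letter a g s) n) (f b' z).
  have /basic_intervalP[z' z'01 <-] := cx' n.+1; exists z' => //.
  by rewrite mkseqS -cats1 comp_word_cat Weq.
have b'0 : (0 < b')%N by apply: leq_trans bb'.
(* Letters are even, so [2 * m - 1 >= m] whole cylinders lie between [b] and [b']. *)
have gapP : m%:R * expR (lq n) <= `|f b z - f b' z'|.
  have /andP[_ h1] := map_between hf b0 z01.
  have /andP[h2 _] := map_between hf b'0 z'01.
  have h3 : (b' - b.+1)%:R * expR (lq n) <= lend f b' - rend f b.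
    apply: (gap_between_letters hf b0 bb') => y /andP[y1 y2].
    have y0 : (0 < y)%N by apply: leq_trans y1.
    rewrite rend_sub_lend //.
    have /andP[h _] := H y 1 0 y0 i1 i0; apply: le_trans h.
    rewrite subr0 normr1 mulr1; apply: lowle => //.
    by apply: le_trans (letterle s' n (s'n n)); rewrite ler_nat ltnW.
  have h4 : m%:R <= (b' - b.+1)%:R :> R.
    by rewrite ler_nat bb'E; clear -m0; lia.
  have h5 : m%:R * expR (lq n) <= (b' - b.+1)%:R * expR (lq n).
    by rewrite ler_wpM2r ?expR_ge0.
  rewrite distrC; apply: le_trans (ler_norm _).
  by rewrite (le_trans h5) // (le_trans h3) // lerB.
have dist : m%:R * expR (\sum_(i < n.+1) lq i) <= `|x - x'|.
  have z1 := map01 hf b0 z01; have z'1 := map01 hf b'0 z'01.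
  have /andP[h _] := comp_word_bounds hf (fun i _ => divr_ge0 (ltW K10) (powR_ge0 _ _))
    (fun i _ => divr_ge0 (ltW K20) (powR_ge0 _ _)) H W z1 z'1.
  rewrite xE x'E; apply: le_trans h.
  rewrite big_ord_recr /= expRD mulrCA; apply: ler_pM; rewrite ?expR_ge0 //.
  rewrite /mkseq big_map -[X in iota 0 X]subn0 -/(index_iota 0 n) big_mkord expR_sum.
  apply: ler_prod => i _; rewrite expR_ge0 /=; apply: lowle => //.
  exact: letterle.
have mR : 0 < m%:R :> R by rewrite ltr0n.
have mt : (m <= digit_count a g n)%N.
  by rewrite (leq_trans (leq_subr _ _)) // ltnW.
have t0 : 0 < (digit_count a g n)%:R :> R by rewrite ltr0n.
apply: le_trans (_ : 2 * expR (C' / a) *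
    (m%:R `^ th * expR (\sum_(i < n.+1) lq i) `^ th) <= _); last first.
  rewrite ler_pM2l ?mulr_gt0 ?expR_gt0 // -powRM ?expR_ge0 //.
  apply: ge0_ler_powR; rewrite ?nnegrE ?(ltW th0) // mulr_ge0 ?expR_ge0 //.
have P0 : 0 < (radix_prod (digit_count a g) n)%:R :> R.
  by rewrite ltr0n /radix_prod; elim/big_ind : _ => // y y' y0 y'0; rewrite muln_gt0 y0.
have PT : expR (\sum_(i < n) lt i) <= (radix_prod (digit_count a g) n)%:R.
  rewrite expR_sum /radix_prod natr_prod; apply: ler_prod => i _.
  by rewrite expR_ge0 tP.
rewrite radix_prodS natrM invfM.
set T : R := (radix_prod _ n)%:R in P0 PT *.
set t : R := (digit_count a g n)%:R in t0 *.
have tl : expR (lt n) <= t by exact: tP.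
apply: le_trans (_ : 2 * m%:R `^ th * (expR (- (th * lt n)) * expR (- \sum_(i < n) lt i)) <= _).
  have h1 : m.+1%:R <= 2 * m%:R :> R by rewrite -natrM ler_nat; clear -m0; lia.
  (* Interpolation through [m <= t]: the factor [m ^ th] it produces cancels against the one from
     the distance. *)
  have h2 : m%:R <= m%:R `^ th * t `^ (1 - th).
    rewrite -[leLHS](powRr1 (ltW mR)) -[X in _ `^ X](subrKC th 1).
    rewrite powRD; last by rewrite (gt_eqF mR) implybT.
    rewrite ler_pM2l ?powR_gt0 //; apply: ge0_ler_powR; rewrite ?nnegrE ?(ltW t0) //.
      by rewrite subr_ge0 ltW.
    by rewrite ler_nat.
  have h3 : t `^ (1 - th) / t <= expR (- (th * lt n)).
    have -> : t `^ (1 - th) / t = (t `^ th)^-1.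
      rewrite -[X in _ / X](powRr1 (ltW t0)) -powRN -powRD; last first.
        by rewrite (gt_eqF t0) implybT.
      by rewrite -powRN; congr (_ `^ _); ring.
    rewrite mulrC expRN expRM lef_pV2 ?posrE ?powR_gt0 ?expR_gt0 //.
    by apply: ge0_ler_powR; rewrite ?nnegrE ?expR_ge0 ?(ltW th0) ?(ltW t0).
  have h4 : T^-1 <= expR (- \sum_(i < n) lt i).
    by rewrite expRN lef_pV2 ?posrE ?expR_gt0.
  apply: le_trans (_ : 2 * (m%:R `^ th * t `^ (1 - th)) * (T^-1 * t^-1) <= _).
    rewrite ler_wpM2r ?mulr_ge0 ?invr_ge0 ?(ltW t0) ?(ltW P0) //.
    by apply: le_trans h1 _; rewrite ler_pM2l.
  have -> : 2 * (m%:R `^ th * t `^ (1 - th)) * (T^-1 * t^-1) =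
    2 * m%:R `^ th * (t `^ (1 - th) / t * T^-1) by ring.
  rewrite ler_pM2l ?mulr_gt0 ?powR_gt0 //; apply: ler_pM => //.
    by rewrite divr_ge0 ?powR_ge0 // ltW.
  by rewrite invr_ge0 ltW.
rewrite -!mulrA ler_pM2l // [leRHS]mulrCA ler_pM2l ?powR_gt0 //.
rewrite -expRM -!expRD ler_expR.
pose G := \sum_(i < n) g i.+1.
have n0 : 0 <= n%:R :> R by [].
have ln0' : 0 <= ln n.+1%:R :> R by rewrite ln_ge0 // ler1n.
have sumlq : \sum_(i < n.+1) lq i = n.+1%:R * lK - p / a * (G + g n.+1).
  rewrite /lq sumrB sumr_const card_ord -[lK *+ _]mulr_natl; congr (_ - _).
  rewrite -mulr_sumr -mulr_suml big_ord_recr /= -/G; ring.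
have sumlt : G / a - (1 + a^-1) * (n%:R * ln n.+1%:R) - n%:R * k <= \sum_(i < n) lt i.
  rewrite /lt !sumrB -mulr_suml -/G -mulr_sumr sumr_const card_ord -(mulr_natl k n).
  rewrite lerB // lerB // ler_wpM2l ?addr_ge0 ?invr_ge0 ?(ltW ha) //.
  apply: le_trans (_ : \sum_(i < n) ln n.+1%:R <= _); last first.
    by rewrite sumr_const card_ord mulr_natl.
  by apply: ler_sum => i _; rewrite ler_ln ?posrE ?ltr0n // ler_nat ltnS ltnW.
have := C'P n; rewrite -/G /B sumlq /lt -(natr1 n).
have a'0 : 0 < a^-1 by rewrite invr_gt0.
have nl0 : 0 <= n%:R * ln (n%:R + 1) :> R by rewrite mulr_ge0 // natr1.
move: sumlt; rewrite -(natr1 n).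
have nK := ler_norm (- lK); rewrite normrN in nK.
have nK0 : 0 <= `|lK| by [].
move=> sumlt CP.
have {}CP : ((1 + a^-1) + k + `|lK|) * ((n%:R + 1) * (1 + ln (n%:R + 1))) <=
  ((1 - th * p) * G - th * (p - 1) * g n.+1 + C') / a.
  by rewrite ler_pdivlMr // mulrC mulrA.
move: ln0' nl0 sumlt CP; rewrite -(natr1 n).
set S := \sum_(_ < _) _; set l := ln _; set y : R := n%:R; set gn := g _.
set K := `|lK| in nK nK0 *; set a' := a^-1 in a'0 *.
move=> l0 yl0 sumlt CP.
have h5 : th * ((1 + a') * l + k - (y + 1) * lK) <= (1 + a') * l + k + (y + 1) * K.
  have u0 : 0 <= (1 + a') * l + k + (y + 1) * K.
    by rewrite !addr_ge0 // mulr_ge0 // addr_ge0 // ltW.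
  have u1 : (1 + a') * l + k - (y + 1) * lK <= (1 + a') * l + k + (y + 1) * K.
    by rewrite lerD2l -mulrN ler_wpM2l // addr_ge0.
  apply: le_trans (_ : th * ((1 + a') * l + k + (y + 1) * K) <= _).
    by rewrite ler_pM2l.
  by rewrite ler_piMl // ltW.
have h6 : (1 + a') * (y * l) + y * k + ((1 + a') * l + k + (y + 1) * K) <=
   ((1 + a') + k + K) * ((y + 1) * (1 + l)).
  have q1 : 0 <= (1 + a') * (y + 1) by rewrite mulr_ge0 // addr_ge0 // ltW.
  have q2 : 0 <= (k + K) * ((y + 1) * l) by rewrite !mulr_ge0 ?addr_ge0.
  by rewrite -subr_ge0; apply: le_trans (addr_ge0 q1 q2) _;
    rewrite le_eqVlt; apply/orP; left; apply/eqP; ring.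
have {}CP := le_trans h6 CP.
move: h5 sumlt CP; clear; lra.
Qed.

(** * The two fast growth rates *)

Lemma bounded_above_of_eventually (R : numDomainType) (F : nat -> R) (n0 : nat) :
  (forall n, F n \is Num.real) ->
  (forall n, (n0 <= n)%N -> F n <= 0) -> exists C : R, forall n, F n <= C.
Proof.
move=> Fr H; exists (\sum_(i < n0) `|F i|) => n.
have S0 : 0 <= \sum_(i < n0) `|F i| by apply: sumr_ge0.
have [n0n|nn0] := leqP n0 n; first exact: le_trans (H n n0n) S0.
rewrite (bigD1 (Ordinal nn0)) //=; apply: le_trans (real_ler_norm (Fr n)) _.
by rewrite lerDl sumr_ge0.
Qed.

Lemma ln_le_powR (R : realType) (r x : R) : 0 < r -> 0 < x -> ln x <= r^-1 * x `^ r.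
Proof.
move=> r0 x0; rewrite ler_pdivlMl // -ln_powR ltW // ln_sublinear //.
exact: powR_gt0.
Qed.

Section SubexponentialLower.
Context {R : realType}.
Implicit Types (alpha : R).

Lemma powR_increment alpha : 0 < alpha -> exists2 c : R, 0 < c &
  forall n : nat, c / n.+1%:R <= n.+1%:R `^ alpha - n%:R `^ alpha.
Proof.
move=> al0; pose c := Num.min alpha 1.
have c0 : 0 < c by rewrite lt_min al0 ltr01.
have ca : c <= alpha by rewrite ge_min lexx.
have c1 : c <= 1 by rewrite ge_min lexx orbT.
exists (c / 2); first by rewrite divr_gt0.
move=> n; have N0 : 0 < n.+1%:R :> R by rewrite ltr0n.
have N1 : 1 <= n.+1%:R :> R by rewrite ler1n.
have x0 : 0 <= c / n.+1%:R by rewrite divr_ge0 // ltW.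
have x1 : c / n.+1%:R <= 1 by rewrite ler_pdivrMr // mul1r (le_trans c1).
have h : n%:R `^ alpha <= n.+1%:R `^ alpha * expR (- (c / n.+1%:R)).
  have [->|n0] := posnP n; first by rewrite powR0 ?gt_eqF // mulr_ge0 ?powR_ge0 ?expR_ge0.
  have n0' : 0 < n%:R :> R by rewrite ltr0n.
  have -> : n%:R = n.+1%:R * (1 + - n.+1%:R^-1) :> R.
    by rewrite mulrDr mulrN mulfV ?gt_eqF // mulr1 -(natr1 n) addrK.
  have y0 : 0 < 1 + - n.+1%:R^-1 :> R.
    by rewrite subr_gt0 invf_lt1 // ltr1n.
  rewrite powRM ?(ltW y0) // ler_pM2l ?powR_gt0 //.
  rewrite /powR gt_eqF // ler_expR.
  have l : ln (1 + - n.+1%:R^-1) <= - n.+1%:R^-1 :> R.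
    by apply: le_ln1Dx; rewrite ltrN2 invf_lt1 // ltr1n.
  apply: le_trans (_ : alpha * - n.+1%:R^-1 <= _); first by rewrite ler_pM2l.
  by rewrite mulrN lerN2 ler_wpM2r // invr_ge0 ltW.
have e := expRN_le_half x0 x1.
have P1 : 1 <= n.+1%:R `^ alpha :> R.
  by rewrite -[leLHS](powRr0 n.+1%:R) ler_powR // ltW.
have q0 : 0 <= c / n.+1%:R / 2 by rewrite divr_ge0.
have -> : c / 2 / n.+1%:R = c / n.+1%:R / 2 by rewrite mulrAC.
move: h e P1 q0; set N := n.+1%:R `^ _; set M := n%:R `^ _.
set X := expR _; set y := _ / _ / 2; clear; nra.
Qed.

Lemma powR_sublinear_exp alpha (C : R) : 0 < alpha ->
  exists n0, forall n, (n0 <= n)%N -> C * n.+1%:R <= expR (n%:R `^ alpha).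
Proof.
move=> al0; have b0 : 0 < alpha / 2 by rewrite divr_gt0.
pose L := ln (`|C| + 1).
have [n0 n0P] := powR_unbounded (`|L| + 1 + (alpha / 2)^-1 + 1) b0.
exists n0.+1 => n n0n; have n1 : (0 < n)%N by apply: leq_trans n0n.
have nR : 0 < n%:R :> R by rewrite ltr0n.
apply: le_trans (_ : (`|C| + 1) * (expR 1 * n%:R) <= _).
  apply: le_trans (_ : (`|C| + 1) * n.+1%:R <= _).
    by rewrite ler_wpM2r // ler_wpDr // ler_norm.
  rewrite ler_wpM2l ?addr_ge0 //.
  apply: le_trans (_ : 2 * n%:R <= _); last first.
    by rewrite ler_wpM2r //; apply: le_trans (expR_ge1Dx 1); rewrite lerD2l.
  by rewrite -natr1 mulr_natl mulr2n lerD2l ler1n.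
have C1 : 0 < `|C| + 1 by rewrite ltr_wpDl.
rewrite -[leLHS](lnK (x := _)) ?posrE ?mulr_gt0 ?expR_gt0 // ler_expR.
rewrite !lnM ?posrE ?mulr_gt0 ?expR_gt0 // expRK -/L.
have h := n0P n (ltnW n0n); have l := ln_le_powR b0 nR.
have -> : n%:R `^ alpha = n%:R `^ (alpha / 2) * n%:R `^ (alpha / 2).
  by rewrite -powRD; [congr (_ `^ _); field|rewrite (gt_eqF nR) implybT].
have nL := ler_norm L; have L0 : 0 <= `|L| by [].
have i0 : 0 < (alpha / 2)^-1 by rewrite invr_gt0.
move: h l nL L0 i0; set y := n%:R `^ _; set z := `|L|; set i := _^-1; set w := ln _.
clear; nra.
Qed.

Lemma sum_powR_ge alpha n : 0 < alpha ->
  (n%:R / 2) * (n%:R / 2) `^ alpha <= \sum_(i < n) (i.+1%:R : R) `^ alpha.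
Proof.
move=> al0; rewrite -(big_mkord xpredT (fun i => (i.+1%:R : R) `^ alpha)).
have n2 : (n./2 <= n)%N by rewrite -divn2 leq_div.
rewrite (big_cat_nat (n := n./2)) //=.
apply: le_trans (_ : \sum_(n./2 <= i < n) (i.+1%:R : R) `^ alpha <= _); last first.
  by rewrite lerDr sumr_ge0 // => i _; exact: powR_ge0.
apply: le_trans (_ : \sum_(n./2 <= i < n) (n%:R / 2) `^ alpha <= _); last first.
  rewrite big_nat_cond [leRHS]big_nat_cond; apply: ler_sum => i /andP[/andP[ni _] _].
  apply: ge0_ler_powR; rewrite ?nnegrE ?(ltW al0) ?divr_ge0 //.
  rewrite ler_pdivrMr // -natrM ler_nat; lia.
rewrite sumr_const_nat -[_ *+ (n - _)]mulr_natl ler_wpM2r ?powR_ge0 //.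
rewrite ler_pdivrMr // -natrM ler_nat; lia.
Qed.

(** The sum is at least of order [n ^ (1 + alpha)], which dominates [n * ln n] and [n ^ alpha] for
    every positive [kappa]. The finitely many remaining [n] go into [C]. *)
Lemma subexp_balance alpha (kappa lam B : R) : 0 < alpha -> 0 < kappa ->
  exists C : R, forall n : nat, B * (n.+1%:R * (1 + ln n.+1%:R)) <=
    kappa * (\sum_(i < n) i.+1%:R `^ alpha) - lam * n.+1%:R `^ alpha + C.
Proof.
move=> al0 k0; have b0 : 0 < alpha / 2 by rewrite divr_gt0.
pose q : R := 4^-1 * 4^-1 `^ alpha; have q0 : 0 < q by rewrite mulr_gt0 ?powR_gt0.
pose i := (alpha / 2)^-1; have i0 : 0 < i by rewrite invr_gt0.
pose T := 2 * `|B| * (1 + i) / (kappa * q) + 1.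
have [n0 n0P] := powR_unbounded T b0.
pose m := Num.truncn (2 * `|lam| / (kappa * q)).
have kq : 0 < kappa * q by rewrite mulr_gt0.
suff [C CP] : exists C, forall n : nat, B * (n.+1%:R * (1 + ln n.+1%:R)) -
    (kappa * (\sum_(i < n) i.+1%:R `^ alpha) - lam * n.+1%:R `^ alpha) <= C.
  by exists C => n; rewrite -lerBlDl.
apply: (@bounded_above_of_eventually _ _ (maxn 1 (maxn n0 m))).
  by move=> n; exact: num_real.
move=> n; rewrite !geq_max => /and3P[n1 n0n mn]; rewrite subr_le0.
set x : R := n.+1%:R; have x0 : 0 < x by rewrite ltr0n.
have S : q * (x * x `^ alpha) <= \sum_(i < n) i.+1%:R `^ alpha.
  apply: le_trans (sum_powR_ge n al0).
  have h : 4^-1 * x <= n%:R / 2.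
    rewrite /x -(natr1 n); have : 1 <= n%:R :> R by rewrite ler1n.
    by move: (n%:R : R); clear; move=> y; lra.
  have -> : q * (x * x `^ alpha) = (4^-1 * x) * (4^-1 * x) `^ alpha.
    by rewrite powRM ?(ltW x0) //; rewrite /q; ring.
  have h0 : 0 <= 4^-1 * x by rewrite mulr_ge0 // ltW.
  apply: ler_pM; rewrite ?powR_ge0 //.
  apply: ge0_ler_powR; rewrite ?nnegrE ?(ltW al0) //.
have h := n0P n.+1 (leqW n0n); have l := ln_le_powR b0 x0.
rewrite -/x -/i in h l.
have mx : 2 * `|lam| / (kappa * q) <= x.
  by apply/ltW/(lt_le_trans (truncnS_gt _)); rewrite ler_nat ltnS.
rewrite ler_pdivrMr // in mx.
have xE : x `^ alpha = x `^ (alpha / 2) * x `^ (alpha / 2).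
  by rewrite -powRD; [congr (_ `^ _); field|rewrite (gt_eqF x0) implybT].
rewrite xE in S *.
set y := x `^ (alpha / 2) in h l S *.
have h' : 2 * `|B| * (1 + i) <= (y - 1) * (kappa * q).
  by rewrite -ler_pdivrMr //; move: h; rewrite /T; lra.
have T1 : 1 <= T.
  by rewrite lerDr divr_ge0 ?(ltW kq) // !mulr_ge0 // addr_ge0 // ltW.
have y1 : 1 <= y by apply: le_trans h.
apply: le_trans (_ : kappa * (q * (x * (y * y))) - lam * (y * y) <= _); last first.
  by rewrite lerD2r ler_pM2l.
have a1 : B * (x * (1 + ln x)) <= x * (`|B| * (1 + i) * y).
  rewrite mulrCA ler_pM2l //.
  have x1 : 0 <= ln x by rewrite ln_ge0 // ler1n.
  apply: le_trans (_ : `|B| * (1 + ln x) <= _).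
    by rewrite ler_wpM2r ?ler_norm // addr_ge0.
  rewrite -mulrA ler_wpM2l //; move: l y1 i0; clear; nra.
have a2 : x * (`|B| * (1 + i) * y) <= x * (y * y) * (kappa * q) / 2.
  have -> : x * (y * y) * (kappa * q) / 2 = x * (y * (kappa * q) / 2 * y) by ring.
  have y0 : 0 < y by apply: lt_le_trans y1.
  rewrite ler_pM2l // ler_pM2r //; move: h' kq; clear; lra.
have a3 : lam * (y * y) <= x * (y * y) * (kappa * q) / 2.
  have yy : 0 <= y * y by rewrite mulr_ge0 // (le_trans ler01).
  apply: le_trans (_ : `|lam| * (y * y) <= _); first by rewrite ler_wpM2r ?ler_norm.
  have -> : x * (y * y) * (kappa * q) / 2 = (x * (kappa * q) / 2) * (y * y) by ring.
  by rewrite ler_wpM2r //; move: mx; clear; lra.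
have := le_trans a1 a2; move: a3; clear; lra.
Qed.

End SubexponentialLower.

Lemma hausdorff_dim_subexp_lower (R : realType) (d : R) (f : nat -> R -> R) (a : R)
    (phi : R -> R) (alpha th : R) :
  d_decaying_gauss_like d f ->
  (forall j : nat, (0 < j)%N -> potential_value f phi j = j%:R `^ a) ->
  1 < d -> 0 < a -> 0 < alpha -> 0 < th -> th < d^-1 ->
  (th%:E <= hausdorff_dim (birkhoff_level_set f phi
    (fun n => expR (n%:R `^ alpha))))%E.
Proof.
move=> hf hval hd ha al0 th0 thd; have d0 : 0 < d by apply: lt_trans hd.
have thd1 : th * d < 1 by rewrite -ltr_pdivlMr // div1r.
have th1 : th < 1 by apply: lt_trans thd _; rewrite invf_lt1.
(* This makes [th * (d + delta)] the mean of [th * d] and 1, hence less than 1. *)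
pose delta := (th^-1 - d) / 2.
have delta0 : 0 < delta.
  by rewrite divr_gt0 // subr_gt0 -[ltLHS]invrK ltf_pV2 ?posrE ?invr_gt0.
have [c c0 cP] := powR_increment al0.
apply: (@hausdorff_dim_ge_fast R d f a phi (fun n => n%:R `^ alpha) c th delta) => //.
- by move=> C; exact: powR_sublinear_exp.
move=> B; apply: subexp_balance => //.
have -> : th * (d + delta) = (1 + th * d) / 2.
  rewrite /delta; field; exact: lt0r_neq0.
move: thd1; clear; lra.
Qed.

Lemma hausdorff_dim_superexp_lower (R : realType) (d : R) (f : nat -> R -> R) (a : R)
    (phi : R -> R) (beta th : R) :
  d_decaying_gauss_like d f ->
  (forall j : nat, (0 < j)%N -> potential_value f phi j = j%:R `^ a) ->
  1 < d -> 0 < a -> 1 < beta -> 0 < th -> th < (d * beta - beta + 1)^-1 ->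
  (th%:E <= hausdorff_dim (birkhoff_level_set f phi
    (fun n => expR (beta ^+ n))))%E.
Proof.
move=> hf hval hd ha beta1 th0 thd.
have beta0 : 0 < beta by apply: lt_trans beta1.
have b10 : 0 < beta - 1 by rewrite subr_gt0.
pose den := d * beta - beta + 1; rewrite -/den in thd.
have den1 : 1 < den.
  have -> : den = (d - 1) * beta + 1 by rewrite /den; ring.
  by rewrite ltrDr mulr_gt0 // subr_gt0.
have den0 : 0 < den by apply: lt_trans den1.
have thd1 : th * den < 1 by rewrite -ltr_pdivlMr // div1r.
have th1 : th < 1 by apply: lt_trans thd _; rewrite invf_lt1.
(* With [p = d + delta], this makes [th * (p * beta - beta + 1)] the mean of [th * den] and 1. *)
pose delta := (th^-1 - den) / (2 * beta).
have delta0 : 0 < delta.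
  rewrite divr_gt0 ?mulr_gt0 // subr_gt0 -[ltLHS]invrK ltf_pV2 ?posrE ?invr_gt0 //.
apply: (@hausdorff_dim_ge_fast R d f a phi (fun n => beta ^+ n) (beta - 1) th delta) => //.
- by move=> n; rewrite exprn_ge0 // ltW.
- move=> n; have h : 1 <= beta ^+ n by rewrite exprn_ege1 // ltW.
  have -> : beta ^+ n.+1 - beta ^+ n = (beta - 1) * beta ^+ n by rewrite exprS; ring.
  by rewrite ler_pM2l // (le_trans _ h) // invf_le1 ?ltr0n // ler1n.
- move=> C; have [n0 n0P] := expr_superlinear (2 * `|C|) beta1.
  exists n0.+1 => n n0n; have n1 : 1 <= n%:R :> R by rewrite ler1n (leq_trans _ n0n).
  have h := n0P n (ltnW n0n).
  apply: le_trans (_ : beta ^+ n <= _); last first.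
    by apply: le_trans (expR_ge1Dx _); rewrite lerDr.
  apply: le_trans h; apply: le_trans (_ : `|C| * n.+1%:R <= _).
    by rewrite ler_wpM2r ?ler_norm.
  rewrite -mulrA mulrCA ler_wpM2l // -(natr1 n); move: n1; clear; lra.
move=> B; set p := d + delta.
(* The coefficient of [beta ^ n.+1] in the balance once the geometric sum is evaluated. *)
pose kappa := (1 - th * (p * beta - beta + 1)) / (beta - 1).
have kappa0 : 0 < kappa.
  rewrite divr_gt0 // subr_gt0.
  have -> : th * (p * beta - beta + 1) = (1 + th * den) / 2.
    rewrite /p /delta /den; field; apply/andP; split; exact: lt0r_neq0.
  by move: thd1; clear; lra.
(* As [1 + ln x <= x], the losses are at most quadratic; a linear bound for the powers of
   [sqrt beta], once squared, absorbs them. *)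
have g1 : 1 < Num.sqrt beta by rewrite -sqrtr1 ltr_sqrt.
have [n0 n0P] := expr_superlinear (Num.sqrt (`|B| / kappa)) g1.
pose C0 := (1 - th * p) * (beta / (beta - 1)).
suff [C CP] : exists C, forall n : nat, B * (n.+1%:R * (1 + ln n.+1%:R)) -
    kappa * beta ^+ n.+1 <= C.
  exists (C + C0) => n; have := CP n.
  have -> : \sum_(i < n) beta ^+ i.+1 = (beta ^+ n.+1 - beta) / (beta - 1).
    elim: n {CP} => [|n IH]; first by rewrite big_ord0 expr1 subrr mul0r.
    rewrite big_ord_recr /= IH [beta ^+ n.+2]exprS; field; exact: lt0r_neq0.
  have -> : (1 - th * p) * ((beta ^+ n.+1 - beta) / (beta - 1)) -
      th * (p - 1) * beta ^+ n.+1 + (C + C0) = kappa * beta ^+ n.+1 + C.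
    rewrite /kappa /C0; field; exact: lt0r_neq0.
  by rewrite lerBlDl.
apply: (@bounded_above_of_eventually _ _ n0); first by move=> n; exact: num_real.
move=> n n0n; rewrite subr_le0; have h := n0P n.+1 (leqW n0n).
set x : R := n.+1%:R in h *; have x0 : 0 < x by rewrite ltr0n.
have lx : 1 + ln x <= x.
  have := @le_ln1Dx R (x - 1); have -> : 1 + (x - 1) = x by ring.
  have h1 : -1 < x - 1 by move: x0; clear; lra.
  by move=> /(_ h1); clear; lra.
apply: le_trans (_ : `|B| * (x * x) <= _).
  have l0 : 0 <= ln x by rewrite ln_ge0 // ler1n.
  apply: le_trans (_ : `|B| * (x * (1 + ln x)) <= _).
    by rewrite ler_wpM2r ?ler_norm // mulr_ge0 ?addr_ge0 // ltW.
  by rewrite ler_wpM2l // ler_pM2l.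
have Bk : 0 <= `|B| / kappa by rewrite divr_ge0 // ltW.
have sq : (Num.sqrt (`|B| / kappa) * x) ^+ 2 <= (Num.sqrt beta ^+ n.+1) ^+ 2.
  have s1 : 0 <= Num.sqrt (`|B| / kappa) * x by rewrite mulr_ge0 ?sqrtr_ge0 // ltW.
  have s2 : 0 <= Num.sqrt beta ^+ n.+1 by rewrite exprn_ge0 // sqrtr_ge0.
  by apply: lerXn2r; rewrite ?nnegrE.
move: sq; rewrite exprMn sqr_sqrtr // -exprM mulnC exprM sqr_sqrtr ?(ltW beta0) //.
by rewrite mulrAC ler_pdivrMr // expr2 => /le_trans; apply; rewrite mulrC.
Qed.

(** * Lower bound under bounded distortion *)

Section BoundedDistortion.
Context {R : realType} (d : R) (f : nat -> R -> R).
Hypothesis hf : d_decaying_gauss_like d f.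
Implicit Types (w v : seq nat).
Local Notation len := (interval_length f).

Lemma interval_length_gt0 w : word w -> 0 < len w.
Proof.
move=> ww; rewrite (interval_lengthE hf) // normr_gt0 subr_eq0.
apply/eqP => /(comp_word_inj hf ww) h.
have : (1 : R) = 0 by apply: h; rewrite lexx ler01.
by apply/eqP; rewrite oner_eq0.
Qed.

Lemma interval_length_nil : len [::] = 1.
Proof. by rewrite (interval_lengthE hf) //= subr0 normr1. Qed.

(** Constants on either side of 1 extend the estimates to empty words, whose interval has length
    1. *)
Lemma bounded_distortion_bounds : bounded_distortion f ->
  exists K L : R, [/\ 0 < K, K <= 1, 1 <= L & forall v w, word v -> word w ->
    K * (len v * len w) <= len (v ++ w) <= L * (len v * len w)].
Proof.
move=> [K3 [K4 [K30 K40 H]]].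
exists (Num.min K3 1), (Num.max K4 1); split.
- by rewrite lt_min K30 ltr01.
- by rewrite ge_min lexx orbT.
- by rewrite le_max lexx orbT.
move=> v w wv ww; have v0 := interval_length_gt0 wv; have w0 := interval_length_gt0 ww.
have m1 : Num.min K3 1 <= 1 by rewrite ge_min lexx orbT.
have m2 : 1 <= Num.max K4 1 by rewrite le_max lexx orbT.
have [vn|vn] := posnP (size v).
  rewrite (size0nil vn) interval_length_nil mul1r /=.
  by rewrite ler_piMl ?(ltW w0) // ler_peMl // ltW.
have [wn|wn] := posnP (size w).
  rewrite (size0nil wn) interval_length_nil mulr1 cats0.
  by rewrite ler_piMl ?(ltW v0) // ler_peMl // ltW.
have /andP[] := H v w wv ww vn wn.
rewrite ler_pdivlMr ?mulr_gt0 // ler_pdivrMr ?mulr_gt0 // => h1 h2.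
have vw : 0 <= len v * len w by rewrite mulr_ge0 // ltW.
by rewrite (le_trans _ h1) ?(le_trans h2) // ler_wpM2r // ?ge_min ?le_max lexx.
Qed.

Lemma interval_length_rcons v j : word v -> (0 < j)%N ->
  len (rcons v j) = `|comp_word f v (rend f j) - comp_word f v (lend f j)|.
Proof.
move=> wv j0; have wj : word (rcons v j) by rewrite /word all_rcons j0.
rewrite (interval_lengthE hf) // -cats1 !comp_word_cat /= /rend /lend.
by have [] := leP (f j 0) (f j 1) => _ //; rewrite distrC.
Qed.

Lemma comp_word_rend_le v N : word v -> (0 < N)%N ->
  `|comp_word f v (rend f N) - comp_word f v 0| <=
    \sum_(1 <= j < N.+1) len (rcons v j).
Proof.
move=> wv; case: N => // N _; elim: N => [|N IH].
  by rewrite big_nat1 interval_length_rcons // (lend1 hf).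
rewrite big_nat_recr //= interval_length_rcons // (rend_lendS hf) // [leRHS]addrC.
by apply: le_trans (ler_distD (comp_word f v (rend f N.+1)) _ _) _; rewrite lerD2l.
Qed.

(** Children with a letter above [M] fill at most the proportion [L * (1 - rend f M)] of the
    cylinder of [v], since each has length at most [L] times the product of lengths. *)
Lemma sum_length_children (K L : R) v M : 1 <= L ->
  (forall v w, word v -> word w -> len (v ++ w) <= L * (len v * len w)) ->
  word v -> (0 < M)%N ->
  (1 - L * (1 - rend f M)) * len v <= \sum_(j <- iota 1 M) len (rcons v j).
Proof.
move=> L1 HL wv M0; have L0 : 0 <= L by apply: le_trans L1.
have -> : \sum_(j <- iota 1 M) len (rcons v j) = \sum_(1 <= j < M.+1) len (rcons v j).
  by rewrite /index_iota subn1.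
have [Lip HLip] := comp_word_lipschitz hf wv.
have v0 := interval_length_gt0 wv.
rewrite mulrBl mul1r lerBlDr; apply/ler_addgt0Pr => e e0.
(* By the Lipschitz bound, letters above a large [N] account for at most [e], so only finite sums
   over children occur. *)
pose e' := e / (`|Lip| + 1).
have Lip0 : 0 < `|Lip| + 1 by rewrite ltr_wpDl.
have e'0 : 0 < e' by rewrite divr_gt0.
have [N0 N00 hN0] := rend_cofinal hf (ltac:(lra) : 1 - e' < 1).
pose N := maxn N0 M; have MN : (M <= N)%N by rewrite leq_maxr.
have N_0 : (0 < N)%N by apply: leq_trans MN.
have hN : 1 - e' <= rend f N by apply: le_trans hN0 (rend_le_rend hf N00 (leq_maxl _ _)).
have r0 : 0 <= rend f N by apply: le_trans (lend_ge0 hf N_0) (ltW (lend_lt_rend hf N_0)).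
have r1 := rend_lt1 hf N_0.
have h1 : `|comp_word f v 1 - comp_word f v (rend f N)| <= e.
  apply: le_trans (HLip _ _ _ _) _; rewrite ?lexx ?ler01 ?r0 ?(ltW r1) //.
  rewrite gtr0_norm ?subr_gt0 //; apply: le_trans (_ : (`|Lip| + 1) * e' <= _); last first.
    by rewrite /e' mulrC divfK // gt_eqF.
  apply: le_trans (_ : (`|Lip| + 1) * (1 - rend f N) <= _).
    by rewrite ler_wpM2r ?subr_ge0 ?(ltW r1) // (le_trans (ler_norm Lip)) // lerDl.
  by rewrite ler_pM2l //; move: hN; clear; lra.
have h2 : `|comp_word f v (rend f N) - comp_word f v 0| <=
    \sum_(1 <= j < N.+1) len (rcons v j).
  exact: comp_word_rend_le.
have h3 : \sum_(1 <= j < N.+1) len (rcons v j) <=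
    \sum_(1 <= j < M.+1) len (rcons v j) + L * (1 - rend f M) * len v.
  rewrite (big_cat_nat (n := M.+1)) //= lerD2l.
  apply: le_trans (_ : \sum_(M.+1 <= j < N.+1) L * len v * (rend f j - rend f j.-1) <= _).
    rewrite big_nat_cond [leRHS]big_nat_cond; apply: ler_sum => j /andP[/andP[Mj _] _].
    case: j Mj => // j; rewrite ltnS => Mj; have j0 : (0 < j)%N by apply: leq_trans Mj.
    have wj : word [:: j.+1] by [].
    rewrite -cats1; apply: le_trans (HL _ _ wv wj) _; rewrite mulrA ler_wpM2l //.
      by rewrite mulr_ge0 // ltW.
    by rewrite /= -(rend_lendS hf j0) rend_sub_lend // (interval_lengthE hf).
  rewrite -mulr_sumr big_add1 /= (telescope_sumr (rend f)) // mulrAC.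
  by rewrite ler_wpM2r ?(ltW v0) // ler_wpM2l // lerD2r ltW.
rewrite (interval_lengthE hf) //; apply: le_trans (ler_distD (comp_word f v (rend f N)) _ _) _.
rewrite -(interval_lengthE hf) //; move: h1 h2 h3.
set X := `| _ |; set Y := `| _ |; move=> h1 h2 h3.
by rewrite addrC lerD // (le_trans h2).
Qed.

Lemma sum_length_words (L : R) M n : 1 <= L ->
  (forall v w, word v -> word w -> len (v ++ w) <= L * (len v * len w)) ->
  (0 < M)%N -> 0 <= 1 - L * (1 - rend f M) ->
  (1 - L * (1 - rend f M)) ^+ n <= \sum_(w <- words (fun=> iota 1 M) n) len w.
Proof.
move=> L1 HL M0 c0; elim: n => [|n IH]; first by rewrite big_seq1 interval_length_nil expr0.
rewrite exprS /= big_allpairs_dep /=; apply: le_trans (ler_wpM2l c0 IH) _.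
rewrite mulr_sumr !big_seq; apply: ler_sum => w /words_mem[sw wD].
apply: (sum_length_children 0) => //.
by apply/(all_nthP 0%N) => i; rewrite sw => /wD; rewrite mem_iota => /andP[].
Qed.

Lemma interval_length_contract : exists m (A : R), [/\ (0 < m)%N, 0 < A, A < 1 &
  forall k w, word w -> size w = (m * k)%N -> len w <= A ^+ k].
Proof.
have [m [A [m0 A0 A1 H]]] := dgl_contract hf.
exists m, A; split=> // k w ww sw; rewrite (interval_lengthE hf) //.
suff : forall x y, 0 <= x <= 1 -> 0 <= y <= 1 ->
    `|comp_word f w x - comp_word f w y| <= A ^+ k * `|x - y|.
  move=> /(_ 1 0); rewrite subr0 normr1 mulr1; apply; rewrite lexx ler01 //.
elim: k w ww sw => [|k IH] w ww sw x y x01 y01.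
  by rewrite muln0 in sw; rewrite (size0nil sw) expr0 mul1r.
have wt := word_take m ww; have wd := word_drop m ww.
have st : size (take m w) = m by rewrite size_takel // sw mulnS leq_addr.
have sd : size (drop m w) = (m * k)%N by rewrite size_drop sw mulnS addKn.
have IH' := IH _ wd sd x y x01 y01.
have E z : comp_word f w z = comp_word f (take m w) (comp_word f (drop m w) z).
  by rewrite -comp_word_cat cat_take_drop.
rewrite !E.
have B z : z \in `[0, 1] -> 0 <= `|deriv01 (comp_word f (take m w)) z| <= A.
  by move=> zI; have /andP[h1 h2] := H _ wt st z zI; rewrite (ltW h1).
have /andP[_ h] := deriv01_bounds (fun z => @has_deriv01_comp_word R d f hf _ z wt) B
   (comp_word01 hf wd x01) (comp_word01 hf wd y01).
by apply: (le_trans h); rewrite exprS -mulrA ler_pM2l.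
Qed.

End BoundedDistortion.

(* Sorting by decreasing length, the i-th word would have length less than
   (Lam / (i + 1)) ^ (1 / s) if the conclusion failed, and the lengths would
   have a sum too small for [hsum]. *)
Lemma many_long_words (R : realType) (T : eqType) (l : seq T) (len : T -> R)
    (s s' Lam top : R) :
  0 < s -> s < s' -> s' < 1 -> 0 < Lam -> uniq l ->
  (forall w, w \in l -> 0 < len w <= top) ->
  top `^ (1 - s') * (Lam `^ (s' / s) * (1 + (s' / s - 1)^-1)) < \sum_(w <- l) len w ->
  exists (W : seq T) (rho : R), [/\ uniq W, {subset W <= l}, 0 < rho,
    (forall w, w \in W -> rho <= len w) & Lam <= (size W)%:R * rho `^ s].
Proof.
move=> s0 ss' s'1 Lam0 ul lent hsum; have s'0 : 0 < s' by apply: lt_trans ss'.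
pose r (x y : T) := len y <= len x.
have rtot : total r by move=> x y; rewrite /r le_total.
have rtr : transitive r by move=> x y z; rewrite /r => h1 h2; exact: le_trans h1.
pose L := sort r l.
have pL : perm_eq L l by rewrite perm_sort.
have top0 : 0 <= top `^ (1 - s') by exact: powR_ge0.
pose p := s' / s; have p1 : 1 < p by rewrite ltr_pdivlMr // mul1r.
have Z0 : 0 <= 1 + (p - 1)^-1 by rewrite addr_ge0 // invr_ge0 subr_ge0 ltW.
case: l => [|x0 l'] in ul lent hsum L pL *.
  by move: hsum; rewrite big_nil ltNge mulr_ge0 // mulr_ge0 // powR_ge0.
have mL w : w \in L -> w \in x0 :: l' by rewrite (perm_mem pL).
have [[i [iL hi]]|none] := pselect (exists i, (i < size L)%N /\
    Lam <= i.+1%:R * len (nth x0 L i) `^ s).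
  exists (take i.+1 L), (len (nth x0 L i)); split.
  - by rewrite take_uniq // sort_uniq.
  - by move=> w /mem_take /mL.
  - by have /andP[] := lent _ (mL _ (mem_nth x0 iL)).
  - move=> w /(nthP x0)[j]; rewrite size_takel // ltnS => ji <-.
    rewrite nth_take ?ltnS //.
    apply: (sorted_leq_nth rtr (fun x => lexx (len x)) x0 (sort_sorted rtot _)) => //.
    by rewrite inE (leq_ltn_trans ji).
  - by rewrite size_takel.
exfalso; move: hsum; apply/negP; rewrite -leNgt -(perm_big _ pL) /=.
rewrite (big_nth x0) big_mkord.
apply: le_trans (_ : \sum_(i < size L) top `^ (1 - s') *
    (Lam `^ p * i.+1%:R `^ (- p)) <= _).
  apply: ler_sum => i _.
  have /andP[x_gt0 xt] := lent _ (mL _ (mem_nth x0 (ltn_ord i))).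
  set x := len _ in x_gt0 xt *.
  have hx : x `^ s <= Lam / i.+1%:R.
    rewrite ler_pdivlMr ?ltr0n // leNgt; apply/negP => h; apply: none.
    by exists i; split=> //; rewrite mulrC ltW.
  (* Split [x] as [x ^ (1 - s') * x ^ s']; the second factor is at most
     [(Lam / (i + 1)) ^ (s' / s)], which is summable in [i]. *)
  rewrite -[leLHS](powRr1 (ltW x_gt0)) -[X in _ `^ X](subrK s' 1).
  rewrite powRD; last by rewrite (gt_eqF x_gt0) implybT.
  apply: ler_pM; rewrite ?powR_ge0 //.
    apply: ge0_ler_powR; rewrite ?nnegrE ?subr_ge0 ?(ltW s'1) ?(ltW x_gt0) //.
    exact: le_trans (ltW x_gt0) xt.
  have -> : s' = s * p by rewrite /p mulrC divfK // gt_eqF.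
  rewrite (@powRrM _ x s p); apply: le_trans (_ : (Lam / i.+1%:R) `^ p <= _).
    have p0 : 0 <= p by rewrite ltW // (lt_trans ltr01).
    by apply: ge0_ler_powR; rewrite // nnegrE ?powR_ge0 // divr_ge0 // ltW.
  by rewrite powRM ?(ltW Lam0) ?invr_ge0 // powRN -powR_inv1 // -powRrM mulN1r powRN.
rewrite -mulr_sumr ler_wpM2l // -mulr_sumr ler_wpM2l ?powR_ge0 //.
have -> : \sum_(i < size L) i.+1%:R `^ (- p) =
    \sum_(1 <= j < (size L).+1) (j%:R : R) `^ (- p).
  by rewrite big_add1 /= big_mkord.
exact: sum_powR_le.
Qed.

(** * Large letters at square times *)

Section SparseLetters.
Context {R : realType}.
Variables (alpha a : R) (P : nat).
Hypotheses (al0 : 0 < alpha) (al2 : alpha < 2^-1) (ha : 0 < a) (P0 : (0 < P)%N).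

Definition isqrt (n : nat) : nat := Num.truncn (Num.sqrt (n%:R : R)).

Lemma isqrt_itv n : (isqrt n ^ 2 <= n < (isqrt n).+1 ^ 2)%N.
Proof.
have /andP[h1 h2] := truncn_itv (sqrtr_ge0 (n%:R : R)); rewrite -/(isqrt n) in h1 h2.
have s2 : Num.sqrt (n%:R : R) ^+ 2 = n%:R by rewrite sqr_sqrtr.
apply/andP; split.
  by rewrite -(ler_nat R) natrX -s2; apply: lerXn2r; rewrite ?nnegrE ?sqrtr_ge0.
by rewrite -(ltr_nat R) natrX -s2; apply: ltrXn2r; rewrite ?nnegrE ?sqrtr_ge0.
Qed.

Lemma leq_isqrt m n : (m <= n)%N -> (isqrt m <= isqrt n)%N.
Proof.
by move=> mn; rewrite le_truncn // ler_sqrt // ler_nat.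
Qed.

Lemma leq_isqrt_of_sqr q n : (q ^ 2 <= n)%N -> (q <= isqrt n)%N.
Proof.
move=> qn; have /andP[_ h] := isqrt_itv n.
by rewrite -ltnS -ltn_sqr; exact: leq_ltn_trans h.
Qed.

(** [Phi] frozen at the time [P * q ^ 2], where [P] is the block length and [q ^ 2] the largest
    square not above the block index [r]. *)
Definition staircase r : R := expR ((P * isqrt r ^ 2)%:R `^ alpha).
Definition staircase_root r : R := (staircase r.+1 - staircase r) `^ a^-1.
(* Equal to 1 unless [r + 1] is a perfect square. *)
Definition big_letter r : nat := (Num.truncn (staircase_root r)).+1.

Lemma staircase_le m n : (m <= n)%N -> staircase m <= staircase n.
Proof.
move=> mn; rewrite ler_expR; apply: ge0_ler_powR; rewrite ?nnegrE ?(ltW al0) //.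
by rewrite ler_nat leq_mul2l leq_sqr leq_isqrt ?orbT.
Qed.

Lemma staircase_step_ge0 r : 0 <= staircase r.+1 - staircase r.
Proof. by rewrite subr_ge0 staircase_le. Qed.

Lemma big_letter_ge r : staircase r.+1 - staircase r <= (big_letter r)%:R `^ a.
Proof.
rewrite -[leLHS](powRVK ha (staircase_step_ge0 r)).
apply: ge0_ler_powR; rewrite ?nnegrE ?powR_ge0 ?(ltW ha) //.
exact/ltW/truncnS_gt.
Qed.

Lemma big_letter_le r : (big_letter r)%:R <= staircase_root r + 1.
Proof. by rewrite -natr1 lerD2r truncn_le // powR_ge0. Qed.

Lemma staircaseE r : \sum_(i < r) (staircase i.+1 - staircase i) = staircase r - staircase 0.
Proof. by rewrite -(big_mkord xpredT (fun i => staircase i.+1 - staircase i)) telescope_sumr. Qed.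

Lemma sum_big_letter_ge r : staircase r - staircase 0 <= \sum_(i < r) (big_letter i)%:R `^ a.
Proof. by rewrite -staircaseE; apply: ler_sum => i _; exact: big_letter_ge. Qed.

Lemma sum_big_letter_le (e : R) : 0 < e -> exists2 C : R, 0 <= C & forall r,
  \sum_(i < r) (big_letter i)%:R `^ a <= (1 + e) * (staircase r - staircase 0) + C * r%:R.
Proof.
move=> e0; have [eta eta0 [C C0 HC]] := powR_affine_le ha e0.
exists C => // r; rewrite -staircaseE mulr_sumr.
have -> : C * r%:R = \sum_(i < r) C by rewrite sumr_const card_ord mulr_natr.
rewrite -big_split /=; apply: ler_sum => i _.
rewrite -[X in _ <= (1 + e) * X + C](powRVK ha (staircase_step_ge0 i)).
have v0 : 0 <= staircase_root i by exact: powR_ge0.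
apply: le_trans (HC _ v0); apply: ge0_ler_powR; rewrite ?nnegrE ?(ltW ha) //.
  by rewrite addr_ge0 // mulr_ge0 // addr_ge0 // ltW.
apply: (le_trans (big_letter_le i)).
have : 0 <= staircase_root i * eta by rewrite mulr_ge0 // ltW.
by rewrite mulrDr mulr1; move: (staircase_root i * eta) => y; lra.
Qed.

(** Between consecutive squares [n ^ alpha] varies by at most [P ^ alpha * ((q + 1) ^ (2 alpha) - q
    ^ (2 alpha))], which is at most [P ^ alpha * q ^ (2 alpha - 1)]; as [alpha < 1/2], this tends to
    0. *)
Lemma staircase_asymptotic (e : R) : 0 < e -> exists n0, forall n, (n0 <= n)%N ->
  (1 - e) * expR (n%:R `^ alpha) <= staircase (n %/ P) <= expR (n%:R `^ alpha).
Proof.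
move=> e0.
have b0 : 0 < 1 - 2 * alpha by move: al2; lra.
have Pa0 : 0 < (P%:R : R) `^ alpha by rewrite powR_gt0 // ltr0n.
pose l := ln (1 + e); have l0 : 0 < l by rewrite ln_gt0 // ltrDl.
have [q0 q0P] := powR_unbounded (P%:R `^ alpha / l) b0.
exists (P * q0.+1 ^ 2)%N => n n0n.
pose r := (n %/ P)%N; pose q := isqrt r; rewrite -/r.
have /andP[qr rq] := isqrt_itv r; rewrite -/q in qr rq.
have q0q : (q0.+1 <= q)%N by apply: leq_isqrt_of_sqr; rewrite leq_divRL // mulnC.
have q_gt0 : 0 < q%:R :> R by rewrite ltr0n (leq_trans _ q0q).
have up : (P * q ^ 2 <= n)%N.
  by apply: leq_trans (leq_divM n P); rewrite -/r mulnC leq_mul2r qr orbT.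
have lo : (n <= P * q.+1 ^ 2)%N.
  by rewrite ltnW // mulnC -ltn_divLR.
apply/andP; split; last first.
  rewrite ler_expR; apply: ge0_ler_powR; rewrite ?nnegrE ?(ltW al0) //.
  by rewrite ler_nat.
have sqE (y : nat) : (P * y ^ 2)%:R `^ alpha = P%:R `^ alpha * y%:R `^ (2 * alpha) :> R.
  by rewrite natrM powRM // natrX powRrM powR_mulrn.
have gap : n%:R `^ alpha - (P * q ^ 2)%:R `^ alpha <= l.
  apply: le_trans (_ : (P * q.+1 ^ 2)%:R `^ alpha - (P * q ^ 2)%:R `^ alpha <= _).
    by rewrite lerD2r; apply: ge0_ler_powR; rewrite ?nnegrE ?(ltW al0) // ler_nat.
  rewrite !sqE -mulrBr mulrC -ler_pdivlMr //.
  have q1E : q.+1%:R = q%:R * (1 + q%:R^-1) :> R.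
    by rewrite mulrDr mulr1 mulfV ?gt_eqF // natr1.
  rewrite q1E powRM ?addr_ge0 ?invr_ge0 // -[X in _ - X]mulr1 -mulrBr.
  have h1 : (1 + q%:R^-1) `^ (2 * alpha) <= 1 + q%:R^-1 :> R.
    by apply: ler1_powR; [rewrite lerDl invr_ge0|move: al2; lra].
  apply: le_trans (_ : q%:R `^ (2 * alpha) * q%:R^-1 <= _).
    by rewrite ler_wpM2l ?powR_ge0 // lerBlDl.
  have -> : q%:R `^ (2 * alpha) * q%:R^-1 = (q%:R `^ (1 - 2 * alpha))^-1 :> R.
    rewrite -powR_inv1 // -powRD; last by rewrite (gt_eqF q_gt0) implybT.
    by rewrite -powRN; congr (_ `^ _); ring.
  have h2 := q0P q (ltnW q0q).
  rewrite -[leRHS]invrK lef_pV2 ?posrE ?powR_gt0 ?invr_gt0 ?divr_gt0 //.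
  by rewrite invf_div.
have h : expR (n%:R `^ alpha) <= (1 + e) * staircase r.
  have e1 : 0 < 1 + e by rewrite addr_gt0.
  rewrite -[X in X * _](lnK (x := 1 + e)) ?posrE // -/l -expRD ler_expR.
  by rewrite -lerBlDr.
have E0 := expR_gt0 ((n%:R : R) `^ alpha).
have [e1|e1] := leP e 1; last first.
  apply: le_trans (expR_ge0 _); rewrite pmulr_lle0 // subr_le0 ltW //.
apply: le_trans (_ : (1 - e) * ((1 + e) * staircase r) <= _).
  by rewrite ler_wpM2l // subr_ge0.
rewrite mulrA ler_piMl ?expR_ge0 //; move: e0 e1; nra.
Qed.

(** With [q = isqrt n], at most [q] of the first [n] big letters differ from 1, and their logarithms
    are at most of order [q ^ (2 alpha)]. The total, of order [q ^ (1 + 2 alpha)], is [o (q ^ 2)]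
    because [alpha < 1/2]. *)
Lemma sum_ln_big_letter_le (kappa : R) : exists C : R, forall n,
  kappa * (\sum_(i < n) ln (big_letter i)%:R) <= n%:R + C.
Proof.
have b0 : 0 < 1 - 2 * alpha by move: al2; lra.
have lnb0 i : 0 <= ln (big_letter i)%:R :> R by rewrite ln_ge0 // ler1n.
pose Pa : R := P%:R `^ alpha / a.
have Pa0 : 0 <= Pa by rewrite divr_ge0 ?powR_ge0 // ltW.
have ln20 : 0 <= ln 2 :> R by rewrite ln_ge0 // ler1n.
have bound n : \sum_(i < n) ln (big_letter i)%:R <=
    (isqrt n)%:R * (ln 2 + Pa * (isqrt n)%:R `^ (2 * alpha)).
  set X := ln 2 + _.
  have X0 : 0 <= X by apply: addr_ge0 => //; rewrite mulr_ge0 ?powR_ge0.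
  have single i : (i < n)%N -> ln (big_letter i)%:R <= X.
    move=> ilt.
    have root_le : staircase_root i <= expR (Pa * (isqrt n)%:R `^ (2 * alpha)).
      have -> : Pa * (isqrt n)%:R `^ (2 * alpha) = (P * isqrt n ^ 2)%:R `^ alpha / a.
        by rewrite natrM powRM // natrX (@powRrM _ (isqrt n)%:R 2) powR_mulrn // /Pa mulrAC.
      rewrite expRM; apply: ge0_ler_powR;
        rewrite ?nnegrE ?staircase_step_ge0 ?expR_ge0 ?invr_ge0 ?(ltW ha) //.
      apply: le_trans (staircase_le ilt); by rewrite gerBl expR_ge0.
    have e1 : 1 <= expR (Pa * (isqrt n)%:R `^ (2 * alpha)).
      by rewrite -expR0 ler_expR mulr_ge0 ?powR_ge0.
    have b_le : (big_letter i)%:R <= 2 * expR (Pa * (isqrt n)%:R `^ (2 * alpha)).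
      by apply: le_trans (big_letter_le i) _; move: root_le e1; lra.
    rewrite /X -[X in _ + X]expRK -lnM ?posrE ?expR_gt0 //.
    by rewrite ler_ln ?posrE ?ltr0n ?mulr_gt0 ?expR_gt0.
  suff main m : (m <= n)%N -> \sum_(i < m) ln (big_letter i)%:R <= (isqrt m)%:R * X by exact: main.
  elim: m => [|m IH] mn; first by rewrite big_ord0 mulr_ge0.
  rewrite big_ord_recr /=; have := leq_isqrt (leqnSn m).
  rewrite leq_eqVlt => /predU1P[E|lt].
    have -> : big_letter m = 1%N.
      rewrite /big_letter /staircase_root /staircase -E subrr powR0 ?invr_eq0 ?gt_eqF //.
      by rewrite truncn0.
    by rewrite ln1 addr0 -E IH // ltnW.
  apply: le_trans (lerD (IH (ltnW mn)) (single m mn)) _.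
  have : (isqrt m).+1%:R * X <= (isqrt m.+1)%:R * X by rewrite ler_wpM2r // ler_nat.
  by rewrite -(natr1 (isqrt m)) mulrDl mul1r.
pose k1 := `|kappa| * (ln 2 + Pa); have k10 : 0 <= k1.
  by rewrite mulr_ge0 // addr_ge0.
have [q0 q0P] := powR_unbounded k1 b0.
suff [C CP] : exists C, forall n, kappa * (\sum_(i < n) ln (big_letter i)%:R) - n%:R <= C.
  by exists C => n; rewrite -lerBlDl.
apply: (@bounded_above_of_eventually _ _ (q0.+1 ^ 2)); first by move=> n; exact: num_real.
move=> n n0n; rewrite subr_le0.
have /andP[qn _] := isqrt_itv n; have := bound n.
have qq : (q0.+1 <= isqrt n)%N by exact: leq_isqrt_of_sqr.
have := q0P (isqrt n) (ltnW qq).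
have q1 : 1 <= (isqrt n)%:R :> R by rewrite ler1n (leq_trans _ qq).
have qR : (isqrt n)%:R ^+ 2 <= n%:R :> R by rewrite -natrX ler_nat.
set q : R := (isqrt n)%:R in q1 qR *; set S := \sum_(_ < _) _ => hq hS.
have q_gt0 : 0 < q by apply: lt_le_trans q1.
apply: le_trans qR.
have S0 : 0 <= S by apply: sumr_ge0.
have qa1 : 1 <= q `^ (2 * alpha).
  by rewrite -[leLHS](powRr0 q) ler_powR // mulr_ge0 // ltW.
apply: le_trans (_ : `|kappa| * S <= _); first by rewrite ler_wpM2r ?ler_norm.
apply: le_trans (_ : `|kappa| * (q * (ln 2 + Pa * q `^ (2 * alpha))) <= _).
  by rewrite ler_wpM2l.
apply: le_trans (_ : q * (k1 * q `^ (2 * alpha)) <= _).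
  have h : ln 2 + Pa * q `^ (2 * alpha) <= (ln 2 + Pa) * q `^ (2 * alpha).
    by rewrite [leRHS]mulrDl lerD2r ler_peMr.
  by rewrite mulrCA ler_pM2l // /k1 -mulrA ler_wpM2l.
rewrite expr2 ler_pM2l //.
apply: le_trans (_ : q `^ (1 - 2 * alpha) * q `^ (2 * alpha) <= _).
  by rewrite ler_wpM2r // powR_ge0.
rewrite -powRD; last by rewrite (gt_eqF q_gt0) implybT.
by rewrite subrK powRr1 // ltW.
Qed.

Lemma sparse_power_sum_cvg (S : nat -> R) (M : R) :
  (forall n, \sum_(i < n %/ P) (big_letter i)%:R `^ a <= S n <=
    \sum_(i < n %/ P) (big_letter i)%:R `^ a + M * n%:R) ->
  S n / expR (n%:R `^ alpha) @[n --> \oo] --> (1 : R).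
Proof.
move=> HS; apply: cvg_ratio1 => [n|e e0]; first exact: expR_gt0.
have e20 : 0 < e / 2 by rewrite divr_gt0.
have [C C0 HC'] := sum_big_letter_le e20.
have [z0 [s0 LB HC]] : exists z0 : R, [/\ 0 <= z0,
    forall r, staircase r - z0 <= \sum_(i < r) (big_letter i)%:R `^ a &
    forall r, \sum_(i < r) (big_letter i)%:R `^ a <=
      (1 + e / 2) * (staircase r - z0) + C * r%:R].
  by exists (staircase 0); split=> //; [exact: expR_ge0|exact: sum_big_letter_ge].
have [n1 n1P] := staircase_asymptotic e20.
have [n2 n2P] := powR_sublinear_exp (2 * (C + `|M|) / e) al0.
have [n3 n3P] := powR_sublinear_exp (2 * z0 / e) al0.
exists (maxn n1 (maxn n2 n3)) => n; rewrite !geq_max => /and3P[n1n n2n n3n].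
have h1 := n1P n n1n; have h2 := n2P n n2n; have h3 := n3P n n3n.
have lb := LB (n %/ P)%N; have ub := HC (n %/ P)%N; have hS := HS n.
have rn : (n %/ P)%:R <= n%:R :> R by rewrite ler_nat leq_div.
rewrite -!(natr1 n) in h2 h3; have n_ge0 : 0 <= n%:R :> R by [].
move: s0 h1 h2 h3 lb ub hS rn n_ge0.
move: (expR _) => X; move: (staircase _) => st; move: (\sum_(i < _) _) => sum.
move: ((n %/ P)%:R : R) => r; move: (n%:R : R) => y; move: (S n) => Sn s0 /andP[a1 a2] h2 h3 lb ub /andP[l1 l2] ry y0.
clear - e e0 e20 C C0 M z0 s0 Sn sum st X y r a1 a2 h2 h3 lb ub l1 l2 ry y0.
have {}h3 : 2 * z0 <= e * X.
  have : 2 * z0 / e <= X.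
    apply: le_trans h3; rewrite ler_peMr ?lerDr //.
    by rewrite divr_ge0 ?mulr_ge0 // ltW.
  by rewrite ler_pdivrMr // [X * e]mulrC.
have {}h2 : 2 * ((C + `|M|) * y) <= e * X.
  have CM : 0 <= 2 * (C + `|M|) by rewrite mulr_ge0 // addr_ge0.
  have : 2 * (C + `|M|) * y / e <= X.
    apply: le_trans h2; rewrite mulrAC ler_wpM2l ?divr_ge0 ?(ltW e0) //.
    by rewrite lerDl.
  by rewrite ler_pdivrMr // -mulrA [X * e]mulrC.
apply/andP; split; first by apply: le_trans l1; apply: le_trans lb; lra.
apply: (le_trans l2).
have h4 : C * r <= C * y by rewrite ler_wpM2l.
have h5 : M * y <= `|M| * y by rewrite ler_wpM2r ?ler_norm.
have h6 : (1 + e / 2) * (st - z0) <= (1 + e / 2) * X.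
  by rewrite ler_wpM2l ?addr_ge0 ?(ltW e20) //; lra.
move: h2; rewrite mulrDl; lra.
Qed.

End SparseLetters.

(** * Block codes and separation *)

(** [g] is monotone, so between [g z] and a point [y] outside the image of (0, 1) lies the whole
    image of [0, p] or of [q, r]. *)
Lemma dist_outside_image01 (R : realType) (g : R -> R) (L p q r z y : R) :
  (forall x y, 0 <= x <= 1 -> 0 <= y <= 1 -> `|g x - g y| <= L * `|x - y|) ->
  (forall x y, 0 <= x <= 1 -> 0 <= y <= 1 -> g x = g y -> x = y) ->
  0 <= p -> p <= z -> z <= q -> q <= r -> r <= 1 ->
  (forall u, 0 < u < 1 -> g u <> y) ->
  Num.min `|g p - g 0| `|g r - g q| <= `|g z - y|.
Proof.
move=> gL ginj p0 pz zq qr r1 yout.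
have z0 : 0 <= z by apply: le_trans pz.
have q1 : q <= 1 by apply: le_trans r1.
have z1 : z <= 1 by apply: le_trans q1.
have p1 : p <= 1 by apply: le_trans z1.
have q0 : 0 <= q by apply: le_trans zq.
have ob : y <= Num.min (g 0) (g 1) \/ Num.max (g 0) (g 1) <= y.
  have [?|h1] := leP y (Num.min (g 0) (g 1)); first by left.
  have [?|h2] := leP (Num.max (g 0) (g 1)) y; first by right.
  have [|u u01 gu] := @image01_surj_lt R g L gL ginj y; first by rewrite h1 h2.
  by have := yout u u01.
have mono (h : R -> R) :
    (forall x y, 0 <= x -> x < y -> y <= 1 -> h x < h y) ->
    forall x y, 0 <= x -> x <= y -> y <= 1 -> h x <= h y.
  move=> hm x x' x0; rewrite le_eqVlt => /predU1P[-> //|xx'] x'1.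
  by rewrite ltW // hm.
rewrite ge_min.
have [inc|dec] := injective01_mono gL ginj.
  have {}inc := mono _ inc.
  have [yl|yr] := ob.
    apply/orP; left.
    have h1 : y <= g 0 by apply: le_trans yl _; rewrite ge_min lexx.
    have h2 := inc _ _ (lexx 0) p0 p1; have h3 := inc _ _ p0 pz z1.
    rewrite ger0_norm ?subr_ge0 //; apply: le_trans (ler_norm _); lra.
  apply/orP; right.
  have h1 : g 1 <= y by apply: le_trans yr; rewrite le_max lexx orbT.
  have h2 := inc _ _ z0 zq q1; have h3 := inc _ _ q0 qr r1.
  have h4 := inc _ _ (le_trans q0 qr) r1 (lexx 1).
  rewrite ger0_norm ?subr_ge0 // distrC; apply: le_trans (ler_norm _); lra.
have {}dec x x' : 0 <= x -> x <= x' -> x' <= 1 -> g x' <= g x.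
  move=> x0 xx' x'1; rewrite -lerN2.
  apply: (mono (fun t => - g t)) => // u u' u0 uu' u'1; rewrite ltrN2; exact: dec.
have [yl|yr] := ob.
  apply/orP; right.
  have h1 : y <= g 1 by apply: le_trans yl _; rewrite ge_min lexx orbT.
  have h2 := dec _ _ z0 zq q1; have h3 := dec _ _ q0 qr r1.
  have h4 := dec _ _ (le_trans q0 qr) r1 (lexx 1).
  rewrite distrC ger0_norm ?subr_ge0 //; apply: le_trans (ler_norm _); lra.
apply/orP; left.
have h1 : g 0 <= y by apply: le_trans yr; rewrite le_max lexx.
have h2 := dec _ _ (lexx 0) p0 p1; have h3 := dec _ _ p0 pz z1.
rewrite distrC ger0_norm ?subr_ge0 // distrC; apply: le_trans (ler_norm _); lra.
Qed.

Section BlockLetters.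
Variables (l : nat) (W : seq (seq nat)) (big : nat -> nat).
Hypothesis sizeW : forall v, v \in W -> size v = l.

(* The letter 2 keeps the coded point away from the ends of the cylinder of the
   chosen word. *)
Definition block (s : nat -> nat) r : seq nat := nth [::] W (s r) ++ [:: 2%N; big r].
Definition block_letter s i : nat := nth 0%N (block s (i %/ l.+2)) (i %% l.+2).

Lemma size_block s r : (s r < size W)%N -> size (block s r) = l.+2.
Proof. by move=> sr; rewrite size_cat sizeW ?mem_nth // addn2. Qed.

Lemma mkseq_block_letter s r : (s r < size W)%N ->
  mkseq (block_letter s) (r.+1 * l.+2) = mkseq (block_letter s) (r * l.+2) ++ block s r.
Proof.
move=> sr; rewrite mulSn addnC /mkseq iotaD map_cat add0n; congr (_ ++ _).
apply: (@eq_from_nth _ 0%N); first by rewrite size_map size_iota size_block.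
move=> j; rewrite size_map size_iota => jl.
rewrite (nth_map 0%N) ?size_iota // nth_iota // /block_letter.
by rewrite divnMDl // modnMDl divn_small // addn0 modn_small.
Qed.

Lemma eq_mkseq_block_letter s s' r : (forall i, (i < r)%N -> s i = s' i) ->
  mkseq (block_letter s) (r * l.+2) = mkseq (block_letter s') (r * l.+2).
Proof.
move=> ss'; apply/eq_in_map => i; rewrite mem_iota add0n => /andP[_ ir].
by rewrite /block_letter /block ss' // ltn_divLR.
Qed.

Lemma block_letter_two s n : (s n < size W)%N -> block_letter s (n * l.+2 + l) = 2%N.
Proof.
move=> sn; rewrite /block_letter divnMDl // modnMDl divn_small ?addn0 ?modn_small //.
by rewrite /block nth_cat sizeW ?mem_nth // ltnn subnn.
Qed.

Lemma block_letter_big s n : (s (n %/ l.+2) < size W)%N -> (l.+2 %| n.+1)%N ->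
  block_letter s n = big (n %/ l.+2).
Proof.
move=> sn dv; have E : (n %% l.+2)%N = l.+1.
  move: dv; rewrite {1}(divn_eq n l.+2) -addnS dvdn_addr ?dvdn_mull // => /dvdn_leq h.
  by apply/eqP; rewrite eqn_leq -ltnS ltn_mod /= -ltnS h.
by rewrite /block_letter E /block nth_cat sizeW ?mem_nth // ltnNge leqnSn /= subSnn.
Qed.

Lemma block_letter_small s n : (s (n %/ l.+2) < size W)%N -> ~~ (l.+2 %| n.+1)%N ->
  block_letter s n = 2%N \/
  exists v, v \in W /\ block_letter s n \in v.
Proof.
move=> sn ndv; have jl : (n %% l.+2 < l.+1)%N.
  rewrite ltn_neqAle -ltnS ltn_mod andbT; apply: contra ndv => /eqP E.
  by rewrite {1}(divn_eq n l.+2) -addnS E dvdn_add // dvdn_mull.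
rewrite /block_letter /block nth_cat sizeW ?mem_nth //; case: ifPn => jv.
  by right; exists (nth [::] W (s (n %/ l.+2)%N)); rewrite !mem_nth ?sizeW ?mem_nth.
left; have -> : (n %% l.+2)%N = l by apply/eqP; rewrite eqn_leq -ltnS jl leqNgt.
by rewrite subnn.
Qed.

End BlockLetters.

(** Big letters close the blocks, so their number among the first [n] letters is [n %/ l.+2]. All
    others are at most [M], the separating letter 2 included because [1 < M]. *)
Lemma block_letter_power_sum (R : realType) (a : R) (l : nat) (W : seq (seq nat))
    (big : nat -> nat) (M : nat) (s : nat -> nat) : 0 < a ->
  (forall v, v \in W -> size v = l) ->
  (forall v b, v \in W -> b \in v -> (b <= M)%N) -> (1 < M)%N ->
  (forall r, (s r < size W)%N) -> forall n,
  \sum_(i < n %/ l.+2) ((big i)%:R : R) `^ a <=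
    power_sum a (mkseq (block_letter l W big s) n) <=
  \sum_(i < n %/ l.+2) ((big i)%:R : R) `^ a + M%:R `^ a * n%:R.
Proof.
move=> ha sizeW WM M1 sW; elim=> [|n IH].
  by rewrite div0n big_ord0 /power_sum big_nil mulr0 addr0 lexx.
have /andP[l1 l2] := IH; have Ma : 0 <= (M%:R : R) `^ a by exact: powR_ge0.
rewrite mkseqS -cats1 power_sum_cat [power_sum a [:: _]]big_seq1 divnS // -(natr1 n).
have [dv|ndv] := boolP (l.+2 %| n.+1)%N.
  rewrite (block_letter_big big sizeW) // add1n big_ord_recr /= lerD2r l1 /=.
  by move: l2 Ma; lra.
rewrite add0n; have b0 : 0 <= (block_letter l W big s n)%:R `^ a :> R by exact: powR_ge0.
have bM : (block_letter l W big s n)%:R `^ a <= (M%:R : R) `^ a.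
  apply: ge0_ler_powR; rewrite ?nnegrE ?(ltW ha) // ler_nat.
  by have [->|[v [vW bv]]] := block_letter_small big sizeW (sW _) ndv; [|exact: WM bv].
by move: l1 l2 b0 bM; lra.
Qed.

Lemma block_letter_gt0 (l : nat) (W : seq (seq nat)) (big : nat -> nat) (s : nat -> nat) :
  (forall v, v \in W -> size v = l) -> (forall v, v \in W -> word v) ->
  (forall r, (0 < big r)%N) -> (forall r, (s r < size W)%N) ->
  forall n, (0 < block_letter l W big s n)%N.
Proof.
move=> sizeW wW big0 sW n; have [dv|ndv] := boolP (l.+2 %| n.+1)%N.
  by rewrite (block_letter_big big sizeW).
have [->//|[v [vW bv]]] := block_letter_small big sizeW (sW _) ndv.
exact: (allP (wW v vW)).
Qed.

(** Words of length [m * k] over a large finite alphabet have total length at least [h ^ k], while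
    each has length at most [A ^ k], and [(A ^ k) ^ (1 - s') = h ^ (2 k)]. As [h < 1], a large [k]
    meets the hypothesis of [many_long_words]. *)
Lemma exists_long_words (R : realType) (d : R) (f : nat -> R -> R) (L s Lam : R) :
  d_decaying_gauss_like d f -> 1 <= L ->
  (forall v w, word v -> word w -> interval_length f (v ++ w) <=
     L * (interval_length f v * interval_length f w)) ->
  0 < s -> s < 1 -> 2 <= Lam ->
  exists (l M : nat) (W : seq (seq nat)) (rho : R),
    [/\ uniq W /\ (1 < size W)%N, 0 < rho,
        forall v, v \in W -> [/\ word v, size v = l & rho <= interval_length f v],
        forall v b, v \in W -> b \in v -> (b <= M)%N & Lam <= (size W)%:R * rho `^ s].
Proof.
move=> hf L1 HL s0 s1 Lam2.
have [m [A [m0 A0 A1 HA]]] := interval_length_contract hf.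
pose s' := (1 + s) / 2; have ss' : s < s' by rewrite /s'; lra.
have s'1 : s' < 1 by rewrite /s'; lra.
have Lam0 : 0 < Lam by apply: lt_le_trans Lam2.
pose Z := Lam `^ (s' / s) * (1 + (s' / s - 1)^-1).
have p1 : 1 < s' / s by rewrite ltr_pdivlMr // mul1r.
have Z0 : 0 < Z.
  by rewrite mulr_gt0 ?powR_gt0 // addr_gt0 // invr_gt0 subr_gt0.
have powA (r : R) : 0 < r -> A `^ r < 1.
  by move=> r0; rewrite /powR gt_eqF // expR_lt1 pmulr_rlt0 // ln_lt0 // A0.
pose h := A `^ ((1 - s') / 2); have h0 : 0 < h by rewrite powR_gt0.
have h1 : h < 1 by apply: powA; rewrite divr_gt0 // subr_gt0.
(* The proportion of length that each further letter must preserve; [M] is then chosen so that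
   larger letters cost at most [1 - gam]. *)
pose gam := h `^ m%:R^-1; have gam0 : 0 < gam by rewrite powR_gt0.
have gamm : gam ^+ m = h.
  by rewrite -powR_mulrn ?(ltW gam0) // -powRrM mulVf ?pnatr_eq0 ?gt_eqF // powRr1 // ltW.
have gam1 : gam < 1.
  by rewrite /gam /h -powRrM powA // mulr_gt0 ?invr_gt0 ?ltr0n // divr_gt0 // subr_gt0.
have L0 : 0 < L by apply: lt_le_trans L1.
have [M0 M00 hM0] := rend_cofinal hf (ltac:(rewrite gtrBl divr_gt0 // subr_gt0 //) : 1 - (1 - gam) / L < 1).
pose M := maxn M0 2; have Mgt0 : (0 < M)%N by rewrite leq_max M00.
have hM : gam <= 1 - L * (1 - rend f M).
  have : 1 - (1 - gam) / L <= rend f M.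
    exact: le_trans hM0 (rend_le_rend hf M00 (leq_maxl _ _)).
  rewrite lerBlDr -lerBlDl ler_pdivlMr // => hh; rewrite mulrC; move: hh; clear; lra.
have hinv : 1 < h^-1 by rewrite invf_gt1.
have [k0 k0P] := expr_superlinear (Z + 1) hinv.
pose k := k0.+1.
have Zhk : Z * h ^+ k < 1.
  have := k0P k (leqnSn _); rewrite exprVn -[X in _ <= X]mul1r ler_pdivlMr ?exprn_gt0 // => hh.
  apply: lt_le_trans hh; rewrite ltr_pM2r ?exprn_gt0 //.
  have : 1 <= k%:R :> R by rewrite ler1n.
  by move: Z0; move: (k%:R : R); clear; move=> y *; nra.
pose D (_ : nat) := iota 1 M.
have lenw w : w \in words D (m * k)%N -> word w /\ size w = (m * k)%N.
  move=> /words_mem[sw wD]; split=> //.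
  by apply/(all_nthP 0%N) => i; rewrite sw => /wD; rewrite mem_iota => /andP[].
have [|||W [rho [uW subW rho0 rhoW HW]]] := @many_long_words R _ (words D (m * k))
    (interval_length f) s s' Lam (A ^+ k) s0 ss' s'1 Lam0.
- by apply: words_uniq => i; exact: iota_uniq.
- by move=> w /lenw[ww sw]; rewrite (interval_length_gt0 hf ww) HA.
- have hE : (A ^+ k) `^ (1 - s') = h ^+ k * h ^+ k.
    rewrite -!powR_mulrn ?(ltW A0) ?(ltW h0) // -powRrM mulrC powRrM.
    have -> : A `^ (1 - s') = h * h.
      by rewrite /h -powRD; [congr (_ `^ _); field|rewrite (gt_eqF A0) implybT].
    by rewrite powRM // ltW.
  rewrite hE -/Z; apply: lt_le_trans (_ : h ^+ k <= _).
    by rewrite -mulrA mulrC gtr_pMl ?exprn_gt0 // mulrC.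
  apply: le_trans (sum_length_words hf (m * k) L1 HL Mgt0 (le_trans (ltW gam0) hM)).
  rewrite -gamm -exprM; apply: lerXn2r => //; rewrite nnegrE ltW //.
  exact: lt_le_trans hM.
exists (m * k)%N, M, W, rho; split=> //.
- split=> //; rewrite -(ltr_nat R).
  have W0 : (0 < size W)%N.
    rewrite lt0n; apply/eqP => W0; move: HW; rewrite W0 mul0r leNgt Lam0 //.
  have w0 : nth [::] W 0 \in W by rewrite mem_nth.
  have [ww sw] := lenw _ (subW _ w0).
  have rho1 : rho <= 1.
    apply: le_trans (rhoW _ w0) _; apply: le_trans (HA k _ ww sw) _.
    by rewrite exprn_ile1 // ltW.
  have rs : rho `^ s <= 1.
    have : rho `^ s <= 1 `^ s by apply: ge0_ler_powR; rewrite ?nnegrE ?(ltW s0) // ltW.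
    by rewrite powR1.
  apply: lt_le_trans (_ : 2 <= _); first by rewrite ltr1n.
  apply: le_trans Lam2 (le_trans HW _); by rewrite ler_piMr.
- by move=> v vW; have [wv sv] := lenw v (subW v vW); split=> //; exact: rhoW.
- move=> v b vW /(nthP 0%N)[i]; have /words_mem[sv vD] := subW v vW.
  by rewrite sv => /vD + <-; rewrite mem_iota => /andP[_]; rewrite add1n ltnS.
Qed.

(** Every block loses a constant through distortion and a power of its big letter. The choices of
    words outweigh the constant with a factor [expR 1] per block to spare, and the resulting
    [expR n] pays for the big letters up to a constant. *)
Lemma hausdorff_dim_bounded_distortion_lower (R : realType) (d : R)
    (f : nat -> R -> R) (a : R) (phi : R -> R) (alpha s : R) :
  d_decaying_gauss_like d f ->
  (forall j : nat, (0 < j)%N -> potential_value f phi j = j%:R `^ a) ->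
  1 < d -> 0 < a -> 0 < alpha -> alpha < 2^-1 -> bounded_distortion f ->
  0 < s -> s < 1 ->
  (s%:E <= hausdorff_dim (birkhoff_level_set f phi
    (fun n => expR (n%:R `^ alpha))))%E.
Proof.
move=> hf hval hd ha al0 al2 bd s0 s1.
have [K [L [K0 K1 L1 HKL]]] := bounded_distortion_bounds hf bd.
have HK v w : word v -> word w ->
    K * (interval_length f v * interval_length f w) <= interval_length f (v ++ w).
  by move=> wv ww; have /andP[] := HKL v w wv ww.
have HL v w : word v -> word w -> interval_length f (v ++ w) <=
    L * (interval_length f v * interval_length f w).
  by move=> wv ww; have /andP[] := HKL v w wv ww.
have [k1 [k2 [k10 k20 Hk]]] := map_bounds hf (ltr01 : 0 < (1 : R)).
set p := d + 1 in Hk; have p0 : 0 < p by rewrite addr_gt0 // (lt_trans ltr01).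
have w2 : word [:: 2%N] by []. have w1 : word [:: 1%N] by [].
have len0 w := @interval_length_gt0 _ _ _ hf w.
(* One [K] for each concatenation: prefix with block, chosen word with the last two letters, and 2
   with the big letter. *)
pose D := K ^+ 3 * interval_length f [:: 2%N] * k1.
have D0 : 0 < D by rewrite !mulr_gt0 ?exprn_gt0 ?len0.
(* The first value leaves a factor [expR 1] per block after the loss [D ^ s]; the value 2 forces at
   least two words. *)
pose Lam := Num.max (expR 1 / D `^ s) 2.
have Lam2 : 2 <= Lam by rewrite le_max lexx orbT.
have LamD : expR 1 <= Lam * D `^ s.
  by rewrite -ler_pdivrMr ?powR_gt0 // le_max lexx.
have [l [M [W [rho [[uW W1] rho0 WP WM LamW]]]]] := exists_long_words hf L1 HL s0 s1 Lam2.
have sizeW v : v \in W -> size v = l by move=> /WP[].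
have wordW v : v \in W -> word v by move=> /WP[].
pose P := l.+2; pose big := @big_letter R alpha a P.
have big0 r : (0 < big r)%N by [].
pose t := size W; pose c := block_letter l W big.
have Wn (s' : nat -> nat) r : (s' r < t)%N -> nth [::] W (s' r) \in W by move=> ?; rewrite mem_nth.
have c_gt0 s' : (forall i, (s' i < t)%N) -> forall i, (0 < c s' i)%N.
  by move=> sr; exact: block_letter_gt0.
pose U s' r := mkseq (c s') (r * P).
have US s' r : (s' r < t)%N -> U s' r.+1 = U s' r ++ block W big s' r.
  by move=> sr; exact: mkseq_block_letter.
have wordU s' r : (forall i, (s' i < t)%N) -> word (U s' r).
  by move=> sr; apply: word_mkseq; exact: c_gt0.
pose x1 := interval_length f [:: 1%N]; have x10 : 0 < x1 by exact: len0.
pose x3 := interval_length f [:: 3%N]; have x30 : 0 < x3 by apply: len0.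
(* A point in the child 2 of [u ++ v1] is separated from the exterior by the child 1 on one side and
   the child 3 on the other. One [K] splits off that child, the other splits off [v1]. *)
pose kap := K * (K * (rho * Num.min x1 x3)).
have kap0 : 0 < kap by rewrite !mulr_gt0 // lt_min x10 x30.
have len_big r : k1 / (big r)%:R `^ p <= interval_length f [:: big r].
  have wb : word [:: big r] by [].
  rewrite (interval_lengthE hf wb) /=.
  have /andP[h _] := Hk (big r) 1 0 (big0 r) (introT andP (conj ler01 (lexx 1)))
     (introT andP (conj (lexx 0) ler01)).
  by apply: le_trans h; rewrite subr0 normr1 mulr1.
have lenU s' n : (forall i, (s' i < t)%N) ->
    \prod_(i < n) (rho * D / (big i)%:R `^ p) <= interval_length f (U s' n).
  move=> sr; elim: n => [|n IH].
    by rewrite big_ord0 /U mul0n (interval_length_nil hf).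
  rewrite big_ord_recr /= US // /block.
  have [wv sv rv] := WP _ (Wn s' n (sr n)).
  set v := nth [::] W (s' n) in wv rv *.
  have wb : word [:: big n] by [].
  have w2b : word [:: 2%N; big n] by [].
  have h1 := HK _ _ w2 wb; have h2 := HK _ _ wv w2b.
  have wvb : word (v ++ [:: 2%N; big n]) by rewrite /word all_cat wv.
  have h3 := HK _ _ (wordU s' n sr) wvb.
  apply: le_trans h3.
  have g2 := len0 _ w2; have gb := len_big n; have gU := len0 _ (wordU s' n sr).
  have B0 : 0 < k1 / (big n)%:R `^ p by rewrite divr_gt0 // powR_gt0 // ltr0n.
  have P0 : 0 <= \prod_(i < n) (rho * D / (big i)%:R `^ p).
    by apply: prodr_ge0 => i _; rewrite divr_ge0 ?powR_ge0 // mulr_ge0 // ltW.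
  have step : rho * D / (big n)%:R `^ p <= K * interval_length f (v ++ [:: 2%N; big n]).
    apply: le_trans (_ : K * (K * (rho * (K * (interval_length f [:: 2%N] *
       (k1 / (big n)%:R `^ p))))) <= _); last first.
      rewrite ler_pM2l //; apply: le_trans h2; rewrite ler_pM2l //.
      apply: ler_pM => //; first exact: ltW.
        by rewrite mulr_ge0 ?(ltW K0) // mulr_ge0 ?(ltW g2) // ltW.
      by apply: le_trans h1; rewrite ler_pM2l // ler_pM2l.
    by rewrite /D le_eqVlt; apply/orP; left; apply/eqP; ring.
  rewrite [leRHS]mulrCA; apply: ler_pM => //.
  by rewrite divr_ge0 ?powR_ge0 // mulr_ge0 // ltW.
have [C0 C0P] := @sum_ln_big_letter_le R alpha a P al0 al2 ha (p * s).
have tR : 0 < t%:R :> R by rewrite ltr0n (ltn_trans _ W1).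
(* A mass distribution estimate: the uniform weight [t ^ (- n)] of a choice of [n] words is at most
   a constant times the [s]-th power of the length of its cylinder. *)
have mass s' n : (forall i, (s' i < t)%N) ->
    (t%:R ^+ n)^-1 <= expR C0 * interval_length f (U s' n) `^ s.
  move=> sr; rewrite -[leLHS]mul1r ler_pdivrMr ?exprn_gt0 // -mulrA.
  rewrite -[leLHS](expRxMexpNx_1 C0) ler_pM2l ?expR_gt0 //.
  apply: le_trans (_ : (\prod_(i < n) (rho * D / (big i)%:R `^ p)) `^ s * t%:R ^+ n <= _);
    last first.
    rewrite ler_pM2r ?exprn_gt0 //; apply: ge0_ler_powR; rewrite ?nnegrE ?(ltW s0) //.
    - by apply: prodr_ge0 => i _; rewrite divr_ge0 ?powR_ge0 // mulr_ge0 // ltW.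
    - exact/ltW/len0/wordU.
    - exact: lenU.
  rewrite prod_powR => [|i]; last by rewrite divr_ge0 ?powR_ge0 // mulr_ge0 // ltW.
  have -> : t%:R ^+ n = \prod_(i < n) (t%:R : R) by rewrite prodr_const card_ord.
  rewrite -big_split /=.
  apply: le_trans (_ : \prod_(i < n) expR (1 - p * s * ln (big i)%:R) <= _).
    rewrite -expR_sum ler_expR sumrB sumr_const card_ord -mulr_sumr.
    by have := C0P n; rewrite -/big; lra.
  apply: ler_prod => i _; rewrite expR_ge0 /=.
  have b0 : 0 < (big i)%:R :> R by rewrite ltr0n.
  have bp : 0 < (big i)%:R `^ p :> R by rewrite powR_gt0.
  have ib : 0 <= ((big i)%:R `^ p)^-1 :> R by rewrite invr_ge0 ltW.
  rewrite (powRM s (ltW (mulr_gt0 rho0 D0)) ib) (powRM s (ltW rho0) (ltW D0)) expRB.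
  have -> : (((big i)%:R `^ p)^-1) `^ s = (expR (p * s * ln (big i)%:R))^-1 :> R.
    by rewrite -powRN -powRrM mulNr powRN /powR gt_eqF.
  rewrite [leRHS]mulrAC ler_pM2r ?invr_gt0 ?expR_gt0 //.
  apply: (le_trans LamD); rewrite mulrAC ler_pM2r ?powR_gt0 // mulrC //.
apply: (@hausdorff_dim_ge_of_code R d f a phi hf hval
   (fun n => expR (n%:R `^ alpha)) (fun=> t) c
   (expR C0 / kap `^ s)) => //.
  move=> s' sr; split; first exact: c_gt0.
    move=> n; exists (n * P + l)%N; last by rewrite /c (block_letter_two big sizeW).
    by apply: leq_trans (leq_addr _ _); rewrite leq_pmulr.
  apply: (@sparse_power_sum_cvg R alpha a P al0 al2 ha (ltn0Sn _) _ ((maxn M 2)%:R `^ a)).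
  move=> n; have := @block_letter_power_sum R a l W big (maxn M 2) s' ha sizeW _ _ sr n.
  apply => //.
    by move=> v b vW bv; rewrite leq_max (WM v b).
  by rewrite leq_max orbT.
move=> s1' s2' n x y sr1 sr2 agree lt12 cx cy.
have UE : U s2' n = U s1' n by apply: eq_mkseq_block_letter => i /agree.
set u := U s1' n in UE; have wu : word u by exact: wordU.
set v1 := nth [::] W (s1' n); set v2 := nth [::] W (s2' n).
have [wv1 sv1 rv1] := WP _ (Wn s1' n (sr1 n)); rewrite -/v1 in wv1 sv1 rv1.
have [wv2 sv2 rv2] := WP _ (Wn s2' n (sr2 n)); rewrite -/v2 in wv2 sv2 rv2.
have wuv : word (u ++ v1) by rewrite /word all_cat wu.
have wuv2 : word (u ++ v2) by rewrite /word all_cat wu.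
pose g := comp_word f (u ++ v1).
have [Lg HLg] := comp_word_lipschitz hf wuv.
have [z1 z101 xE] : exists2 z, 0 <= z <= 1 & x = g (f 2 z).
  have := cx (n.+1 * P)%N; rewrite -/(U s1' n.+1) US //.
  move=> /basic_intervalP[z z01 <-]; exists (f (big n) z); first exact: (map01 hf (big0 n)).
  by rewrite /g /block catA !comp_word_cat.
have yI : basic_interval f (u ++ v2) y.
  have := cy (n.+1 * P)%N; rewrite -/(U s2' n.+1) US // UE.
  move=> /basic_intervalP[z z01 <-]; apply/basic_intervalP.
  exists (comp_word f [:: 2%N; big n] z); first exact: (comp_word01 hf).
  by rewrite /block catA [in RHS]comp_word_cat.
(* [y] lies in the cylinder of [u ++ v2], another word of the same length, because [W] has no
   repetition; hence it is not interior to that of [u ++ v1]. *)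
have yout z : 0 < z < 1 -> g z <> y.
  move=> z01 gz; rewrite -gz in yI.
  have := interior_coding_unique hf wuv wuv2 _ z01 yI.
  rewrite !size_cat sv1 sv2 => /(_ erefl) /eqP; rewrite eqseq_cat // eqxx /=.
  rewrite nth_uniq // => /eqP E; move: lt12; rewrite E ltnn //.
have r2l3 : lend f 3 = rend f 2 by exact: (rend_lendS hf).
have l2r1 : lend f 2 = rend f 1 by exact: (rend_lendS hf).
have /andP[m1 m2] := map_between hf (isT : (0 < 2)%N) z101.
have dist : kap * interval_length f u <= `|x - y|.
  have r10 : 0 <= rend f 1 by rewrite -l2r1 (lend_ge0 hf).
  have r33 : rend f 2 <= rend f 3 by apply: (rend_le_rend hf).
  have r31 := ltW (rend_lt1 hf (isT : (0 < 3)%N)).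
  rewrite l2r1 in m1.
  have := @dist_outside_image01 R g Lg (rend f 1) (rend f 2) (rend f 3) (f 2 z1) y
    HLg (fun x y => @comp_word_inj _ _ _ hf _ x y wuv) r10 m1 m2 r33 r31 yout.
  rewrite -xE; apply: le_trans; rewrite -(lend1 hf) -r2l3.
  rewrite -!(interval_length_rcons hf wuv) // -!cats1.
  have h1 := HK _ _ wuv w1; have h3 := HK _ _ wuv (isT : word [:: 3%N]).
  have huv := HK _ _ wu wv1.
  have low : K * (interval_length f u * rho) <= interval_length f (u ++ v1).
    by apply: le_trans huv; rewrite ler_pM2l // ler_pM2l // len0.
  have fin x' : Num.min x1 x3 <= x' -> kap * interval_length f u <=
      K * (interval_length f (u ++ v1) * x').
    move=> mx.
    have -> : kap * interval_length f u =
      K * (K * (interval_length f u * rho) * Num.min x1 x3) by rewrite /kap; ring.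
    rewrite ler_pM2l //; apply: ler_pM => //.
      by rewrite mulr_ge0 ?(ltW K0) // mulr_ge0 ?(ltW rho0) // ltW // len0.
    by rewrite le_min !ltW.
  rewrite le_min (le_trans _ h1) ?(le_trans _ h3) //.
    by apply: fin; rewrite ge_min lexx orbT.
  by apply: fin; rewrite ge_min lexx.
have prodE : (radix_prod (fun=> t) n.+1)%:R = t%:R ^+ n * t%:R :> R.
  by rewrite radix_prodS natrM /radix_prod prod_nat_const card_ord natrX.
have xy0 : 0 <= kap * interval_length f u by rewrite mulr_ge0 // ltW // len0.
(* With a constant number [t] of choices the last digit can be given up. *)
apply: le_trans (_ : (t%:R ^+ n)^-1 <= _).
  rewrite prodE invfM mulrCA ler_piMr ?invr_ge0 ?exprn_ge0 // ler_pdivrMr // mul1r.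
  by rewrite ler_nat (leq_trans _ (sr2 n)) // ltnS leq_subr.
apply: le_trans (mass s1' n sr1) _; rewrite -/u -mulrA ler_pM2l ?expR_gt0 //.
rewrite ler_pdivlMl ?powR_gt0 // -powRM ?(ltW kap0) ?(ltW (len0 _ wu)) //.
by apply: ge0_ler_powR; rewrite ?nnegrE ?(ltW s0).
Qed.

(** * The dimension formulas *)

Lemma hausdorff_measure_unit_interval (R : realType) (A : set R) (s : R) : 1 < s ->
  (forall x, A x -> 0 < x < 1) -> hausdorff_measure s A = 0%E.
Proof.
move=> s1 A01; apply: (@hausdorff_measure_subset R s A (\bigcup_(N : nat) A)).
  by move=> x Ax; exists 0%N.
have s0 : 0 < s by apply: lt_trans s1.
apply: hausdorff_measure_bigcup_eq0 => // _ e e0.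
(* A cover by [n] intervals of length [1 / n] has [s]-sum [n ^ (1 - s)]. *)
have [n0 n0P] := powR_unbounded (e^-1) (ltac:(rewrite subr_gt0 //) : 0 < s - 1).
pose n := n0.+1; have n_gt0 : 0 < n%:R :> R by rewrite ltr0n.
exists nat, (iota 0 n), (fun i => [set x | i%:R / n%:R <= x <= i.+1%:R / n%:R]),
  (fun=> n%:R^-1); split.
- move=> x /A01/andP[x0 x1]; pose i := Num.truncn (n%:R * x).
  have nx0 : 0 <= n%:R * x by rewrite mulr_ge0 // ltW.
  have /andP[h1 h2] := truncn_itv nx0.
  exists i.
    rewrite mem_iota add0n -(ltr_nat R); apply: le_lt_trans h1 _.
    by rewrite gtr_pMr.
  by rewrite /= ler_pdivrMr // ler_pdivlMr // mulrC h1 ltW.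
- move=> i _; split; first by rewrite invr_ge0.
  move=> x y /= /andP[a1 a2] /andP[b1 b2].
  move: a2 b2; rewrite -natr1 mulrDl mul1r => a2 b2.
  by rewrite ler_distl; apply/andP; split; move: a1 a2 b1 b2; lra.
rewrite big_const_seq count_predT size_iota iter_addr_0 -(mulr_natl (n%:R^-1 `^ s) n).
have -> : n%:R^-1 `^ s = n%:R `^ (- s) :> R.
  by rewrite -powR_inv1 // -powRrM mulN1r.
have := n0P n (leqnSn _).
have -> : n%:R * n%:R `^ (- s) = (n%:R `^ (s - 1))^-1 :> R.
  rewrite -powRN opprB -{1}(powRr1 (ltW n_gt0)) -powRD //.
  by rewrite (gt_eqF n_gt0) implybT.
by move=> h; rewrite -[leRHS]invrK lef_pV2 ?posrE ?invr_gt0 ?powR_gt0.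
Qed.

Theorem theorem1p2 (R : realType) (d : R) (f : nat -> R -> R) (a : R)
    (phi : R -> R) (hd : 1 < d) (hf : d_decaying_gauss_like d f) (ha : 0 < a)
    (hphi : potential f phi)
    (hval : forall j : nat, (0 < j)%N ->
       potential_value f phi j = j%:R `^ a) :
  (forall alpha : R, 0 < alpha ->
     let E := birkhoff_level_set f phi (fun n => expR (n%:R `^ alpha)) in
     (alpha < 2^-1 -> bounded_distortion f -> hausdorff_dim E = 1%E) /\
     (2^-1 < alpha -> hausdorff_dim E = (d^-1)%:E)) /\
  (forall beta : R, 1 < beta ->
     hausdorff_dim (birkhoff_level_set f phi (fun n => expR (beta ^+ n))) =
       ((d * beta - beta + 1)^-1)%:E).
Proof.
have d0 : 0 < d by apply: lt_trans hd.
split=> [alpha al0 E|beta beta1]; first split=> [al2 bd|al2].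
- apply: hausdorff_dim_eq => // [s s1|th th0 th1].
    by apply: hausdorff_measure_unit_interval => // x [].
  exact: hausdorff_dim_bounded_distortion_lower hf hval hd ha al0 al2 bd th0 th1.
- apply: hausdorff_dim_eq; first by rewrite invr_gt0.
    by move=> s ds; exact: hausdorff_measure_subexp_upper hf hd ha hval _ _ al2 ds.
  by move=> th th0 thd; exact: hausdorff_dim_subexp_lower hf hval hd ha al0 th0 thd.
- apply: hausdorff_dim_eq.
  + rewrite invr_gt0; have -> : d * beta - beta + 1 = (d - 1) * beta + 1 by ring.
    by rewrite addr_gt0 // mulr_gt0 ?subr_gt0 // (lt_trans ltr01).
  + by move=> s hs; exact: hausdorff_measure_superexp_upper hf hd ha hval beta1 hs.
  + by move=> th th0 thd; exact: hausdorff_dim_superexp_lower hf hval hd ha beta1 th0 thd.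
Qed.
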